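(* Let $f(x,y,p)$ be a smooth function and consider the path geometry corresponding to the second-order ODE $y''=f(x,y,y')$, i.e. the 3-manifold $J^1(\mathbb{R},\mathbb{R})=\mathbb{R}^3$ with coordinates $(x,y,p)$ and the line fields $L_1=\mathrm{Span}(\partial_p)$, $L_2=\mathrm{Span}(\partial_x+p\,\partial_y+f(x,y,p)\,\partial_p)$. The chains of this path geometry (those which are graphs over the $x$-axis) are the curves in $J^1(\mathbb{R},\mathbb{R})$ which are the graphs $x\mapsto(x,y(x),p(x))$ of solutions $(y(x),p(x))$ of the system $$y''=f+f_p\Delta+\tfrac12f_{pp}\Delta^2+\tfrac16f_{ppp}\Delta^3,$$ $$p''=-\frac{2(p'-f)^2}{\Delta}+f_p(3p'-2f)+f_x+pf_y+\left[f_{pp}(p'-f)+2f_y\right]\Delta+\tfrac16\left[f_{ppp}(p'-2f)-f_{xpp}+4f_{yp}-pf_{ypp}\right]\Delta^2,$$ where $\Delta=y'-p$ (assumed non-vanishing) and $f$ and its partial derivatives are evaluated at $(x,y(x),p(x))$.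
   Context: **Fefferman metric.** A path geometry is a smooth 3-manifold $M$ with an ordered pair of smooth line fields $L_1,L_2\subset TM$ spanning a contact distribution $D=L_1\oplus L_2$. Let $D^*=D\setminus(L_1\cup L_2)$ and $\mathbb{S}D^*$ the bundle over $M$ of rays $[X]=\mathbb{R}^+X$, $X\in D^*$. Let $J\in\mathrm{End}(D)$, $J(X_1+X_2)=X_1-X_2$ for $X_i\in L_i$. Fix a contact form $\eta^3$, $D=\ker\eta^3$. Adapted coframes are the local coframes $(\eta^1,\eta^2,\eta^3)$ with $d\eta^3=\eta^1\wedge\eta^2$, $\eta^1|_{L_2}=0$, $\eta^2|_{L_1}=0$. They are the local sections of a principal $\mathbb{R}^*$-bundle $B\to M$, a subbundle of the coframe bundle, with $s\in\mathbb{R}^*$ acting by $(\eta^1,\eta^2,\eta^3)\mapsto(\eta^1/s,s\eta^2,\eta^3)$. Let $\omega^1,\omega^2,\omega^3$ be the tautological 1-forms on $B$. There is a unique $\mathbb{R}^*$-connection form $\alpha$ on $B$ with $$d\omega^1=-\alpha\wedge\omega^1+a_1\,\omega^2\wedge\omega^3,\quad d\omega^2=\alpha\wedge\omega^2+a_2\,\omega^3\wedge\omega^1,\quad d\omega^3=\omega^1\wedge\omega^2$$ for some functions $a_1,a_2$; moreover $d\alpha=b_1\omega^2\wedge\omega^3+b_2\omega^3\wedge\omega^1+K\omega^1\wedge\omega^2$ for some functions $b_1,b_2,K$. Set $\sigma=-\frac23\alpha+\frac16K\omega^3$ and $\mathrm{g}=\omega^1\cdot\omega^2+\omega^3\cdot\sigma$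 ($\cdot$ is the symmetric product of 1-forms), a metric of signature $(2,2)$ on $B$. The map $h:B\to\mathbb{S}D^*$, $h(u)=[X]$ with $u^1(X)=u^2(X)=1$, $u^3(X)=0$, is a diffeomorphism onto an open subset $\mathbb{S}D^+$, and $J\circ h$ is a diffeomorphism onto the complement $\mathbb{S}D^-$; transporting $\mathrm{g}$ by $h$ and $J\circ h$ gives a metric on $\mathbb{S}D^*$ whose conformal class does not depend on $\eta^3$. This is the Fefferman conformal class. **Chains.** A chain is the projection to $M$ of an unparametrized non-vertical null geodesic of the Fefferman conformal metric on $\mathbb{S}D^*$ (vertical meaning contained in a fiber of $\mathbb{S}D^*\to M$); chains are understood to be curves transverse to $D$. Here $D=\ker(dy-p\,dx)$, so for a curve $x\mapsto(x,y(x),p(x))$ transversality to $D$ means $\Delta=y'-p\ne0$. *)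

(* Defs.v *)
From HB Require Import structures.
From mathcomp Require Import all_boot all_order all_algebra.
From mathcomp Require Import all_classical all_reals all_analysis.

Set Implicit Arguments.
Unset Strict Implicit.
Unset Printing Implicit Defensive.

Import Order.TTheory GRing.Theory Num.Theory.
Import numFieldNormedType.Exports.

Local Open Scope ring_scope.
Local Open Scope classical_set_scope.

(* Tensor calculus on open subsets of R^n in the standard coordinates.  A
   1-form is the row of its coefficients, a 2-form or a symmetric bilinear
   form is the matrix of its values on pairs of coordinate vectors. *)

Section Calculus.
Context {R : realType} {n : nat}.
Implicit Types (U : set 'rV[R]_n.+1) (q v : 'rV[R]_n.+1).

Definition partial (i : 'I_n.+1) (F : 'rV[R]_n.+1 -> R) : 'rV[R]_n.+1 -> R :=
  fun q => 'D_(delta_mx 0 i) F q.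

(* C^infinity on an open set: every iterated partial derivative exists and is
   differentiable *)
Definition smooth_on U (F : 'rV[R]_n.+1 -> R) : Prop :=
  forall (s : seq 'I_n.+1) q, U q -> differentiable (foldr partial F s) q.

Definition smooth_form_on U (w : 'rV[R]_n.+1 -> 'rV[R]_n.+1) : Prop :=
  forall i, smooth_on U (fun q => w q 0 i).

Definition pairing (a v : 'rV[R]_n.+1) : R := \sum_i a 0 i * v 0 i.

(* conventions: (a /\ b)(v, w) = a(v) b(w) - a(w) b(v), and
   dw(e_i, e_j) = d_i w_j - d_j w_i *)
Definition wedge (a b : 'rV[R]_n.+1) : 'M[R]_n.+1 := a^T *m b - b^T *m a.

Definition extd (w : 'rV[R]_n.+1 -> 'rV[R]_n.+1) q : 'M[R]_n.+1 :=
  \matrix_(i, j) (partial i (fun x => w x 0 j) q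
                  - partial j (fun x => w x 0 i) q).

Definition symprod (a b : 'rV[R]_n.+1) : 'M[R]_n.+1 :=
  2^-1 *: (a^T *m b + b^T *m a).

Definition christoffel (g : 'rV[R]_n.+1 -> 'M[R]_n.+1) q (k i j : 'I_n.+1) : R :=
  2^-1 * \sum_l invmx (g q) k l *
    (partial i (fun x => g x j l) q + partial j (fun x => g x i l) q
     - partial l (fun x => g x i j) q).

Definition twice_derivable_on {m : nat} (I : set R) (c : R -> 'rV[R]_m.+1) : Prop :=
  forall t, I t -> derivable c t 1 /\ derivable (derive1 c) t 1.

(* affinely parametrized null geodesics of a metric g defined on U *)
Definition null_geodesic U (g : 'rV[R]_n.+1 -> 'M[R]_n.+1) (I : set R)
    (c : R -> 'rV[R]_n.+1) : Prop :=
  [/\ forall t, I t -> U (c t),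
      twice_derivable_on I c,
      forall t, I t -> forall k,
        derive1 (derive1 c) t 0 k
        + \sum_i \sum_j christoffel g (c t) k i j * derive1 c t 0 i * derive1 c t 0 j = 0
    & forall t, I t ->
        \sum_i \sum_j g (c t) i j * derive1 c t 0 i * derive1 c t 0 j = 0].

(* the metrics on U conformal to g *)
Definition conformal_class U (g g' : 'rV[R]_n.+1 -> 'M[R]_n.+1) : Prop :=
  exists lam : 'rV[R]_n.+1 -> R,
    [/\ smooth_on U lam, forall q, U q -> 0 < lam q
      & forall q, U q -> g' q = lam q *: g q].

Definition line_span (X : 'rV[R]_n.+1 -> 'rV[R]_n.+1) q : set 'rV[R]_n.+1 :=
  [set v | exists c : R, v = c *: X q].

End Calculus.

Definition open_interval {R : realType} (I : set R) : Prop :=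
  [/\ open I, is_interval I & I !=set0].

Section PathGeometry.
Context {R : realType}.

(* A line field on M = R^3, as the set of tangent vectors it contains at each
   point. *)
Context (L1 L2 : 'rV[R]_3 -> set 'rV[R]_3).
Implicit Types (q v w X : 'rV[R]_3).

Definition contact_plane q : set 'rV[R]_3 :=
  [set v | exists v1 v2, [/\ L1 q v1, L2 q v2 & v = v1 + v2]].

Definition contact_star q : set 'rV[R]_3 :=
  contact_plane q `\` (L1 q `|` L2 q).

(* the graph of the endomorphism J of the contact plane at q *)
Definition J_graph q v w : Prop :=
  exists v1 v2, [/\ L1 q v1, L2 q v2, v = v1 + v2 & w = v1 - v2].

Definition same_ray v w : Prop := exists2 c : R, 0 < c & w = c *: v.

Definition contact_form (eta3 : 'rV[R]_3 -> 'rV[R]_3) : Prop :=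
  smooth_form_on setT eta3 /\
  forall q v, pairing (eta3 q) v = 0 <-> contact_plane q v.

Definition adapted_coframe (eta1 eta2 eta3 : 'rV[R]_3 -> 'rV[R]_3) : Prop :=
  [/\ smooth_form_on setT eta1, smooth_form_on setT eta2,
      forall q, row_free (col_mx (eta1 q) (col_mx (eta2 q) (eta3 q))),
      forall q, extd eta3 q = wedge (eta1 q) (eta2 q)
    & forall q, (forall v, L2 q v -> pairing (eta1 q) v = 0) /\
                (forall v, L1 q v -> pairing (eta2 q) v = 0)].

(* A global adapted coframe is a section of the R^*-bundle B over M = R^3 and
   identifies B with the open set {(q, s) | s <> 0} of R^3 x R, the point
   (q, s) being the coframe (eta1 / s, s eta2, eta3) at q. *)

Definition base (u : 'rV[R]_(3 + 1)) : 'rV[R]_3 := lsubmx u.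
Definition fib (u : 'rV[R]_(3 + 1)) : R := rsubmx u 0 0.

Definition bundle : set 'rV[R]_(3 + 1) := [set u | fib u != 0].

(* The action of r in R^*; being linear in these coordinates, it is also its
   own differential. *)
Definition act (r : R) (u : 'rV[R]_(3 + 1)) : 'rV[R]_(3 + 1) :=
  row_mx (base u) (r *: rsubmx u).

(* value at u of the vector field generating the action *)
Definition fundamental (u : 'rV[R]_(3 + 1)) : 'rV[R]_(3 + 1) :=
  row_mx 0 (rsubmx u).

Section Fefferman.
Context (eta1 eta2 eta3 : 'rV[R]_3 -> 'rV[R]_3).

Definition coframe1 (u : 'rV[R]_(3 + 1)) : 'rV[R]_3 := (fib u)^-1 *: eta1 (base u).
Definition coframe2 (u : 'rV[R]_(3 + 1)) : 'rV[R]_3 := fib u *: eta2 (base u).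
Definition coframe3 (u : 'rV[R]_(3 + 1)) : 'rV[R]_3 := eta3 (base u).

(* tautological 1-forms: pullbacks to B of the coframe *)
Definition omega1 (u : 'rV[R]_(3 + 1)) : 'rV[R]_(3 + 1) := row_mx (coframe1 u) 0.
Definition omega2 (u : 'rV[R]_(3 + 1)) : 'rV[R]_(3 + 1) := row_mx (coframe2 u) 0.
Definition omega3 (u : 'rV[R]_(3 + 1)) : 'rV[R]_(3 + 1) := row_mx (coframe3 u) 0.

Definition connection_form (alpha : 'rV[R]_(3 + 1) -> 'rV[R]_(3 + 1)) : Prop :=
  [/\ smooth_form_on bundle alpha,
      forall u, bundle u -> pairing (alpha u) (fundamental u) = 1
    & forall (r : R) (u v : 'rV[R]_(3 + 1)), r != 0 -> bundle u ->
        pairing (alpha (act r u)) (act r v) = pairing (alpha u) v].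

Definition structure_equations (alpha : 'rV[R]_(3 + 1) -> 'rV[R]_(3 + 1))
    (a1 a2 b1 b2 K : 'rV[R]_(3 + 1) -> R) : Prop :=
  forall u, bundle u ->
  [/\ extd omega1 u = - wedge (alpha u) (omega1 u)
                      + a1 u *: wedge (omega2 u) (omega3 u),
      extd omega2 u = wedge (alpha u) (omega2 u)
                      + a2 u *: wedge (omega3 u) (omega1 u),
      extd omega3 u = wedge (omega1 u) (omega2 u)
    & extd alpha u = b1 u *: wedge (omega2 u) (omega3 u)
                     + b2 u *: wedge (omega3 u) (omega1 u)
                     + K u *: wedge (omega1 u) (omega2 u)].

Definition fefferman_metric (g : 'rV[R]_(3 + 1) -> 'M[R]_(3 + 1)) : Prop :=
  exists alpha a1 a2 b1 b2 K,
    [/\ connection_form alpha,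
        structure_equations alpha a1 a2 b1 b2 K
      & forall u, bundle u ->
          let sigma := - (2 / 3) *: alpha u + (6^-1 * K u) *: omega3 u in
          g u = symprod (omega1 u) (omega2 u) + symprod (omega3 u) sigma].

(* [h_graph u X]: X is the vector at [base u] whose ray is h(u) *)
Definition h_graph (u : 'rV[R]_(3 + 1)) X : Prop :=
  [/\ pairing (coframe1 u) X = 1, pairing (coframe2 u) X = 1
    & pairing (coframe3 u) X = 0].

End Fefferman.

(* The curve t |-> [X t], a ray of D^* at the point q t, is a null geodesic of
   (a metric in) the Fefferman conformal class: it is the image under h or
   J o h of a null geodesic in B.  As I is connected, a continuous curve of
   rays lies entirely in one of the two parts SD^+ and SD^-. *)
Definition fefferman_null_geodesic (eta3 : 'rV[R]_3 -> 'rV[R]_3) (I : set R)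
    (q X : R -> 'rV[R]_3) : Prop :=
  (forall t, I t -> contact_star (q t) (X t)) /\
  exists eta1 eta2 g g' c,
    [/\ adapted_coframe eta1 eta2 eta3,
        fefferman_metric eta1 eta2 eta3 g /\ conformal_class bundle g g',
        null_geodesic bundle g' I c,
        forall t, I t -> q t = base (c t)
      & (forall t, I t -> exists2 Y, h_graph eta1 eta2 eta3 (c t) Y
                                   & same_ray Y (X t)) \/
        (forall t, I t -> exists Y Z,
           [/\ h_graph eta1 eta2 eta3 (c t) Y, J_graph (q t) Y Z
             & same_ray Z (X t)])].

(* Chains, as unparametrized curves: [c], a curve in M transverse to D and
   defined on the open interval I, becomes under a change of parameter the
   projection to M of a null geodesic not contained in a fiber. *)
Definition is_chain (eta3 : 'rV[R]_3 -> 'rV[R]_3) (I : set R)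
    (c : R -> 'rV[R]_3) : Prop :=
  (forall x, I x -> ~ contact_plane (c x) (derive1 c x)) /\
  exists (I' : set R) (phi : R -> R) (q X : R -> 'rV[R]_3),
    [/\ open_interval I',
        (forall x, I x -> [/\ derivable phi x 1, derivable (derive1 phi) x 1
                             & derive1 phi x != 0]) /\ phi @` I = I',
        fefferman_null_geodesic eta3 I' q X,
        ~ (exists m, forall t, I' t -> q t = m)
      & forall x, I x -> c x = q (phi x)].

End PathGeometry.

Section SecondOrderODE.
Context {R : realType}.
Implicit Types (f : 'rV[R]_3 -> R) (y p : R -> R) (I : set R).

Definition ix : 'I_3 := @Ordinal 3 0 isT.
Definition iy : 'I_3 := @Ordinal 3 1 isT.
Definition ip : 'I_3 := @Ordinal 3 2 isT.

Definition vec3 (a b c : R) : 'rV[R]_3 := \row_(i < 3) [:: a; b; c]`_i.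

Definition ode_L1 : 'rV[R]_3 -> set 'rV[R]_3 := line_span (fun=> vec3 0 0 1).
Definition ode_L2 f : 'rV[R]_3 -> set 'rV[R]_3 :=
  line_span (fun q => vec3 1 (q 0 ip) (f q)).

Definition jet_graph y p (x : R) : 'rV[R]_3 := vec3 x (y x) (p x).

Definition solves_chain_system f I y p : Prop :=
  forall x, I x ->
  let q := jet_graph y p x in
  let y' := derive1 y x in
  let p' := derive1 p x in
  let Delta := y' - p x in
  let f0 := f q in
  let fx := partial ix f q in
  let fy := partial iy f q in
  let fp := partial ip f q in
  let fpp := partial ip (partial ip f) q in
  let fyp := partial ip (partial iy f) q in
  let fppp := partial ip (partial ip (partial ip f)) q in
  let fxpp := partial ip (partial ip (partial ix f)) q in
  let fypp := partial ip (partial ip (partial iy f)) q in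
  [/\ [/\ derivable y x 1, derivable (derive1 y) x 1,
          derivable p x 1 & derivable (derive1 p) x 1],
      Delta != 0,
      derive1 (derive1 y) x = f0 + fp * Delta + 1 / 2 * fpp * Delta ^+ 2
                    + 1 / 6 * fppp * Delta ^+ 3
    & derive1 (derive1 p) x = - (2 * (p' - f0) ^+ 2 / Delta) + fp * (3 * p' - 2 * f0)
        + fx + p x * fy + (fpp * (p' - f0) + 2 * fy) * Delta
        + 1 / 6 * (fppp * (p' - 2 * f0) - fxpp + 4 * fyp - p x * fypp)
          * Delta ^+ 2].

End SecondOrderODE.

(* Main.v *)
(* Write theta = dy - p dx, psi = dp - f dx and X for the generator of L2.  A
   contact form is m theta with m nowhere zero, and its adapted coframes are
   eta1 = A (psi + (X m / m) theta), eta2 = - (m / A) (dx - (m_p / m) theta).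
   Solving the structure equations for the connection gives
     g = m (theta . rho - psi . dx),
     rho = - 2/3 ds/s + 2/3 d log|A| - 1/3 d log|m| + 2/3 f_p dx + 1/6 f_pp theta,
   so that, up to a conformal factor and closed terms in rho, neither m nor A
   matters.  Up to a change of parameter and of conformal factor, null geodesics
   are the null curves along which the Euler-Lagrange expression of the energy
   is proportional to the dual of the velocity.  In the coframe
   (theta, psi, dx, rho), and with x as parameter, these are four equations for
   Delta = theta(c') = y' - p and psi(c') = p' - f; nullity determines
   rho(c') = psi(c') / Delta, elimination of the proportionality factor leaves
   the chain system, and the fourth equation follows from the others.
   Conversely a solution is lifted by integrating rho(c') = psi(c') / Delta for
   the fibre coordinate s, and phi' = m Delta gives an affine parameter phi. *)

Require Import Defs.
From HB Require Import structures.
From mathcomp Require Import all_boot all_order all_algebra.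
From mathcomp Require Import all_classical all_reals all_analysis.
From mathcomp Require Import ring lra.

Set Implicit Arguments.
Unset Strict Implicit.
Unset Printing Implicit Defensive.

Import Order.TTheory GRing.Theory Num.Theory.
Import numFieldNormedType.Exports.

Local Open Scope ring_scope.
Local Open Scope classical_set_scope.

(** A chain is defined through some adapted coframe and some solution of the structure equations.
    One implication therefore needs uniqueness of the connection and of [K], the other one
    existence. For uniqueness the equations are evaluated on vectors where the unknown torsion terms
    vanish: [eta3] kills d_x + p d_y and d_p, and [eta2], [eta3] both kill d_p. Existence must also
    verify the entries left over; this rests on d(d(eta3)) = 0, hence on the symmetry of second
    partial derivatives. The weights -2/3 and 1/6 in sigma are what removes the contact form. The
    second-order quantity [eN] has coefficient 1 in the theta-component of alpha and 4 in m K, so it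
    cancels in sigma; the other derivatives of m, together with the cross terms of omega1.omega2,
    regroup into -1/3 d log|m|. An exact term in rho changes the pairing of rho with the velocity
    but not d(rho). Since nullity prescribes that pairing, no derivative of m or A survives in the
    chain system. *)

Lemma differentiable_near {K : numFieldType} {V W : normedModType K}
    (F G : V -> W) (q : V) : {near q, F =1 G} ->
  differentiable F q -> differentiable G q.
Proof.
move=> FG Fq; have Fc := diff_continuous Fq; have FGq := nbhs_singleton FG.
(* The differential of [F] satisfies the first-order expansion of [G] at [q]; [diff_unique] then
   identifies it with the differential of [G]. *)
have E : G \o shift q = cst (G q) + 'd F q +o_ 0 id.
  apply/eqaddoP => eps eps0.
  have H := (@eqaddoP _ _ _ _ _ _ _ _).1 (diff_locally Fq) eps eps0.
  have FG0 : \forall h \near (0 : V), F (h + q) = G (h + q).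
    by rewrite (near_shift q) /=; near=> h; rewrite /= sub0r subrK; near: h.
  near=> h; rewrite -[X in `|X|]/(G (h + q) - (G q + 'd F q h)) -FGq.
  by rewrite -(near FG0 h)//; near: h.
have dE := diff_unique Fc E.
apply/diff_locallyP; split; last by rewrite dE.
by rewrite dE.
Unshelve. all: by end_near. Qed.

(** * Gradients and their calculus rules *)

Section PartialDerivatives.
Context {R : realType} {n : nat}.
Implicit Types (U : set 'rV[R]_n.+1) (F G : 'rV[R]_n.+1 -> R).
Implicit Types (q v : 'rV[R]_n.+1) (d e : 'I_n.+1 -> R).

(** Differentiability travels together with the values of the partials because each rule below
    (product, inverse, chain) needs both for its arguments; a gradient can then be assembled along
    the syntax of an expression. *)
Definition has_gradient F q d : Prop :=
  differentiable F q /\ forall i, partial i F q = d i.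

Lemma differentiable_gradient F q :
  differentiable F q -> has_gradient F q (fun i => partial i F q).
Proof. by []. Qed.

Lemma gradient_partial F q d i : has_gradient F q d -> partial i F q = d i.
Proof. by case. Qed.

Lemma gradient_eq F q d e : has_gradient F q d -> d =1 e -> has_gradient F q e.
Proof. by move=> [Fq dF] de; split=> // i; rewrite dF de. Qed.

Lemma gradient_diff F q d v : has_gradient F q d ->
  'd F q v = \sum_i d i * v 0 i.
Proof.
move=> [Fq dF]; rewrite [v in LHS]row_sum_delta raddf_sum; apply: eq_bigr => i _.
by rewrite [LHS]linearZ mulrC -dF /partial deriveE.
Qed.


Lemma gradient_near F G q d : {near q, F =1 G} ->
  has_gradient F q d -> has_gradient G q d.
Proof.
move=> FG [Fq dF]; split=> [|i]; first exact: differentiable_near FG Fq.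
by rewrite -dF /partial (near_eq_derive _ FG).
Qed.

Lemma gradient_cst (a : R) q : has_gradient (fun=> a) q (fun=> 0).
Proof. by split=> [|i]; [exact: differentiable_cst|exact: derive_cst]. Qed.

Lemma gradient_coord j q : has_gradient (fun x => x 0 j) q (fun i => (i == j)%:R).
Proof.
split=> [|i]; first exact: differentiable_coord.
rewrite /partial deriveE; last exact: differentiable_coord.
have lcoord : linear (fun x : 'rV[R]_n.+1 => x 0 j : R^o).
  by move=> a x y; rewrite !mxE.
pose coord := HB.pack_for {linear 'rV[R]_n.+1 -> R^o} (fun x : 'rV[R]_n.+1 => x 0 j : R^o)
  (GRing.isLinear.Build _ _ _ _ _ lcoord).
rewrite (_ : (fun _ => _) = coord)// diff_lin//=; last first.
  by move=> x; apply: differentiable_continuous; exact: differentiable_coord.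
by rewrite mxE eqxx eq_sym.
Qed.

Lemma gradientD F G q d e : has_gradient F q d -> has_gradient G q e ->
  has_gradient (fun x => F x + G x) q (fun i => d i + e i).
Proof.
move=> [Fq dF] [Gq dG]; split=> [|i]; first exact: differentiableD.
by rewrite /partial deriveD; [rewrite -dF -dG|exact: diff_derivable..].
Qed.

Lemma gradientN F q d : has_gradient F q d ->
  has_gradient (fun x => - F x) q (fun i => - d i).
Proof.
move=> [Fq dF]; split=> [|i]; first exact: differentiableN.
by rewrite /partial deriveN; [rewrite -dF|exact: diff_derivable].
Qed.

Lemma gradientB F G q d e : has_gradient F q d -> has_gradient G q e ->
  has_gradient (fun x => F x - G x) q (fun i => d i - e i).
Proof. by move=> Fd /gradientN; apply: gradientD. Qed.

Lemma gradientM F G q d e : has_gradient F q d -> has_gradient G q e ->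
  has_gradient (fun x => F x * G x) q (fun i => d i * G q + F q * e i).
Proof.
move=> [Fq dF] [Gq dG]; split=> [|i]; first exact: differentiableM.
rewrite /partial deriveM; [|exact: diff_derivable..].
by rewrite -dF -dG addrC [_ *: _]mulrC.
Qed.

Lemma gradientV F q d : F q != 0 -> has_gradient F q d ->
  has_gradient (fun x => (F x)^-1) q (fun i => - d i / F q ^+ 2).
Proof.
move=> F0 [Fq dF]; split=> [|i]; first exact: differentiableV.
rewrite /partial deriveV//; last exact: diff_derivable.
by rewrite -dF /partial [_ *: _]mulrC mulrN mulNr.
Qed.

Lemma gradient_comp_curve F (c : R -> 'rV[R]_n.+1) t v d :
  has_gradient F (c t) d -> is_derive t 1 c v ->
  is_derive t 1 (F \o c) (\sum_i d i * v 0 i).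
Proof.
move=> Fd [ct cv]; have cd : differentiable c t by exact/derivable1_diffP.
have Fcd : differentiable (F \o c) t by apply: differentiable_comp => //; case: Fd.
apply: DeriveDef; first exact/derivable1_diffP.
rewrite deriveE// diff_comp//=; last by case: Fd.
have -> : 'd c t 1 = v by rewrite -deriveE.
exact: gradient_diff.
Qed.

End PartialDerivatives.

(** * Symmetry of second partial derivatives *)

Section Schwarz.
Context {R : realType} {n : nat}.
Implicit Types (F G : 'rV[R]_n.+1 -> R) (q v : 'rV[R]_n.+1).

Lemma differentiable_expansion G q (eps : R) : 0 < eps -> differentiable G q ->
  \forall v \near (0 : 'rV[R]_n.+1), `|G (q + v) - G q - 'd G q v| <= eps * `|v|.
Proof.
move=> eps0 Gq.
have H := (@eqaddoP _ _ _ _ _ _ _ _).1 (diff_locally Gq) eps eps0.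
apply: filterS H => v /=; apply: le_trans.
by rewrite -[X in _ <= `|X|]/(G (v + q) - (G q + 'd G q v)) opprD addrA [v + q]addrC.
Qed.

Lemma normr_delta_row_le1 (i : 'I_n.+1) : `|delta_mx 0 i : 'rV[R]_n.+1| <= 1.
Proof.
rewrite /Num.Def.normr/= mx_normrE; apply: bigmax_le => //= -[k l] _.
by rewrite mxE; case: (_ && _); rewrite ?normr1 ?normr0.
Qed.

Lemma is_derive_line q v w (t : R) : is_derive t 1 (fun t => q + (t *: v + w)) v.
Proof.
have sv : is_derive t (1 : R) (fun t : R => t *: v) v.
  apply: DeriveDef; first exact/derivable1_diffP/ex_diff.
  by rewrite deriveE ?diff_val ?scale1r.
have sw := is_deriveD sv (is_derive_cst w t 1).
by have := is_deriveD (is_derive_cst q t 1) sw; rewrite add0r addr0.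
Qed.

(* The mean value theorem in the direction i, then the expansion of the
   partial derivative at q. *)
Lemma second_difference F q i j (eps : R) : 0 < eps ->
  (\forall x \near q, differentiable F x) -> differentiable (partial i F) q ->
  \forall h \near (0 : R)^'+,
    `|F (q + h *: delta_mx 0 i + h *: delta_mx 0 j) - F (q + h *: delta_mx 0 i)
      - F (q + h *: delta_mx 0 j) + F q - h ^+ 2 * partial j (partial i F) q|
    <= eps * h ^+ 2.
Proof.
move=> eps0 Fnear dFq; set ei : 'rV[R]_n.+1 := delta_mx 0 i.
set ej : 'rV[R]_n.+1 := delta_mx 0 j; set G := partial i F.
have /nbhs_ballP[r /= r0 Fr] : \forall v \near (0 : 'rV[R]_n.+1), differentiable F (q + v).
  have : \forall v \near (0 : 'rV[R]_n.+1), differentiable F (v + q).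
    rewrite (near_shift q) /=; apply: filterS Fnear => v.
    by rewrite /= sub0r subrK.
  by apply: filterS => v; rewrite addrC.
(* The expansion is used at [t *: ei + h *: ej] and at [t *: ei] with [0 <= t <= h]; the two norms
   add up to at most [3 * h]. *)
have eps30 : 0 < eps / 3 by rewrite divr_gt0.
have /nbhs_ballP[d /= d0 Gd] := differentiable_expansion eps30 dFq.
have leN (a b : R) : `|a *: ei + b *: ej| <= `|a| + `|b|.
  apply: (le_trans (ler_normD _ _)); apply: lerD; rewrite normrZ -[leRHS]mulr1.
    by rewrite ler_wpM2l// normr_delta_row_le1.
  by rewrite ler_wpM2l// normr_delta_row_le1.
have leN1 (a : R) : `|a *: ei| <= `|a|.
  by rewrite normrZ -[leRHS]mulr1 ler_wpM2l// normr_delta_row_le1.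
near=> h.
have h0 : 0 < h by near: h; exact: nbhs_right_gt.
have h2r : h + h < r.
  rewrite -mulr2n -mulr_natl -ltr_pdivlMl//; near: h; apply: nbhs_right_lt.
  by rewrite mulr_gt0.
have h2d : h + h < d.
  rewrite -mulr2n -mulr_natl -ltr_pdivlMl//; near: h; apply: nbhs_right_lt.
  by rewrite mulr_gt0.
have inr v (e : R) : `|v| <= h + h -> h + h < e -> ball (0 : 'rV[R]_n.+1) e v.
  by move=> vh he; rewrite -ball_normE /ball_/= sub0r normrN (le_lt_trans vh).
have small (t : R) : 0 <= t <= h -> `|t *: ei + h *: ej| <= h + h.
  move=> /andP[t0 th]; apply: (le_trans (leN _ _)).
  by rewrite !ger0_norm ?lerD2r// ltW.
have small1 (t : R) : 0 <= t <= h -> `|t *: ei| <= h + h.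
  move=> /andP[t0 th]; apply: (le_trans (leN1 _)); rewrite ger0_norm//.
  by rewrite (le_trans th)// lerDl ltW.
(* The increment of [g] over [[0, h]] is the second difference, and its derivative is a difference
   of values of [G] alone. *)
pose g (t : R) := F (q + (t *: ei + h *: ej)) - F (q + t *: ei).
have dg (t : R) : 0 <= t <= h -> is_derive t 1 g (G (q + (t *: ei + h *: ej)) - G (q + t *: ei)).
  move=> th; apply: is_deriveB.
    have Fq : differentiable F (q + (t *: ei + h *: ej)).
      by apply: Fr; apply: inr h2r; exact: small.
    have := gradient_comp_curve (differentiable_gradient Fq) (is_derive_line q ei (h *: ej) t).
    rewrite (bigD1 i)//= big1 => [|k ki]; first by rewrite mxE !eqxx mulr1 addr0.
    by rewrite mxE (negPf ki) andbF mulr0.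
  have Fq : differentiable F (q + (t *: ei + 0)).
    by apply: Fr; apply: inr h2r; rewrite addr0; exact: small1.
  have := gradient_comp_curve (differentiable_gradient Fq) (is_derive_line q ei 0 t).
  rewrite (bigD1 i)//= big1 => [|k ki]; last by rewrite mxE (negPf ki) andbF mulr0.
  rewrite mxE !eqxx mulr1 addr0 /G addr0 => D.
  apply: near_eq_is_derive D; near=> s.
  by rewrite /= addr0.
have [] := @MVT_segment R g (fun t => G (q + (t *: ei + h *: ej)) - G (q + t *: ei)) 0 h.
- exact: ltW.
- by move=> t; rewrite in_itv/= => /andP[t0 th]; apply: dg; rewrite !ltW.
- apply: continuous_in_subspaceT => t; rewrite inE/= in_itv/= => th.
  by have [/derivable1_diffP/differentiable_continuous] := dg _ th.
move=> t; rewrite in_itv/= => th.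
rewrite /g scale0r subr0 add0r addr0.
rewrite addrA; set A := F (q + h *: ei + h *: ej); set B := F (q + h *: ei).
set C := F (q + h *: ej) => MV.
have H1 := Gd _ (inr _ _ (small _ th) h2d).
have H2 := Gd _ (inr _ _ (small1 _ th) h2d).
have E : 'd G q (t *: ei + h *: ej) = 'd G q (t *: ei) + h * partial j G q.
  rewrite raddfD/=; congr (_ + _).
  by rewrite [LHS]linearZ /partial deriveE.
rewrite E in H1.
set G1 := G (q + (t *: ei + h *: ej)) in H1 *.
set G2 := G (q + t *: ei) in H2 *.
(* In the difference of the two expansions the terms [G q] and ['d G q (t *: ei)] cancel, which
   leaves [h * partial j G q] and the two remainders. *)
have -> : A - B - C + F q - h ^+ 2 * partial j G q =
    ((G1 - G q - ('d G q (t *: ei) + h * partial j G q))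
     - (G2 - G q - 'd G q (t *: ei))) * h.
  have -> : A = (G1 - G2) * h + (C - F q) + B by rewrite -MV; ring.
  ring.
rewrite normrM (gtr0_norm h0) expr2 mulrA ler_wpM2r ?(ltW h0)//.
apply: (le_trans (ler_normB _ _)); apply: (le_trans (lerD H1 H2)).
rewrite -mulrDr.
have : `|t *: ei + h *: ej| + `|t *: ei| <= 3 * h.
  have := leN t h; have := leN1 t; case/andP: th => t0 th.
  rewrite !ger0_norm ?(ltW h0)//; lra.
move=> /(ler_wpM2l (ltW eps30)) /le_trans; apply.
by rewrite mulrA divfK.
Unshelve. all: by end_near. Qed.

(** The second difference is symmetric in [i] and [j], so one and the same number approximates
    [h ^+ 2] times either mixed derivative up to an arbitrarily small multiple of [h ^+ 2]. *)
Lemma partialC F q i j : (\forall x \near q, differentiable F x) ->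
  differentiable (partial i F) q -> differentiable (partial j F) q ->
  partial j (partial i F) q = partial i (partial j F) q.
Proof.
move=> Fq Fi Fj; apply/eqP; rewrite -subr_eq0 -normr_le0.
apply/ler_addgt0Pr => eps eps0; rewrite add0r.
have eps40 : 0 < eps / 4 by rewrite divr_gt0.
have H1 := second_difference j eps40 Fq Fi.
have H2 := second_difference i eps40 Fq Fj.
have [h [h0 {}H1 {}H2]] : exists h : R, [/\ 0 < h,
    `|F (q + h *: delta_mx 0 i + h *: delta_mx 0 j) - F (q + h *: delta_mx 0 i)
      - F (q + h *: delta_mx 0 j) + F q - h ^+ 2 * partial j (partial i F) q|
    <= eps / 4 * h ^+ 2 &
    `|F (q + h *: delta_mx 0 j + h *: delta_mx 0 i) - F (q + h *: delta_mx 0 j)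
      - F (q + h *: delta_mx 0 i) + F q - h ^+ 2 * partial i (partial j F) q|
    <= eps / 4 * h ^+ 2].
  have := filter_ex (filterI (nbhs_right_gt (0 : R)) (filterI H1 H2)).
  by move=> [h [h0 [h1 h2]]]; exists h; split; [exact: h0|exact: h1|exact: h2].
rewrite -(@ler_pM2l _ (h ^+ 2)) ?exprn_gt0//.
rewrite -[X in X * `|_|]ger0_norm ?exprn_ge0 ?ltW// -normrM.
set A := F (q + h *: _ + h *: delta_mx 0 j) in H1.
rewrite [q + _ + _]addrAC -/A in H2.
set B := F (q + h *: delta_mx 0 i) in H1 H2.
set C := F (q + h *: delta_mx 0 j) in H1 H2.
move: H1 H2; move: (partial j _ q) (partial i _ q) A B C (F q) => X Y A B C Fq0 H1 H2.
have -> : h ^+ 2 * (X - Y) = (A - C - B + Fq0 - h ^+ 2 * Y) - (A - B - C + Fq0 - h ^+ 2 * X).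
  by ring.
apply: (le_lt_trans (ler_normB _ _)); apply: (le_lt_trans (lerD H2 H1)).
by rewrite -mulrDl mulrC ltr_pM2l ?exprn_gt0//; lra.
Qed.

End Schwarz.

(** * Smooth functions *)

Section Smoothness.
Context {R : realType} {n : nat}.
Implicit Types (U : set 'rV[R]_n.+1) (F G : 'rV[R]_n.+1 -> R).
Implicit Types (q : 'rV[R]_n.+1) (d e : 'I_n.+1 -> R).

(** Counting the order of differentiation replaces the lists of directions in [smooth_on]: the
    product rule produces sums, which an induction over a list for a single product would not cover,
    while an induction on [k] over all pairs of functions does. *)
Fixpoint times_differentiable (k : nat) U F : Prop :=
  (forall q, U q -> differentiable F q) /\
  if k is k'.+1 then forall i, times_differentiable k' U (partial i F) else True.

Lemma smooth_partial U F i : smooth_on U F -> smooth_on U (partial i F).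
Proof. by move=> FU s q Uq; have := FU (rcons s i) q Uq; rewrite foldr_rcons. Qed.

Lemma smooth_differentiable U F q : smooth_on U F -> U q -> differentiable F q.
Proof. by move=> FU; exact: (FU [::]). Qed.

Lemma smooth_gradient U F q : smooth_on U F -> U q ->
  has_gradient F q (fun i => partial i F q).
Proof. by move=> FU Uq; apply/differentiable_gradient/(smooth_differentiable FU). Qed.

Lemma smooth_onP U F : smooth_on U F <-> forall k, times_differentiable k U F.
Proof.
split=> [FU k|FU s].
  elim: k F FU => [|k IH] F FU /=; (split; first by move=> q; exact: smooth_differentiable) => //.
  by move=> i; exact/IH/smooth_partial.
have {FU} := FU (size s); elim/last_ind: s F => [|s i IH] F; first by case.
by rewrite size_rcons foldr_rcons => -[_ /(_ i)/IH].
Qed.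

Lemma smooth_partialC F q i j : smooth_on setT F ->
  partial j (partial i F) q = partial i (partial j F) q.
Proof.
move=> FT; apply: partialC.
- by near=> x; exact: smooth_differentiable FT _.
- by apply: smooth_differentiable (smooth_partial i FT) _.
- by apply: smooth_differentiable (smooth_partial j FT) _.
Unshelve. all: by end_near. Qed.

Lemma times_differentiable_pred k U F :
  times_differentiable k.+1 U F -> times_differentiable k U F.
Proof.
elim: k F => [|k IH] F [Fd dF]; first by split.
by split=> // i; exact/IH/dF.
Qed.

Lemma partial_open U F G i q : open U -> (forall x, U x -> F x = G x) -> U q ->
  partial i F q = partial i G q.
Proof.
move=> Uo FG Uq; apply: near_eq_derive.
exact: filterS (open_nbhs_nbhs (conj Uo Uq)).
Qed.

Lemma times_differentiable_eq k U F G : open U -> (forall x, U x -> F x = G x) ->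
  times_differentiable k U F -> times_differentiable k U G.
Proof.
move=> Uo; elim: k F G => [|k IH] F G FG /= [Fd dF].
  split=> // q Uq; apply: differentiable_near (Fd q Uq).
  exact: filterS (open_nbhs_nbhs (conj Uo Uq)).
split=> [q Uq|i].
  apply: differentiable_near (Fd q Uq).
  exact: filterS (open_nbhs_nbhs (conj Uo Uq)).
by apply: IH (dF i) => x Ux; exact: partial_open FG Ux.
Qed.

Lemma times_differentiable_cst k U (a : R) : times_differentiable k U (fun=> a).
Proof.
elim: k a => [|k IH] a /=; (split; first by move=> q _; exact: differentiable_cst) => //.
by move=> i; rewrite (_ : partial i _ = fun=> 0)//; apply/funext => x; exact: derive_cst.
Qed.

Lemma times_differentiableD k U F G : open U -> times_differentiable k U F ->
  times_differentiable k U G -> times_differentiable k U (fun x => F x + G x).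
Proof.
move=> Uo; elim: k F G => [|k IH] F G /= [Fd dF] [Gd dG]; (split; first by move=> q Uq;
  have [] := gradientD (differentiable_gradient (Fd _ Uq)) (differentiable_gradient (Gd _ Uq))) => //.
move=> i; apply: times_differentiable_eq (IH _ _ (dF i) (dG i)) => // x Ux.
by rewrite (gradient_partial _ (gradientD (differentiable_gradient (Fd _ Ux))
  (differentiable_gradient (Gd _ Ux)))).
Qed.

Lemma times_differentiableM k U F G : open U -> times_differentiable k U F ->
  times_differentiable k U G -> times_differentiable k U (fun x => F x * G x).
Proof.
move=> Uo; elim: k F G => [|k IH] F G /=.
  move=> [Fd _] [Gd _]; split=> // q Uq.
  by have [] := gradientM (differentiable_gradient (Fd _ Uq)) (differentiable_gradient (Gd _ Uq)).
move=> HF HG; have [Fd dF] := HF; have [Gd dG] := HG.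
have [Fk Gk] := (times_differentiable_pred HF, times_differentiable_pred HG).
split=> // [q Uq|i].
  by have [] := gradientM (differentiable_gradient (Fd _ Uq)) (differentiable_gradient (Gd _ Uq)).
apply: times_differentiable_eq (times_differentiableD Uo (IH _ _ (dF i) Gk) (IH _ _ Fk (dG i))).
- by [].
- move=> x Ux.
by rewrite (gradient_partial _ (gradientM (differentiable_gradient (Fd _ Ux))
  (differentiable_gradient (Gd _ Ux)))).
Qed.

(** The partials of the inverse are - dF / F^2, a product of a partial of [F] with two copies of the
    inverse itself, to which the induction hypothesis applies at the lower order. *)
Lemma times_differentiableV k U F : open U -> (forall x, U x -> F x != 0) ->
  times_differentiable k U F -> times_differentiable k U (fun x => (F x)^-1).
Proof.
move=> Uo F0; elim: k => [|k IH] /=.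
  move=> [Fd _]; split=> // q Uq.
  by have [] := gradientV (F0 _ Uq) (differentiable_gradient (Fd _ Uq)).
move=> HF; have [Fd dF] := HF; have Vk := IH (times_differentiable_pred HF).
split=> // [q Uq|i].
  by have [] := gradientV (F0 _ Uq) (differentiable_gradient (Fd _ Uq)).
have N1 := times_differentiable_cst k U (- 1).
apply: times_differentiable_eq (times_differentiableM Uo (times_differentiableM Uo N1 (dF i)) (times_differentiableM Uo Vk Vk)).
- by [].
- move=> x Ux.
  rewrite (gradient_partial _ (gradientV (F0 _ Ux) (differentiable_gradient (Fd _ Ux)))).
  by rewrite mulN1r expr2 invfM.
Qed.

Lemma smooth_cst U (a : R) : smooth_on U (fun=> a).
Proof. by apply/smooth_onP => k; exact: times_differentiable_cst. Qed.

Lemma smooth_coord U j : smooth_on U (fun q => q 0 j).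
Proof.
apply/smooth_onP => -[|k] /=; (split; first by move=> q _; exact: differentiable_coord) => //.
move=> i; rewrite (_ : partial i _ = fun=> (i == j)%:R); first exact: times_differentiable_cst.
by apply/funext => q; rewrite (gradient_partial _ (gradient_coord j q)).
Qed.

Lemma smooth_eq U F G : open U -> (forall x, U x -> F x = G x) ->
  smooth_on U F -> smooth_on U G.
Proof.
move=> Uo FG /smooth_onP FU; apply/smooth_onP => k.
exact: times_differentiable_eq FG (FU k).
Qed.

Lemma smoothD U F G : open U -> smooth_on U F -> smooth_on U G ->
  smooth_on U (fun x => F x + G x).
Proof.
move=> Uo /smooth_onP FU /smooth_onP GU; apply/smooth_onP => k.
exact: times_differentiableD.
Qed.

Lemma smoothM U F G : open U -> smooth_on U F -> smooth_on U G ->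
  smooth_on U (fun x => F x * G x).
Proof.
move=> Uo /smooth_onP FU /smooth_onP GU; apply/smooth_onP => k.
exact: times_differentiableM.
Qed.

Lemma smoothV U F : open U -> (forall x, U x -> F x != 0) -> smooth_on U F ->
  smooth_on U (fun x => (F x)^-1).
Proof.
move=> Uo F0 /smooth_onP FU; apply/smooth_onP => k.
exact: times_differentiableV.
Qed.

Lemma smoothN U F : open U -> smooth_on U F -> smooth_on U (fun x => - F x).
Proof.
move=> Uo FU; have FE x : U x -> - 1 * F x = - F x by rewrite mulN1r.
exact: smooth_eq Uo FE (smoothM Uo (smooth_cst (- 1)) FU).
Qed.

End Smoothness.

(** * Coordinates of the bundle and functions pulled back from the base *)

Section Bundle.
Context {R : realType}.
Implicit Types (u : 'rV[R]_(3 + 1)) (F : 'rV[R]_3 -> R).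

Definition ibase (j : 'I_3) : 'I_(3 + 1) := lshift 1 j.
Definition ifib : 'I_(3 + 1) := rshift 3 ord0.

Lemma base_coord u j : base u 0 j = u 0 (ibase j).
Proof. by rewrite mxE. Qed.

Lemma fib_coord u : fib u = u 0 ifib.
Proof. by rewrite /fib mxE. Qed.

Lemma gradient_base F u (d : 'I_3 -> R) : has_gradient F (base u) d ->
  has_gradient (fun u => F (base u)) u
    (fun i => match fintype.split (i : 'I_(3 + 1)) with inl j => d j | inr _ => 0 end).
Proof.
move=> Fd; have [Fu _] := Fd.
have bu : differentiable (@base R) u by exact: differentiable_lsubmx.
have Fbu : differentiable (F \o @base R) u by exact: differentiable_comp.
split=> // i; rewrite /partial deriveE// diff_comp//=.
have lb : linear (@base R) by move=> a x y; apply/rowP => k; rewrite !mxE.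
pose b := HB.pack_for {linear 'rV[R]_(3 + 1) -> 'rV[R]_3} (@base R)
  (GRing.isLinear.Build _ _ _ _ _ lb).
have -> : 'd (@base R) u (delta_mx 0 i) = base (delta_mx 0 i).
  rewrite -[@base R]/(b : _ -> _) diff_lin//= => x.
  by apply: differentiable_continuous; exact: differentiable_lsubmx.
rewrite (gradient_diff _ Fd).
have E j : base (delta_mx 0 i) 0 j = (ibase j == i)%:R :> R by rewrite !mxE.
under eq_bigr do rewrite E.
case: split_ordP => k ->; last first.
  by rewrite big1 // => j _; rewrite /ibase eq_lrshift mulr0.
rewrite (bigD1 k)//= eqxx mulr1 big1 ?addr0// => j jk.
by rewrite /ibase eq_lshift (negPf jk) mulr0.
Qed.

Lemma open_bundle : open (@bundle R).
Proof.
rewrite (_ : bundle = (fun u : 'rV[R]_(3 + 1) => u 0 ifib) @^-1` [set x | x != 0]).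
  apply: open_comp => [u _|]; last exact: open_neq.
  by apply: differentiable_continuous; exact: differentiable_coord.
by apply/funext => u; rewrite /bundle /preimage/= fib_coord.
Qed.

(** The induction closes because a partial derivative of a pullback is either the pullback of a
    partial derivative or, in the fibre direction, zero. *)
Lemma smooth_base (U : set 'rV[R]_(3 + 1)) F : open U -> smooth_on setT F ->
  smooth_on U (fun u => F (base u)).
Proof.
move=> Uo /smooth_onP FT; apply/smooth_onP => k.
elim: k F {FT}(FT k) => [|k IH] F /= [Fd dF]; (split; first by move=> u _;
  have [] := gradient_base (differentiable_gradient (Fd (base u) I))) => //.
move=> i; pose G u := match fintype.split (i : 'I_(3 + 1)) with inl j => partial j F (base u) | inr _ => 0 end.
apply: (@times_differentiable_eq _ _ _ _ G) => // [u _|].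
  by rewrite (gradient_partial _ (gradient_base (differentiable_gradient (Fd (base u) I)))).
rewrite /G; case: (fintype.split _) => j; first exact: IH.
exact: times_differentiable_cst.
Qed.

End Bundle.

(** * The geodesic operator *)

Section GeodesicOperator.
Context {R : realType} {n : nat}.
Implicit Types (U : set 'rV[R]_n.+1) (g h : 'rV[R]_n.+1 -> 'M[R]_n.+1).
Implicit Types (a b : 'rV[R]_n.+1 -> 'rV[R]_n.+1) (q v w : 'rV[R]_n.+1).

(* The Euler-Lagrange expression of the energy of g along a curve with
   velocity v and acceleration w at q. *)
Definition lowered g q v w l : R :=
  \sum_k g q k l * w 0 k
  + \sum_i \sum_j (partial i (fun x => g x j l) q
                   - 2^-1 * partial l (fun x => g x i j) q) * (v 0 i * v 0 j).

(** The time derivative of a(c') along a curve c with velocity [v] and acceleration [w]; see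
    [form_derivative_curve]. *)
Definition form_derivative a q v w : R :=
  \sum_k a q 0 k * w 0 k
  + \sum_i \sum_j partial i (fun x => a x 0 j) q * (v 0 i * v 0 j).

Definition interior_extd a q v l : R := \sum_i v 0 i * extd a q i l.

Definition differentiable_form a q := forall i, differentiable (fun x => a x 0 i) q.
Definition differentiable_metric g q := forall i j, differentiable (fun x => g x i j) q.

Definition quadratic g q v : R := \sum_i \sum_j g q i j * v 0 i * v 0 j.
Definition flat g q v l : R := \sum_k g q k l * v 0 k.

(** Coefficients multiplied by the symmetric factor [v 0 i * v 0 j] matter only through their
    symmetric part; comparing those parts avoids any manual exchange of indices. *)
Lemma double_sum_symmetrize (x y : 'I_n.+1 -> 'I_n.+1 -> R) :
  (forall i j, x i j + x j i = y i j + y j i) ->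
  \sum_i \sum_j x i j = \sum_i \sum_j y i j.
Proof.
move=> xy; apply: (@mulfI _ 2); rewrite ?pnatr_eq0// !mulr_natl !mulr2n.
rewrite [X in _ + X = _]exchange_big [X in _ = _ + X]exchange_big -!big_split/=.
apply: eq_bigr => i _; rewrite -!big_split/=; exact: eq_bigr.
Qed.

(** Both sides are an invertible matrix apart: the lowered expression is [g q] applied to the
    geodesic one. Clearing the inverse matrix from the Christoffel symbols in this way leaves
    expressions polynomial in [g] and its derivatives. *)
Lemma geodesic_lowered g q v w : (g q)^T = g q -> g q \in unitmx ->
  (forall k, w 0 k + \sum_i \sum_j christoffel g q k i j * v 0 i * v 0 j = 0)
  <-> (forall l, lowered g q v w l = 0).
Proof.
move=> gT gu.
pose W : 'cV[R]_n.+1 := \col_l \sum_i \sum_j (partial i (fun x => g x j l) q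
                   - 2^-1 * partial l (fun x => g x i j) q) * (v 0 i * v 0 j).
have E1 l : lowered g q v w l = (g q *m w^T + W) l 0.
  rewrite !mxE; congr (_ + _); apply: eq_bigr => k _.
  by rewrite -[in LHS]gT !mxE.
have E2 k : w 0 k + \sum_i \sum_j christoffel g q k i j * v 0 i * v 0 j =
    (w^T + invmx (g q) *m W) k 0.
  rewrite !mxE; congr (_ + _).
  pose S l i j := (partial i (fun x => g x j l) q) * (v 0 i * v 0 j).
  pose T l i j := (partial l (fun x => g x i j) q) * (v 0 i * v 0 j).
  have E i j : christoffel g q k i j * v 0 i * v 0 j =
      \sum_l invmx (g q) k l * (2^-1 * (S l i j + S l j i - T l i j)).
    rewrite /christoffel mulr_sumr !mulr_suml; apply: eq_bigr => l _.
    by rewrite /S /T; ring.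
  under eq_bigr do under eq_bigr do rewrite E.
  under eq_bigr do rewrite exchange_big/=.
  rewrite exchange_big/=; apply: eq_bigr => l _.
  rewrite mxE; under eq_bigr do rewrite -mulr_sumr -mulr_sumr.
  rewrite -mulr_sumr -mulr_sumr; congr (_ * _).
  (* The two positive terms of the Christoffel symbol have equal sums against [v 0 i * v 0 j], by
     exchanging [i] and [j]. *)
  have -> : \sum_i \sum_j (S l i j + S l j i - T l i j) =
      2 * (\sum_i \sum_j S l i j) - \sum_i \sum_j T l i j.
    under eq_bigr do rewrite sumrB big_split/=.
    rewrite sumrB big_split/= [X in _ + X - _]exchange_big/=.
    by rewrite mulr_natl mulr2n.
  rewrite mulrBr mulKf ?pnatr_eq0// mulr_sumr -sumrB; apply: eq_bigr => i _.
  rewrite mulr_sumr -sumrB; apply: eq_bigr => j _.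
  by rewrite /S /T; ring.
split=> [H l|H k].
  rewrite E1; have -> : g q *m w^T + W = g q *m (w^T + invmx (g q) *m W).
    by rewrite mulmxDr mulKVmx.
  rewrite (_ : w^T + _ = 0) ?mulmx0 ?mxE//.
  by apply/colP => k; rewrite -E2 H mxE.
rewrite E2 (_ : w^T + _ = invmx (g q) *m (g q *m w^T + W)).
  rewrite (_ : g q *m _ + _ = 0) ?mulmx0 ?mxE//.
  by apply/colP => l; rewrite -E1 H mxE.
by rewrite mulmxDr mulKmx.
Qed.

Lemma lowered_open U g h q v w l : open U -> (forall x, U x -> g x = h x) ->
  U q -> lowered g q v w l = lowered h q v w l.
Proof.
move=> Uo gh Uq; rewrite /lowered (gh _ Uq); congr (_ + _).
apply: eq_bigr => i _; apply: eq_bigr => j _; congr ((_ - _ * _) * _).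
  by apply: (partial_open _ Uo _ Uq) => x Ux; rewrite (gh _ Ux).
by apply: (partial_open _ Uo _ Uq) => x Ux; rewrite (gh _ Ux).
Qed.

Lemma loweredB g h q v w l : differentiable_metric g q -> differentiable_metric h q ->
  lowered (fun x => g x - h x) q v w l = lowered g q v w l - lowered h q v w l.
Proof.
move=> gq hq; rewrite /lowered opprD addrACA; congr (_ + _).
  by rewrite -sumrB; apply: eq_bigr => k _ /=; rewrite !mxE mulrBl.
rewrite -sumrB; apply: eq_bigr => i _; rewrite -sumrB/=; apply: eq_bigr => j _.
have E k r s : partial k (fun x => (g x - h x) r s) q =
    partial k (fun x => g x r s) q - partial k (fun x => h x r s) q.
  rewrite -(gradient_partial k (gradientB (differentiable_gradient (gq r s))
                 (differentiable_gradient (hq r s)))).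
  by congr (partial _ _ _); apply/funext => x; rewrite !mxE.
by rewrite !E; ring.
Qed.

(** These are the velocity and acceleration of a curve after a change of parameter phi with phi' =
    [a] and phi'' = [b]. The expression is quadratic in the velocity and affine in the acceleration,
    so a new parameter only adds a multiple of the dual of the velocity. *)
Lemma lowered_reparam g q v w (a b : R) l :
  lowered g q (a *: v) (a ^+ 2 *: w + b *: v) l = a ^+ 2 * lowered g q v w l + b * flat g q v l.
Proof.
rewrite /lowered /flat mulrDr [RHS]addrAC; congr (_ + _).
  rewrite !mulr_sumr -big_split; apply: eq_bigr => k _ /=; rewrite !mxE.
  by rewrite mulrDr mulrCA [X in _ + X]mulrCA.
rewrite mulr_sumr; apply: eq_bigr => i _; rewrite mulr_sumr; apply: eq_bigr => j _.
by rewrite !mxE [RHS]mulrCA; congr (_ * _); rewrite expr2 mulrACA.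
Qed.

Lemma flatZ g q v (a : R) l : flat g q (a *: v) l = a * flat g q v l.
Proof.
by rewrite /flat mulr_sumr; apply: eq_bigr => k _; rewrite mxE mulrCA.
Qed.

Lemma quadraticZ g q v (a : R) : quadratic g q (a *: v) = a ^+ 2 * quadratic g q v.
Proof.
rewrite /quadratic mulr_sumr; apply: eq_bigr => i _; rewrite mulr_sumr; apply: eq_bigr => j _.
by rewrite !mxE; ring.
Qed.

Lemma is_derive_coord (c : R -> 'rV[R]_n.+1) (t : R) v i :
  is_derive t 1 c v -> is_derive t 1 (fun s => c s 0 i) (v 0 i).
Proof.
move=> cv; have := gradient_comp_curve (gradient_coord i (c t)) cv.
rewrite (bigD1 i)//= eqxx mul1r big1 ?addr0// => k ki.
by rewrite (negPf ki) mul0r.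
Qed.

Lemma is_derive_row (c : R -> 'rV[R]_n.+1) (t : R) v :
  (forall i, is_derive t 1 (fun s => c s 0 i) (v 0 i)) -> is_derive t 1 c v.
Proof.
move=> H; have cd : derivable c t 1.
  by apply/derivable_mxP => i j; rewrite (ord1 i); case: (H j).
apply: DeriveDef => //; apply/rowP => i.
by rewrite derive_mx// mxE; case: (H i).
Qed.

Lemma form_derivative_curve a (c V : R -> 'rV[R]_n.+1) (t : R) w : differentiable_form a (c t) ->
  is_derive t 1 c (V t) -> is_derive t 1 V w ->
  is_derive t 1 (fun s => pairing (a (c s)) (V s)) (form_derivative a (c t) (V t) w).
Proof.
move=> ad cV Vw.
have H i : is_derive t 1 (fun s => a (c s) 0 i * V s 0 i)
    (a (c t) 0 i * w 0 i + V t 0 i * (\sum_k partial k (fun x => a x 0 i) (c t) * V t 0 k)).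
  exact: is_deriveM (gradient_comp_curve (differentiable_gradient (ad i)) cV)
    (is_derive_coord i Vw).
have S := is_derive_sum H.
apply: is_derive_eq.
  rewrite (_ : (fun s => pairing _ _) = \sum_i (fun s => a (c s) 0 i * V s 0 i)).
    exact: S.
  by apply/funext => s; rewrite fct_sumE.
rewrite big_split/=; congr (_ + _); rewrite exchange_big/=; apply: eq_bigr => i _.
by rewrite mulr_sumr; apply: eq_bigr => k _; ring.
Qed.

(** On a null velocity the last term vanishes and only a multiple of the dual of the velocity is
    added. This is the conformal invariance of null geodesics up to parametrization. *)
Lemma loweredZ (mu : 'rV[R]_n.+1 -> R) g q v w l :
  differentiable mu q -> differentiable_metric g q ->
  lowered (fun x => mu x *: g x) q v w l =
  mu q * lowered g q v w l + (\sum_i partial i mu q * v 0 i) * flat g q v l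
  - 2^-1 * partial l mu q * quadratic g q v.
Proof.
move=> muq gq.
have E k r s : partial k (fun x => (mu x *: g x) r s) q =
    partial k mu q * g q r s + mu q * partial k (fun x => g x r s) q.
  rewrite -(gradient_partial k (gradientM (differentiable_gradient muq)
                 (differentiable_gradient (gq r s)))).
  by congr (partial _ _ _); apply/funext => x; rewrite mxE.
rewrite /lowered /flat /quadratic mulrDr -!addrA. congr (_ + _).
  by rewrite mulr_sumr; apply: eq_bigr => k _; rewrite mxE mulrA.
rewrite mulr_suml !mulr_sumr -sumrB -big_split/=.
apply: eq_bigr => i _; rewrite !mulr_sumr -sumrB -big_split/=.
apply: eq_bigr => j _; rewrite !E.
by ring.
Qed.

(** The energy is 1/2 a(v) b(v), and the Leibniz rule splits its Euler-Lagrange expression. Besides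
    the time derivatives of a(v) and b(v), the forms are differentiated only through d(a) and d(b),
    which makes a coframe with simple exterior derivatives the right tool. *)
Lemma lowered_symprod a b q v w l : differentiable_form a q -> differentiable_form b q ->
  lowered (fun x => symprod (a x) (b x)) q v w l =
  2^-1 * (form_derivative a q v w * b q 0 l + form_derivative b q v w * a q 0 l
     + pairing (a q) v * interior_extd b q v l + pairing (b q) v * interior_extd a q v l).
Proof.
move=> aq bq.
have sE x r s : symprod (a x) (b x) r s = 2^-1 * (a x 0 r * b x 0 s + b x 0 r * a x 0 s).
  by rewrite !mxE !big_ord1 !mxE.
have E k r s : partial k (fun x => symprod (a x) (b x) r s) q =
    2^-1 * (partial k (fun x => a x 0 r) q * b q 0 s + a q 0 r * partial k (fun x => b x 0 s) q
    + (partial k (fun x => b x 0 r) q * a q 0 s + b q 0 r * partial k (fun x => a x 0 s) q)).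
  have ga r := differentiable_gradient (aq r); have gb r := differentiable_gradient (bq r).
  have H := gradientM (gradient_cst 2^-1 q) (gradientD (gradientM (ga r) (gb s))
    (gradientM (gb r) (ga s))).
  rewrite (_ : (fun x => _) = (fun x => 2^-1 * (a x 0 r * b x 0 s + b x 0 r * a x 0 s))).
    by rewrite (gradient_partial k H) mul0r add0r.
  by apply/funext => x; rewrite sE.
rewrite /lowered /form_derivative /interior_extd /pairing.
have -> : \sum_k symprod (a q) (b q) k l * w 0 k =
    2^-1 * ((\sum_k a q 0 k * w 0 k) * b q 0 l + (\sum_k b q 0 k * w 0 k) * a q 0 l).
  rewrite !mulr_suml -big_split mulr_sumr; apply: eq_bigr => k _ /=.
  by rewrite sE; ring.
rewrite !(mulrDl, mulrDr) -!addrA; congr (_ + _).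
rewrite [RHS]addrCA; congr (_ + _).
rewrite !mulr_suml !mulr_sumr -!big_split/=.
under [RHS]eq_bigr do rewrite !(mulr_suml, mulr_sumr) -!big_split/=.
apply: double_sum_symmetrize => i j; rewrite !E !mxE.
have [da aE] : exists da, forall k r, partial k (fun x => a x 0 r) q = da k r.
  by exists (fun k r => partial k (fun x => a x 0 r) q).
have [db bE] : exists db, forall k r, partial k (fun x => b x 0 r) q = db k r.
  by exists (fun k r => partial k (fun x => b x 0 r) q).
rewrite !aE !bE.
move: (a q 0) (b q 0) (v 0) => a0 b0 v0.
by field.
Qed.

End GeodesicOperator.

(** * Coordinates on the bundle *)

Section Coordinates.
Context {R : realType}.
Implicit Types (q : 'rV[R]_3) (u v : 'rV[R]_(3 + 1)).

Lemma vec3x (a b c : R) : vec3 a b c 0 ix = a. Proof. by rewrite mxE. Qed.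
Lemma vec3y (a b c : R) : vec3 a b c 0 iy = b. Proof. by rewrite mxE. Qed.
Lemma vec3p (a b c : R) : vec3 a b c 0 ip = c. Proof. by rewrite mxE. Qed.
Definition vec3E := (vec3x, vec3y, vec3p).

Lemma ord3P (P : 'I_3 -> Prop) : P ix -> P iy -> P ip -> forall i, P i.
Proof.
move=> P0 P1 P2 [[|[|[|i]]] hi] //; [move: P0|move: P1|move: P2];
  by congr P; apply/val_inj.
Qed.

Lemma ord4P (P : 'I_(3 + 1) -> Prop) :
  P (ibase ix) -> P (ibase iy) -> P (ibase ip) -> P ifib -> forall i, P i.
Proof.
move=> P0 P1 P2 P3 i; case: (fintype.split_ordP i) => j ->.
  by apply: (@ord3P (fun j => P (lshift 1 j))).
by rewrite (ord1 j).
Qed.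

Lemma eq_base_fib k : ((ibase k : 'I_4) == ifib) = false.
Proof. exact: eq_lrshift. Qed.

Lemma sum3E (V : nmodType) (F : 'I_3 -> V) : \sum_i F i = F ix + F iy + F ip.
Proof.
rewrite !big_ord_recl big_ord0 addr0 addrA; congr (F _ + F _ + F _); exact/val_inj.
Qed.

Lemma sum4E (V : nmodType) (F : 'I_(3 + 1) -> V) :
  \sum_i F i = F (ibase ix) + F (ibase iy) + F (ibase ip) + F ifib.
Proof. by rewrite big_split_ord big_ord1 sum3E. Qed.

Lemma row_mx_base (a : 'rV[R]_3) (b : 'rV[R]_1) j : row_mx a b 0 (ibase j) = a 0 j.
Proof. exact: row_mxEl. Qed.

Lemma row_mx_fib (a : 'rV[R]_3) (b : 'rV[R]_1) : row_mx a b 0 ifib = b 0 0.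
Proof. exact: row_mxEr. Qed.

Lemma base_row_mx (a : 'rV[R]_3) (b : 'rV[R]_1) : base (row_mx a b) = a.
Proof. exact: row_mxKl. Qed.

Lemma fib_row_mx (a : 'rV[R]_3) (b : 'rV[R]_1) : fib (row_mx a b) = b 0 0.
Proof. by rewrite /fib row_mxKr. Qed.

Lemma wedgeE n (a b : 'rV[R]_n.+1) i j :
  wedge a b i j = a 0 i * b 0 j - b 0 i * a 0 j.
Proof. by rewrite !mxE !big_ord1 !mxE. Qed.

Lemma antisymmetric4 (M N : 'M[R]_(3 + 1)) : M^T = - M -> N^T = - N ->
  M (ibase ix) (ibase iy) = N (ibase ix) (ibase iy) ->
  M (ibase ix) (ibase ip) = N (ibase ix) (ibase ip) ->
  M (ibase iy) (ibase ip) = N (ibase iy) (ibase ip) ->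
  (forall j, M ifib (ibase j) = N ifib (ibase j)) -> M = N.
Proof.
move=> MT NT xy xp yp s.
have MA i j : M i j = - M j i by move/matrixP: MT => /(_ j i); rewrite !mxE.
have NA i j : N i j = - N j i by move/matrixP: NT => /(_ j i); rewrite !mxE.
have M0 i : M i i = 0 by apply/eqP; rewrite -eqNr -MA.
have N0 i : N i i = 0 by apply/eqP; rewrite -eqNr -NA.
apply/matrixP; apply: ord4P; apply: ord4P;
  by [rewrite M0 N0|exact: xy|exact: xp|exact: yp|exact: s|
      rewrite MA NA (xy, xp, yp, s)].
Qed.

Lemma tr_wedge n (a b : 'rV[R]_n.+1) : (wedge a b)^T = - wedge a b.
Proof. by rewrite /wedge linearB/= !trmx_mul !trmxK opprB. Qed.

Lemma tr_extd n (a : 'rV[R]_n.+1 -> 'rV[R]_n.+1) (q : 'rV[R]_n.+1) : (extd a q)^T = - extd a q.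
Proof. by apply/matrixP => i j; rewrite !mxE opprB. Qed.

Lemma extd_eq n (a b : 'rV[R]_n.+1 -> 'rV[R]_n.+1) U (q : 'rV[R]_n.+1) : open U ->
  (forall x, U x -> a x = b x) -> U q -> extd a q = extd b q.
Proof.
move=> Uo ab Uq; apply/matrixP => i j; rewrite !mxE.
by congr (_ - _); apply: (partial_open _ Uo _ Uq) => x /ab ->.
Qed.

Lemma gradient_fib u : has_gradient (@fib R) u (fun i => (i == ifib)%:R).
Proof.
apply: gradient_near (gradient_coord ifib u).
by near=> x; rewrite fib_coord.
Unshelve. all: by end_near. Qed.

Section ScaledForm.
Context (phi : 'rV[R]_(3 + 1) -> R) (dphi : R) (w : 'rV[R]_3 -> 'rV[R]_3).
Context (u : 'rV[R]_(3 + 1)).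
Hypothesis phiu : has_gradient phi u (fun i => dphi * (i == ifib)%:R).
Hypothesis wu : differentiable_form w (base u).
(** For [phi] equal to 1/s, s and 1 this gives [omega1], [omega2] and [omega3]; the zero block says
    that the tautological forms are horizontal. *)
Let W x : 'rV[R]_(3 + 1) := row_mx (phi x *: w (base x)) 0.

Lemma gradient_scaled_form j : has_gradient (fun x => W x 0 (ibase j)) u
  (fun i => match fintype.split (i : 'I_(3 + 1)) with
    | inl k => phi u * partial k (fun q => w q 0 j) (base u)
    | inr _ => dphi * w (base u) 0 j end).
Proof.
have H := gradientM phiu (gradient_base (differentiable_gradient (wu j))).
apply: gradient_near (gradient_eq H _).
  by near=> x; rewrite /W row_mx_base mxE.
move=> i /=; case: fintype.split_ordP => k ->.
  by rewrite eq_base_fib mulr0 mul0r add0r.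
by rewrite (ord1 k) eqxx mulr1 mulr0 addr0.
Unshelve. all: by end_near. Qed.

Lemma gradient_scaled_form0 : has_gradient (fun x => W x 0 ifib) u (fun=> 0).
Proof.
apply: gradient_near (gradient_cst 0 u).
by near=> x; rewrite /W row_mx_fib mxE.
Unshelve. all: by end_near. Qed.

Lemma extd_scaled_form_base i j :
  extd W u (ibase i) (ibase j) = phi u * extd w (base u) i j.
Proof.
rewrite !mxE !(gradient_partial _ (gradient_scaled_form _)).
by rewrite !(unsplitK (inl _)) mulrBr.
Qed.

Lemma extd_scaled_form_fib j : extd W u ifib (ibase j) = dphi * w (base u) 0 j.
Proof.
rewrite mxE (gradient_partial _ (gradient_scaled_form _)).
rewrite (gradient_partial _ gradient_scaled_form0).
by rewrite (unsplitK (inr _)) subr0.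
Qed.

End ScaledForm.

Section ConnectionTypeForm.
Context (k : R) (w : 'rV[R]_3 -> 'rV[R]_3) (u : 'rV[R]_(3 + 1)).
Hypothesis u0 : bundle u.
Hypothesis wu : differentiable_form w (base u).

(* w + k ds/s *)
Definition vertical_extension x : 'rV[R]_(3 + 1) :=
  row_mx (w (base x)) (const_mx (k / fib x)).

Lemma gradient_vertical_extension_base j :
  has_gradient (fun x => vertical_extension x 0 (ibase j)) u
  (fun i => match fintype.split (i : 'I_(3 + 1)) with
    | inl k => partial k (fun q => w q 0 j) (base u)
    | inr _ => 0 end).
Proof.
apply: gradient_near (gradient_base (differentiable_gradient (wu j))).
by near=> x; rewrite /vertical_extension row_mx_base.
Unshelve. all: by end_near. Qed.

Lemma gradient_vertical_extension_fib :
  has_gradient (fun x => vertical_extension x 0 ifib) u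
    (fun i => - k / fib u ^+ 2 * (i == ifib)%:R).
Proof.
have H := gradientM (gradient_cst k u) (gradientV u0 (gradient_fib u)).
apply: gradient_near (gradient_eq H _).
  by near=> x; rewrite /vertical_extension row_mx_fib mxE.
by move=> i /=; rewrite mul0r add0r !(mulrN, mulNr) mulrCA mulrC.
Unshelve. all: by end_near. Qed.

Lemma extd_vertical_extension_base i j :
  extd vertical_extension u (ibase i) (ibase j) = extd w (base u) i j.
Proof.
rewrite !mxE !(gradient_partial _ (gradient_vertical_extension_base _)).
by rewrite !(unsplitK (inl _)).
Qed.

Lemma extd_vertical_extension_fib j : extd vertical_extension u ifib (ibase j) = 0.
Proof.
rewrite mxE (gradient_partial _ (gradient_vertical_extension_base _)).
rewrite (gradient_partial _ gradient_vertical_extension_fib).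
by rewrite (unsplitK (inr _)) eq_base_fib mulr0 subr0.
Qed.

Lemma differentiable_vertical_extension : differentiable_form vertical_extension u.
Proof.
apply: ord4P; [exact: (gradient_vertical_extension_base ix).1|
  exact: (gradient_vertical_extension_base iy).1|
  exact: (gradient_vertical_extension_base ip).1|
  exact: gradient_vertical_extension_fib.1].
Qed.

End ConnectionTypeForm.

End Coordinates.

Opaque partial.

Ltac smooth_atom := repeat apply: smooth_partial; eassumption.

(** Builds the gradient of an expression from its syntax and so fills in an existential variable.
    The leaves are coordinates, constants and functions known to be smooth, including iterated
    partial derivatives of these. *)
Ltac find_gradient :=
  cbv beta;
  lazymatch goal with
  | |- has_gradient (fun x => (@?F x + @?G x)%R) _ _ => eapply gradientD; find_gradient
  | |- has_gradient (fun x => (@?F x * @?G x)%R) _ _ => eapply gradientM; find_gradient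
  | |- has_gradient (fun x => (- @?F x)%R) _ _ => eapply gradientN; find_gradient
  | |- has_gradient (fun x => ((@?F x)^-1)%R) _ _ => eapply gradientV; [done|find_gradient]
  | |- has_gradient (fun x => @fun_of_matrix _ _ _ x _ _) _ _ => eapply gradient_coord
  | |- has_gradient (fun _ => ?a) _ _ => eapply gradient_cst
  | |- has_gradient _ _ _ => apply: smooth_gradient; [smooth_atom|exact: I]
  end.

(* Syntactic on purpose: comparing iterated partial derivatives up to
   conversion unfolds limits and does not terminate in practice. *)
Ltac generalize_partials :=
  repeat match goal with |- context [partial ?i ?F ?q] =>
    let d := fresh "jet" in generalize (partial i F q); intro d end.

Lemma axis_eqs : ((ix == iy) = false) * ((ix == ip) = false) * ((iy == ix) = false)
  * ((iy == ip) = false) * ((ip == ix) = false) * ((ip == iy) = false).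
Proof. by []. Qed.

(** * Structure equations and the Fefferman metric *)

Section StructureEquations.
Context {R : realType} (eta1 eta2 eta3 : 'rV[R]_3 -> 'rV[R]_3).
Context (u : 'rV[R]_(3 + 1)).
Hypothesis u0 : bundle u.
Hypothesis eta1d : differentiable_form eta1 (base u).
Hypothesis eta2d : differentiable_form eta2 (base u).
Hypothesis eta3d : differentiable_form eta3 (base u).

Lemma entryD n (M N : 'M[R]_n.+1) i j : (M + N) i j = M i j + N i j.
Proof. by rewrite mxE. Qed.
Lemma entryN n (M : 'M[R]_n.+1) i j : (- M) i j = - M i j.
Proof. by rewrite mxE. Qed.
Lemma entryZ n (c : R) (M : 'M[R]_n.+1) i j : (c *: M) i j = c * M i j.
Proof. by rewrite mxE. Qed.


Lemma omega1_base j : omega1 eta1 u 0 (ibase j) = (fib u)^-1 * eta1 (base u) 0 j.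
Proof. by rewrite /omega1 row_mx_base mxE. Qed.
Lemma omega2_base j : omega2 eta2 u 0 (ibase j) = fib u * eta2 (base u) 0 j.
Proof. by rewrite /omega2 row_mx_base mxE. Qed.
Lemma omega3_base j : omega3 eta3 u 0 (ibase j) = eta3 (base u) 0 j.
Proof. by rewrite /omega3 row_mx_base. Qed.
Lemma omega1_fib : omega1 eta1 u 0 ifib = 0.
Proof. by rewrite /omega1 row_mx_fib mxE. Qed.
Lemma omega2_fib : omega2 eta2 u 0 ifib = 0.
Proof. by rewrite /omega2 row_mx_fib mxE. Qed.
Lemma omega3_fib : omega3 eta3 u 0 ifib = 0.
Proof. by rewrite /omega3 row_mx_fib mxE. Qed.
Let omegaE := (omega1_base, omega2_base, omega3_base, omega1_fib, omega2_fib, omega3_fib).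

Lemma extd_omega1 : 
  (forall i j, extd (omega1 eta1) u (ibase i) (ibase j) = (fib u)^-1 * extd eta1 (base u) i j) *
  (forall j, extd (omega1 eta1) u ifib (ibase j) = - (fib u) ^- 2 * eta1 (base u) 0 j).
Proof.
have g : has_gradient (fun x => (fib x)^-1) u
    (fun i => - (fib u) ^- 2 * (i == ifib)%:R).
  apply: gradient_eq (gradientV u0 (gradient_fib u)) _ => i /=.
  by rewrite !mulNr mulrC.
by split=> *; [exact: (extd_scaled_form_base g)|exact: (extd_scaled_form_fib g)].
Qed.

Lemma extd_omega2 : 
  (forall i j, extd (omega2 eta2) u (ibase i) (ibase j) = fib u * extd eta2 (base u) i j) *
  (forall j, extd (omega2 eta2) u ifib (ibase j) = eta2 (base u) 0 j).
Proof.
have g : has_gradient (@fib R) u (fun i => 1 * (i == ifib)%:R).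
  by apply: gradient_eq (gradient_fib u) _ => i /=; rewrite mul1r.
split=> *; first exact: (extd_scaled_form_base g).
by rewrite (extd_scaled_form_fib g)// mul1r.
Qed.

Lemma extd_omega3 : 
  (forall i j, extd (omega3 eta3) u (ibase i) (ibase j) = extd eta3 (base u) i j) *
  (forall j, extd (omega3 eta3) u ifib (ibase j) = 0).
Proof.
have g : has_gradient (fun=> 1) u (fun i => 0 * (i == ifib)%:R).
  by apply: gradient_eq (gradient_cst 1 u) _ => i /=; rewrite mul0r.
have E : omega3 eta3 = fun x => row_mx (1 *: eta3 (base x)) 0.
  by apply/funext => x; rewrite scale1r.
split=> *; rewrite E; first by rewrite (extd_scaled_form_base g)// mul1r.
by rewrite (extd_scaled_form_fib g)// mul0r.
Qed.


Definition structure_equations_at alpha (a1 a2 b1 b2 K : R) : Prop :=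
  [/\ extd (omega1 eta1) u = - wedge (alpha u) (omega1 eta1 u)
                      + a1 *: wedge (omega2 eta2 u) (omega3 eta3 u),
      extd (omega2 eta2) u = wedge (alpha u) (omega2 eta2 u)
                      + a2 *: wedge (omega3 eta3 u) (omega1 eta1 u),
      extd (omega3 eta3) u = wedge (omega1 eta1 u) (omega2 eta2 u)
    & extd alpha u = b1 *: wedge (omega2 eta2 u) (omega3 eta3 u)
                     + b2 *: wedge (omega3 eta3 u) (omega1 eta1 u)
                     + K *: wedge (omega1 eta1 u) (omega2 eta2 u)].

Definition pairs_of_axes (P : 'I_3 -> 'I_3 -> Prop) := [/\ P ix iy, P ix ip & P iy ip].

Lemma pairs_of_axes_iff (P Q : 'I_3 -> 'I_3 -> Prop) :
  (forall i j, P i j <-> Q i j) -> pairs_of_axes P <-> pairs_of_axes Q.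
Proof. by move=> PQ; split=> -[? ? ?]; split; apply/PQ. Qed.

Lemma antisymmetric4P (M N : 'M[R]_(3 + 1)) : M^T = - M -> N^T = - N ->
  (M = N <-> (forall j, M ifib (ibase j) = N ifib (ibase j)) /\
     pairs_of_axes (fun i j => M (ibase i) (ibase j) = N (ibase i) (ibase j))).
Proof.
by move=> MT NT; split=> [->|[s [xy xp yp]]]; [split=> //; split|exact: antisymmetric4].
Qed.

(** Since alpha has fibre component 1/s, the ds-components of the first three equations hold
    identically: differentiating the factors 1/s and s reproduces the alpha terms. What remains
    lives on the base, and each equation there keeps s only in [alpha] and in the coefficients [a1],
    [a2], [b1], [b2]. *)
Lemma structure_equations_base (alpha : 'rV[R]_(3 + 1) -> 'rV[R]_(3 + 1)) (a1 a2 b1 b2 K : R) :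
  alpha u 0 ifib = (fib u)^-1 ->
  structure_equations_at alpha a1 a2 b1 b2 K <->
  [/\ pairs_of_axes (fun i j => extd eta1 (base u) i j =
        - (alpha u 0 (ibase i) * eta1 (base u) 0 j - eta1 (base u) 0 i * alpha u 0 (ibase j))
        + a1 * fib u ^+ 2 * (eta2 (base u) 0 i * eta3 (base u) 0 j
                             - eta3 (base u) 0 i * eta2 (base u) 0 j)),
      pairs_of_axes (fun i j => extd eta2 (base u) i j =
        alpha u 0 (ibase i) * eta2 (base u) 0 j - eta2 (base u) 0 i * alpha u 0 (ibase j)
        + a2 * fib u ^- 2 * (eta3 (base u) 0 i * eta1 (base u) 0 j
                             - eta1 (base u) 0 i * eta3 (base u) 0 j)),
      pairs_of_axes (fun i j => extd eta3 (base u) i j =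
        eta1 (base u) 0 i * eta2 (base u) 0 j - eta2 (base u) 0 i * eta1 (base u) 0 j)
    & (forall j, extd alpha u ifib (ibase j) = 0) /\
      pairs_of_axes (fun i j => extd alpha u (ibase i) (ibase j) =
        b1 * fib u * (eta2 (base u) 0 i * eta3 (base u) 0 j
                      - eta3 (base u) 0 i * eta2 (base u) 0 j)
        + b2 / fib u * (eta3 (base u) 0 i * eta1 (base u) 0 j
                        - eta1 (base u) 0 i * eta3 (base u) 0 j)
        + K * (eta1 (base u) 0 i * eta2 (base u) 0 j
               - eta2 (base u) 0 i * eta1 (base u) 0 j))].
Proof.
move=> als; have s0 : fib u != 0 by exact: u0.
have trD (M N : 'M[R]_(3 + 1)) : M^T = - M -> N^T = - N -> (M + N)^T = - (M + N).
  by move=> MT NT; rewrite linearD/= MT NT opprD.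
have trZ (c : R) (M : 'M[R]_(3 + 1)) : M^T = - M -> (c *: M)^T = - (c *: M).
  by move=> MT; rewrite linearZ/= MT scalerN.
have trN (M : 'M[R]_(3 + 1)) : M^T = - M -> (- M)^T = - - M.
  by move=> MT; rewrite linearN/= MT.
have tw (a b : 'rV[R]_(3 + 1)) := tr_wedge a b.
have E1 := propext (antisymmetric4P (tr_extd (omega1 eta1) u)
  (trD _ _ (trN _ (tw (alpha u) (omega1 eta1 u))) (trZ a1 _ (tw (omega2 eta2 u) (omega3 eta3 u))))).
have E2 := propext (antisymmetric4P (tr_extd (omega2 eta2) u)
  (trD _ _ (tw (alpha u) (omega2 eta2 u)) (trZ a2 _ (tw (omega3 eta3 u) (omega1 eta1 u))))).
have E3 := propext (antisymmetric4P (tr_extd (omega3 eta3) u) (tw (omega1 eta1 u) (omega2 eta2 u))).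
have E4 := propext (antisymmetric4P (tr_extd alpha u)
  (trD _ _ (trD _ _ (trZ b1 _ (tw (omega2 eta2 u) (omega3 eta3 u)))
     (trZ b2 _ (tw (omega3 eta3 u) (omega1 eta1 u)))) (trZ K _ (tw (omega1 eta1 u) (omega2 eta2 u))))).
rewrite /structure_equations_at {}E1 {}E2 {}E3 {}E4.
(* The ds-component of d(omega1) is -1/s^2 [eta1], which is exactly that of - alpha /\ omega1. *)
have -> : (forall j, extd (omega1 eta1) u ifib (ibase j) =
    (- wedge (alpha u) (omega1 eta1 u) + a1 *: wedge (omega2 eta2 u) (omega3 eta3 u))
      ifib (ibase j)) = True.
  apply/propext; split=> // _ j.
  rewrite !(entryD, entryN, entryZ, wedgeE) !omegaE extd_omega1.2 als.
  by generalize (eta1 (base u) 0 j); generalize (fib u) s0 => *; field.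
have -> : (forall j, extd (omega2 eta2) u ifib (ibase j) =
    (wedge (alpha u) (omega2 eta2 u) + a2 *: wedge (omega3 eta3 u) (omega1 eta1 u))
      ifib (ibase j)) = True.
  apply/propext; split=> // _ j.
  rewrite !(entryD, entryN, entryZ, wedgeE) !omegaE extd_omega2.2 als.
  by generalize (eta2 (base u) 0 j); generalize (fib u) s0 => *; field.
have -> : (forall j, extd (omega3 eta3) u ifib (ibase j) =
    wedge (omega1 eta1 u) (omega2 eta2 u) ifib (ibase j)) = True.
  apply/propext; split=> // _ j.
  by rewrite wedgeE !omegaE extd_omega3.2 !mul0r subr0.
have P1 i j : extd (omega1 eta1) u (ibase i) (ibase j) =
    (- wedge (alpha u) (omega1 eta1 u) + a1 *: wedge (omega2 eta2 u) (omega3 eta3 u))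
      (ibase i) (ibase j) <-> 
    extd eta1 (base u) i j =
        - (alpha u 0 (ibase i) * eta1 (base u) 0 j - eta1 (base u) 0 i * alpha u 0 (ibase j))
        + a1 * fib u ^+ 2 * (eta2 (base u) 0 i * eta3 (base u) 0 j
                             - eta3 (base u) 0 i * eta2 (base u) 0 j).
  rewrite !(entryD, entryN, entryZ, wedgeE) !omegaE extd_omega1.1.
  generalize (extd eta1 (base u) i j) (eta1 (base u) 0 j) (eta1 (base u) 0 i)
    (eta2 (base u) 0 j) (eta2 (base u) 0 i) (eta3 (base u) 0 j) (eta3 (base u) 0 i).
  move: (alpha u 0 (ibase i)) (alpha u 0 (ibase j)) => al1 al2.
  generalize (fib u) s0 => s s1 x *; split=> e; last by rewrite e; field.
  by rewrite -[x](mulVKf s1) e; field.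
have P2 i j : extd (omega2 eta2) u (ibase i) (ibase j) =
    (wedge (alpha u) (omega2 eta2 u) + a2 *: wedge (omega3 eta3 u) (omega1 eta1 u))
      (ibase i) (ibase j) <-> 
    extd eta2 (base u) i j =
        alpha u 0 (ibase i) * eta2 (base u) 0 j - eta2 (base u) 0 i * alpha u 0 (ibase j)
        + a2 * fib u ^- 2 * (eta3 (base u) 0 i * eta1 (base u) 0 j
                             - eta1 (base u) 0 i * eta3 (base u) 0 j).
  rewrite !(entryD, entryN, entryZ, wedgeE) !omegaE extd_omega2.1.
  generalize (extd eta2 (base u) i j) (eta1 (base u) 0 j) (eta1 (base u) 0 i)
    (eta2 (base u) 0 j) (eta2 (base u) 0 i) (eta3 (base u) 0 j) (eta3 (base u) 0 i).
  move: (alpha u 0 (ibase i)) (alpha u 0 (ibase j)) => al1 al2.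
  generalize (fib u) s0 => s s1 x *; split=> e; last by rewrite e; field.
  by rewrite -[x](mulKf s1) e; field.
have P3 i j : extd (omega3 eta3) u (ibase i) (ibase j) =
    wedge (omega1 eta1 u) (omega2 eta2 u) (ibase i) (ibase j) <->
    extd eta3 (base u) i j =
        eta1 (base u) 0 i * eta2 (base u) 0 j - eta2 (base u) 0 i * eta1 (base u) 0 j.
  rewrite wedgeE !omegaE extd_omega3.1.
  generalize (extd eta3 (base u) i j) (eta1 (base u) 0 j) (eta1 (base u) 0 i)
    (eta2 (base u) 0 j) (eta2 (base u) 0 i).
  by generalize (fib u) s0 => *; split=> ->; field.
rewrite (propext (pairs_of_axes_iff P1)) (propext (pairs_of_axes_iff P2)) (propext (pairs_of_axes_iff P3)).
have P4 i j : extd alpha u (ibase i) (ibase j) =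
    (b1 *: wedge (omega2 eta2 u) (omega3 eta3 u) + b2 *: wedge (omega3 eta3 u) (omega1 eta1 u)
     + K *: wedge (omega1 eta1 u) (omega2 eta2 u)) (ibase i) (ibase j) <->
    extd alpha u (ibase i) (ibase j) =
        b1 * fib u * (eta2 (base u) 0 i * eta3 (base u) 0 j
                      - eta3 (base u) 0 i * eta2 (base u) 0 j)
        + b2 / fib u * (eta3 (base u) 0 i * eta1 (base u) 0 j
                        - eta1 (base u) 0 i * eta3 (base u) 0 j)
        + K * (eta1 (base u) 0 i * eta2 (base u) 0 j
               - eta2 (base u) 0 i * eta1 (base u) 0 j).
  rewrite !(entryD, entryN, entryZ, wedgeE) !omegaE.
  generalize (extd alpha u (ibase i) (ibase j)) (eta1 (base u) 0 j) (eta1 (base u) 0 i)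
    (eta2 (base u) 0 j) (eta2 (base u) 0 i) (eta3 (base u) 0 j) (eta3 (base u) 0 i).
  by generalize (fib u) s0 => *; split=> ->; field.
rewrite (propext (pairs_of_axes_iff P4)).
have -> : (forall j, extd alpha u ifib (ibase j) =
    (b1 *: wedge (omega2 eta2 u) (omega3 eta3 u) + b2 *: wedge (omega3 eta3 u) (omega1 eta1 u)
     + K *: wedge (omega1 eta1 u) (omega2 eta2 u)) ifib (ibase j)) =
    (forall j, extd alpha u ifib (ibase j) = 0).
  have E j : (b1 *: wedge (omega2 eta2 u) (omega3 eta3 u)
      + b2 *: wedge (omega3 eta3 u) (omega1 eta1 u)
      + K *: wedge (omega1 eta1 u) (omega2 eta2 u)) ifib (ibase j) = 0.
    rewrite !(entryD, entryN, entryZ, wedgeE) !omegaE.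
    by rewrite !(mul0r, subr0, mulr0, addr0).
  by apply/propext; split=> H j; move: (H j); rewrite E.
by split=> -[]; [move=> [_ h1] [_ h2] [_ h3] h4|move=> h1 h2 h3 h4].
Qed.

End StructureEquations.


(** The first equation is d(eta2) on the pair (d_x + p d_y, d_p). There [eta3] vanishes on both
    vectors, so the torsion term drops out, and [eta2] vanishes on d_p, so only alpha(d_p) remains.
    The other two are d(eta1) on (d_x, d_p) and (d_y, d_p), where [eta2] and [eta3] vanish on d_p;
    they give the remaining components. [X] and [N] stand for [mX] and [eN]. *)
Lemma connection_coefficients (R : realType) (m A f p mp X N Ax Ay Ap fp c1 c2 s ax ay ap : R) :
  m != 0 -> A != 0 -> s != 0 ->
  ax * 0 - - (m + p * mp) / A * ap + c2 / s ^+ 2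
    * (- (p * m) * A - - (p * (A * (X / m)) + f * A) * 0)
  + p * (ay * 0 - mp / A * ap + c2 / s ^+ 2 * (m * A - A * (X / m) * 0))
  = - (- 2 * mp + m * Ap / A) / A ->
  Ax + A * (X / m) + p * (Ap * (X / m) + A * (N - 2 * mp * X / m / m)) + fp * A + f * Ap =
  - (ax * A - - (p * (A * (X / m)) + f * A) * ap)
  + c1 * s ^+ 2 * (- (m + p * mp) / A * 0 - - (p * m) * 0) ->
  Ay - (Ap * (X / m) + A * (N - 2 * mp * X / m / m)) =
  - (ay * A - A * (X / m) * ap) + c1 * s ^+ 2 * (mp / A * 0 - m * 0) ->
  [/\ ax = - (Ax / A + fp + X / m + p * N + 2 * (f * mp / m)),
      ay = - (Ay / A) + N & ap = - (Ap / A) + 2 * (mp / m)].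
Proof.
move=> m0 A0 s0 D2 Ex Ey.
have apE : ap = - (Ap / A) + 2 * (mp / m).
  have e : ap * m / A = - (- 2 * mp + m * Ap / A) / A by rewrite -D2; field; rewrite ?m0 ?A0 ?s0.
  by transitivity (ap * m / A * A / m); [|rewrite e]; field; rewrite ?m0 ?A0 ?s0.
have ayE : ay = - (Ay / A) + N.
  have e : ay * A = A * (X / m) * ap - (Ay - (Ap * (X / m) + A * (N - 2 * mp * X / m / m))).
    by rewrite Ey; field; rewrite ?m0 ?A0 ?s0.
  by transitivity (ay * A / A); [|rewrite e apE]; field; rewrite ?m0 ?A0 ?s0.
split=> //.
have e : ax * A = - (p * (A * (X / m)) + f * A) * ap - (Ax + A * (X / m)
  + p * (Ap * (X / m) + A * (N - 2 * mp * X / m / m)) + fp * A + f * Ap).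
  by rewrite Ex; field; rewrite ?m0 ?A0 ?s0.
by transitivity (ax * A / A); [|rewrite e apE]; field; rewrite ?m0 ?A0 ?s0.
Qed.

(** * The normal form of an adapted coframe: connection, curvature and metric *)

Section Model.
Context {R : realType} (f m A : 'rV[R]_3 -> R).
Hypothesis fs : smooth_on setT f.
Hypothesis ms : smooth_on setT m.
Hypothesis As : smooth_on setT A.
Hypothesis m0 : forall q, m q != 0.
Hypothesis A0 : forall q, A q != 0.
Implicit Types (q : 'rV[R]_3) (u : 'rV[R]_(3 + 1)).

(* mX is the derivative of m along L2; e1 is the coefficient of theta in eta1. *)
Definition mX q : R := partial ix m q + q 0 ip * partial iy m q + f q * partial ip m q.
Definition e1 q : R := A q * (mX q * (m q)^-1).
Definition model1 q : 'rV[R]_3 := vec3 (- (q 0 ip * e1 q + f q * A q)) (e1 q) (A q).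
Definition model2 q : 'rV[R]_3 :=
  vec3 (- (m q + q 0 ip * partial ip m q) * (A q)^-1) (partial ip m q * (A q)^-1) 0.
Definition model3 q : 'rV[R]_3 := vec3 (- (q 0 ip * m q)) (m q) 0.

(* With l = log|m|, eN = 2 (d_p l) (X l) + d_p (X l) and
   beta = - d log|A| - (f_p + X l) dx + 2 (d_p l) psi + eN theta. *)
Definition eN q : R :=
  partial ip mX q * (m q)^-1 + partial ip m q * mX q * (m q)^-1 * (m q)^-1.
Definition beta q : 'rV[R]_3 :=
  vec3 (- (partial ix A q * (A q)^-1 + partial ip f q + mX q * (m q)^-1
          + q 0 ip * eN q + 2 * (f q * partial ip m q * (m q)^-1)))
       (- (partial iy A q * (A q)^-1) + eN q)
       (- (partial ip A q * (A q)^-1) + 2 * (partial ip m q * (m q)^-1)).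

Let oT : open [set: 'rV[R]_3]. Proof. exact: openT. Qed.

Lemma smooth_mX : smooth_on setT mX.
Proof.
apply: (smoothD oT); [apply: (smoothD oT)|]; [smooth_atom|apply: (smoothM oT)|apply: (smoothM oT)];
  by [exact: smooth_coord|smooth_atom].
Qed.

Lemma smooth_mV : smooth_on setT (fun q => (m q)^-1).
Proof. exact: smoothV. Qed.
Lemma smooth_AV : smooth_on setT (fun q => (A q)^-1).
Proof. exact: smoothV. Qed.

Lemma smooth_eN : smooth_on setT eN.
Proof.
have := smooth_mX => ?; have := smooth_mV => ?.
apply: (smoothD oT); repeat apply: (smoothM oT); by [|smooth_atom].
Qed.

Lemma smooth_e1 : smooth_on setT e1.
Proof.
have := smooth_mX => ?; have := smooth_mV => ?.
repeat apply: (smoothM oT); by [].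
Qed.

Lemma gradient_mX q : has_gradient mX q (fun i =>
  partial i (partial ix m) q + ((i == ip)%:R * partial iy m q + q 0 ip * partial i (partial iy m) q)
  + (partial i f q * partial ip m q + f q * partial i (partial ip m) q)).
Proof.
apply: gradient_eq; first by rewrite /mX; find_gradient.
by [].
Qed.

Lemma gradient_e1 q : has_gradient e1 q (fun i => partial i A q * (mX q * (m q)^-1)
  + A q * (partial i mX q * (m q)^-1 - mX q * (partial i m q) * (m q)^-1 * (m q)^-1)).
Proof.
have mXs := smooth_mX.
apply: gradient_eq; first by rewrite /e1; find_gradient.
move=> i /=; generalize (m0 q); generalize_partials.
by generalize (mX q) (m q) (A q) => x y z y0; field.
Qed.


Lemma partial_vec3 (F0 F1 F2 : 'rV[R]_3 -> R) i q :
  (partial i (fun x => vec3 (F0 x) (F1 x) (F2 x) 0 ix) q = partial i F0 q) *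
  (partial i (fun x => vec3 (F0 x) (F1 x) (F2 x) 0 iy) q = partial i F1 q) *
  (partial i (fun x => vec3 (F0 x) (F1 x) (F2 x) 0 ip) q = partial i F2 q).
Proof. by do !split; congr (partial _ _ _); apply/funext => x; rewrite vec3E. Qed.

(* The part of d(eta1), modulo eta2 /\ eta3, that determines the connection. *)
Lemma extd_model1 q :
  (extd model1 q ix ip = partial ix A q + e1 q + q 0 ip * partial ip e1 q
     + partial ip f q * A q + f q * partial ip A q) *
  (extd model1 q iy ip = partial iy A q - partial ip e1 q).
Proof.
rewrite !mxE /model1 !partial_vec3; split => //.
have e1s := smooth_e1.
eassert (H : has_gradient (fun x => - (x 0 ip * e1 x + f x * A x)) q _) by find_gradient.
rewrite (gradient_partial ip H) {H} eqxx mul1r opprK.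
generalize_partials; generalize (e1 q) (q 0 ip) (f q) (A q) => *; ring.
Qed.

(** This is the value on (d_x + p d_y, d_p), two vectors killed by [eta3]; it contains no torsion
    and determines the d_p component of the connection. *)
Lemma extd_model2 q :
  extd model2 q ix ip + q 0 ip * extd model2 q iy ip =
  - (- 2 * partial ip m q + m q * partial ip A q * (A q)^-1) * (A q)^-1.
Proof.
rewrite !mxE /model2 !partial_vec3.
eassert (H : has_gradient (fun x => - (m x + x 0 ip * partial ip m x) * (A x)^-1) q _)
  by find_gradient.
eassert (H' : has_gradient (fun x => partial ip m x * (A x)^-1) q _)
  by find_gradient.
rewrite (gradient_partial ip H) (gradient_partial ip H') {H H'} eqxx mulr1n.
rewrite !(gradient_partial _ (gradient_cst 0 q)).
generalize (A0 q); generalize_partials; generalize (q 0 ip) (m q) (A q) => *. by field.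
Qed.

Lemma extd_model3 q :
  (extd model3 q ix iy = partial ix m q + q 0 ip * partial iy m q) *
  (extd model3 q ix ip = m q + q 0 ip * partial ip m q) *
  (extd model3 q iy ip = - partial ip m q).
Proof.
rewrite !mxE /model3 !partial_vec3.
eassert (H : has_gradient (fun x => - (x 0 ip * m x)) q _) by find_gradient.
rewrite !(gradient_partial _ H) {H} !axis_eqs eqxx mulr1n mulr0n.
rewrite !(gradient_partial _ (gradient_cst 0 q)).
by generalize_partials; generalize (q 0 ip) (m q) => *; do !split; ring.
Qed.

Lemma smooth_vec3 (F0 F1 F2 : 'rV[R]_3 -> R) :
  smooth_on setT F0 -> smooth_on setT F1 -> smooth_on setT F2 ->
  smooth_form_on setT (fun q => vec3 (F0 q) (F1 q) (F2 q)).
Proof.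
move=> s0 s1 s2; apply: ord3P; [move: s0|move: s1|move: s2];
  by apply: (smooth_eq oT) => x _; rewrite vec3E.
Qed.

Lemma smooth_model1 : smooth_form_on setT model1.
Proof.
have := smooth_e1 => ?.
have E0 : smooth_on setT (fun q => - (q 0 ip * e1 q + f q * A q)).
  apply: (smoothN oT); apply: (smoothD oT); apply: (smoothM oT) => //; exact: smooth_coord.
exact: smooth_vec3.
Qed.

Lemma smooth_model2 : smooth_form_on setT model2.
Proof.
have := smooth_AV => ?.
have E0 : smooth_on setT (fun q => - (m q + q 0 ip * partial ip m q) * (A q)^-1).
  apply: (smoothM oT) => //; apply: (smoothN oT); apply: (smoothD oT) => //.
  by apply: (smoothM oT); [exact: smooth_coord|smooth_atom].
have E1 : smooth_on setT (fun q => partial ip m q * (A q)^-1).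
  by apply: (smoothM oT) => //; smooth_atom.
by apply: smooth_vec3 => //; exact: smooth_cst.
Qed.

Lemma smooth_model3 : smooth_form_on setT model3.
Proof.
have E0 : smooth_on setT (fun q => - (q 0 ip * m q)).
  by apply: (smoothN oT); apply: (smoothM oT) => //; exact: smooth_coord.
by apply: smooth_vec3 => //; exact: smooth_cst.
Qed.

Lemma smooth_beta : smooth_form_on setT beta.
Proof.
have := smooth_mX => ?; have := smooth_mV => ?; have := smooth_AV => ?.
have := smooth_eN => ?.
have E0 : smooth_on setT (fun q => - (partial ix A q * (A q)^-1 + partial ip f q
   + mX q * (m q)^-1 + q 0 ip * eN q + 2 * (f q * partial ip m q * (m q)^-1))).
  by apply: (smoothN oT); repeat apply: (smoothD oT); repeat apply: (smoothM oT) => //;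
  first [smooth_atom|exact: smooth_coord|exact: smooth_cst].
have E1 : smooth_on setT (fun q => - (partial iy A q * (A q)^-1) + eN q).
  by apply: (smoothD oT) => //; apply: (smoothN oT); apply: (smoothM oT) => //; smooth_atom.
have E2 : smooth_on setT
    (fun q => - (partial ip A q * (A q)^-1) + 2 * (partial ip m q * (m q)^-1)).
  by apply: (smoothD oT); [apply: (smoothN oT)|]; repeat apply: (smoothM oT) => //;
  first [smooth_atom|exact: smooth_cst].
exact: smooth_vec3.
Qed.

Lemma smooth_form_differentiable (w : 'rV[R]_3 -> 'rV[R]_3) q :
  smooth_form_on setT w -> differentiable_form w q.
Proof. by move=> ws i; exact: smooth_differentiable (ws i) _. Qed.

Definition model_connection : 'rV[R]_(3 + 1) -> 'rV[R]_(3 + 1) := vertical_extension 1 beta.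

Lemma model_connection_entries u :
  (forall j, model_connection u 0 (ibase j) = beta (base u) 0 j) *
  (model_connection u 0 ifib = (fib u)^-1).
Proof.
split=> *; rewrite /model_connection /vertical_extension ?row_mx_base ?row_mx_fib//.
by rewrite mxE mul1r.
Qed.

Lemma partial_e1 q : partial ip e1 q = partial ip A q * (mX q * (m q)^-1)
  + A q * (eN q - 2 * partial ip m q * mX q * (m q)^-1 * (m q)^-1).
Proof.
rewrite (gradient_partial ip (gradient_e1 _)) /eN.
generalize (m0 q); generalize_partials.
by generalize (mX q) (m q) => *; field.
Qed.

Lemma connection_fib (alpha : 'rV[R]_(3 + 1) -> 'rV[R]_(3 + 1)) u : connection_form alpha -> bundle u ->
  alpha u 0 ifib = (fib u)^-1.
Proof.
move=> [_ + _] u0 => /(_ u u0); rewrite /pairing sum4E /fundamental.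
rewrite !row_mx_base row_mx_fib !mxE !mulr0 !add0r -/(fib u).
by move=> e; apply: (mulIf (u0 : fib u != 0)); rewrite mulVf// -e /fib mxE.
Qed.

Lemma connection_unique (alpha : 'rV[R]_(3 + 1) -> 'rV[R]_(3 + 1)) a1 a2 b1 b2 K u : connection_form alpha ->
  structure_equations model1 model2 model3 alpha a1 a2 b1 b2 K ->
  bundle u -> alpha u = model_connection u.
Proof.
move=> /connection_fib als /(_ u) + u0 => /(_ u0) S.
have als0 := als _ u0.
have [[_ xp1 yp1] [_ xp2 yp2] _ _] := (structure_equations_base u0
  (smooth_form_differentiable (base u) smooth_model1)
  (smooth_form_differentiable (base u) smooth_model2)
  (smooth_form_differentiable (base u) smooth_model3) _ _ _ _ _ als0).1 S.
suff H : [/\ alpha u 0 (ibase ix) = beta (base u) 0 ix,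
             alpha u 0 (ibase iy) = beta (base u) 0 iy &
             alpha u 0 (ibase ip) = beta (base u) 0 ip].
  by move: H => [hx hy hp]; apply/rowP; apply: ord4P;
    rewrite !model_connection_entries.
have D2 := extd_model2 (base u).
move: D2 xp1 yp1; rewrite xp2 yp2 !extd_model1.
rewrite /model1 /model2 /model3 !vec3E.
rewrite partial_e1 /e1.
rewrite /beta ?vec3E.
exact: connection_coefficients.
Qed.

(** The coefficient [K], read off from d(alpha) on (d_x + p d_y, d_p): the terms with [eta3] vanish
    there and eta1 /\ eta2 takes the value [m]. *)
Definition curvature q : R :=
  (partial ip (partial ip f) q + 4 * eN q - 6 * (partial ip m q * mX q / m q / m q)
   - 2 * (partial iy m q / m q)) / m q.

Lemma extd_beta q :
  extd beta q ix ip + q 0 ip * extd beta q iy ip = m q * curvature q.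
Proof.
rewrite !mxE /beta !partial_vec3.
have Xs := smooth_mX; have Ns := smooth_eN.
eassert (Hx : has_gradient (fun q => - (partial ix A q * (A q)^-1 + partial ip f q
   + mX q * (m q)^-1 + q 0 ip * eN q + 2 * (f q * partial ip m q * (m q)^-1))) q _)
  by find_gradient.
eassert (Hy : has_gradient (fun q => - (partial iy A q * (A q)^-1) + eN q) q _)
  by find_gradient.
eassert (Hp : has_gradient
    (fun q => - (partial ip A q * (A q)^-1) + 2 * (partial ip m q * (m q)^-1)) q _)
  by find_gradient.
rewrite !(gradient_partial _ Hx) !(gradient_partial _ Hy) !(gradient_partial _ Hp) {Hx Hy Hp}.
rewrite eqxx mulr1n.
(* Symmetry cancels the second derivatives of [A], which enter [beta] through an exact form; those
   of [m] combine into the p-derivative of [mX], hence into [eN]. *)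
have := smooth_partialC q ix ip ms; have := smooth_partialC q iy ip ms.
have := smooth_partialC q ix ip As; have := smooth_partialC q iy ip As.
have := gradient_partial ip (gradient_mX q).
rewrite eqxx mulr1n /curvature.
have : eN q = partial ip mX q * (m q)^-1 + partial ip m q * mX q * (m q)^-1 * (m q)^-1 by [].
have : mX q = partial ix m q + q 0 ip * partial iy m q + f q * partial ip m q by [].
generalize (m0 q) (A0 q); generalize_partials.
generalize (eN q) (mX q) (m q) (A q) (f q) (q 0 ip).
move=> N X mm AA ff p mm0 AA0 -> -> -> <- <- <- <-.
by field; rewrite ?mm0 ?AA0.
Qed.

Lemma curvature_unique (alpha : 'rV[R]_(3 + 1) -> 'rV[R]_(3 + 1)) a1 a2 b1 b2 K u :
  connection_form alpha ->
  structure_equations model1 model2 model3 alpha a1 a2 b1 b2 K ->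
  bundle u -> K u = curvature (base u).
Proof.
move=> alc S u0; have als := connection_fib alc u0.
(* The connections agree on the whole open set [bundle], not only at [u], and therefore have the
   same exterior derivative. *)
have E : extd alpha u = extd model_connection u.
  apply: (extd_eq open_bundle) u0 => x; exact: connection_unique alc S.
have [_ _ _ [_ [_ xp yp]]] := (structure_equations_base u0
  (smooth_form_differentiable (base u) smooth_model1)
  (smooth_form_differentiable (base u) smooth_model2)
  (smooth_form_differentiable (base u) smooth_model3) _ _ _ _ _ als).1 (S u u0).
have D := extd_beta (base u).
have bd := smooth_form_differentiable (base u) smooth_beta.
move: xp yp; rewrite E /model_connection !extd_vertical_extension_base// => xp yp.
move: D; rewrite xp yp /model1 /model2 /model3 !vec3E => D.
apply: (mulfI (m0 (base u))); rewrite -D.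
generalize (m0 (base u)) (A0 (base u)) (u0 : fib u != 0); generalize_partials.
generalize (e1 (base u)) (m (base u)) (A (base u)) (f (base u)) (base u 0 ip) (fib u).
by move=> e mm AA ff p s mm0 AA0 s0; field; rewrite ?mm0 ?AA0 ?s0.
Qed.

Definition theta q : 'rV[R]_3 := vec3 (- q 0 ip) 1 0.
Definition psi q : 'rV[R]_3 := vec3 (- f q) 0 1.
Definition dx q : 'rV[R]_3 := vec3 1 0 0.
(* 2/3 d log|A| - 1/3 d log|m| + 2/3 f_p dx + 1/6 f_pp theta *)
Definition rho_base q : 'rV[R]_3 :=
  vec3 (2 / 3 * (partial ix A q * (A q)^-1) + - (3^-1 * (partial ix m q * (m q)^-1))
        + (2 / 3 * partial ip f q + - (6^-1 * (q 0 ip * partial ip (partial ip f) q))))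
       (2 / 3 * (partial iy A q * (A q)^-1) + - (3^-1 * (partial iy m q * (m q)^-1))
        + 6^-1 * partial ip (partial ip f) q)
       (2 / 3 * (partial ip A q * (A q)^-1) + - (3^-1 * (partial ip m q * (m q)^-1))).

Definition contact_metric u : 'M[R]_(3 + 1) :=
  symprod (vertical_extension 0 theta u) (vertical_extension (- (2 / 3)) rho_base u)
  - symprod (vertical_extension 0 psi u) (vertical_extension 0 dx u).

Lemma symprodE n (a b : 'rV[R]_n.+1) i j :
  symprod a b i j = 2^-1 * (a 0 i * b 0 j + b 0 i * a 0 j).
Proof. by rewrite !mxE !big_ord1 !mxE. Qed.

Lemma vertical_extension_base k (w : 'rV[R]_3 -> 'rV[R]_3) u j :
  vertical_extension k w u 0 (ibase j) = w (base u) 0 j.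
Proof. by rewrite /vertical_extension row_mx_base. Qed.

Lemma vertical_extension_fib k (w : 'rV[R]_3 -> 'rV[R]_3) u :
  vertical_extension k w u 0 ifib = k / fib u.
Proof. by rewrite /vertical_extension row_mx_fib mxE. Qed.

(** With l = log|m|, omega1.omega2 equals - m psi.dx plus m theta times l_p psi - (X l) dx + l_p (X
    l) theta. Added to sigma, [eN] and the products l_p (X l) cancel, and the first derivatives of l
    that remain add up to -1/3 (l_y theta + (X l) dx + l_p psi), which is -1/3 dl. *)
Lemma fefferman_metric_model g u : fefferman_metric model1 model2 model3 g ->
  bundle u -> g u = m (base u) *: contact_metric u.
Proof.
move=> [alpha [a1 [a2 [b1 [b2 [K [alc S gE]]]]]]] u0; rewrite gE//.
rewrite (curvature_unique alc S u0) (connection_unique alc S u0).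
apply/matrixP => i j; rewrite /contact_metric.
rewrite !(entryD, entryN, entryZ, symprodE).
have sE k : (- (2 / 3) *: model_connection u + (6^-1 * curvature (base u)) *: omega3 model3 u) 0 k
  = - (2 / 3) * model_connection u 0 k + 6^-1 * curvature (base u) * omega3 model3 u 0 k.
  by rewrite !mxE.
rewrite !sE {sE}.
have : mX (base u) = partial ix m (base u) + base u 0 ip * partial iy m (base u)
  + f (base u) * partial ip m (base u) by [].
move: (fun k => omega1_base model1 u k) (fun k => omega2_base model2 u k)
  (fun k => omega3_base model3 u k) (omega1_fib model1 u) (omega2_fib model2 u)
  (omega3_fib model3 u) => o1 o2 o3 f1 f2 f3.
move: i j; apply: ord4P; apply: ord4P;
rewrite ?o1 ?o2 ?o3 ?f1 ?f2 ?f3 ?model_connection_entries ?vertical_extension_base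
  ?vertical_extension_fib /model1 /model2 /model3 /beta /theta /psi /dx /rho_base
  /curvature /e1 ?vec3E.
all: generalize (m0 (base u)) (A0 (base u)) (u0 : fib u != 0); generalize_partials.
all: generalize (eN (base u)) (mX (base u)) (m (base u)) (A (base u)) (f (base u))
  (base u 0 ip) (fib u).
all: by move=> N X mm AA ff p s mm0 AA0 s0 ->; field; rewrite ?mm0 ?AA0 ?s0.
Qed.

Lemma smooth_theta : smooth_form_on setT theta.
Proof.
apply: smooth_vec3; [apply: (smoothN oT); exact: smooth_coord|exact: smooth_cst|exact: smooth_cst].
Qed.

Lemma smooth_psi : smooth_form_on setT psi.
Proof.
by apply: smooth_vec3; [exact: (smoothN oT)|exact: smooth_cst|exact: smooth_cst].
Qed.

Lemma smooth_dx : smooth_form_on setT dx.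
Proof. apply: smooth_vec3; exact: smooth_cst. Qed.

Lemma smooth_rho_base : smooth_form_on setT rho_base.
Proof.
have := smooth_mV => ?; have := smooth_AV => ?.
by apply: smooth_vec3; repeat apply: (smoothD oT);
  repeat (first [apply: (smoothN oT)|apply: (smoothM oT)]) => //;
  first [exact: smooth_cst|exact: smooth_coord|smooth_atom].
Qed.

Lemma extd_theta q :
  (extd theta q ix iy = 0) * (extd theta q ix ip = 1) * (extd theta q iy ip = 0).
Proof.
rewrite !mxE /theta !partial_vec3.
eassert (H : has_gradient (fun x : 'rV[R]_3 => - x 0 ip) q _) by find_gradient.
rewrite !(gradient_partial _ H) !(gradient_partial _ (gradient_cst _ q)).
by rewrite !axis_eqs eqxx mulr1n mulr0n; do !split; ring.
Qed.

Lemma extd_psi q :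
  (extd psi q ix iy = partial iy f q) * (extd psi q ix ip = partial ip f q)
  * (extd psi q iy ip = 0).
Proof.
rewrite !mxE /psi !partial_vec3.
eassert (H : has_gradient (fun x => - f x) q _) by find_gradient.
rewrite !(gradient_partial _ H) !(gradient_partial _ (gradient_cst _ q)).
by rewrite !opprK !add0r oppr0.
Qed.

Lemma extd_dx q :
  (extd dx q ix iy = 0) * (extd dx q ix ip = 0) * (extd dx q iy ip = 0).
Proof.
have E i j : partial i (fun x => dx x 0 j) q = 0.
  by rewrite (gradient_partial _ (gradient_cst _ q)).
by do !split; rewrite mxE !E subr0.
Qed.

(** The logarithmic parts of [rho_base] are exact and disappear by symmetry of second derivatives,
    so only derivatives of [f] are left. *)
Lemma extd_rho_base q :
  (extd rho_base q ix iy =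
     6^-1 * (partial ip (partial ip (partial ix f)) q
             + q 0 ip * partial ip (partial ip (partial iy f)) q)
     - 2 / 3 * partial ip (partial iy f) q) *
  (extd rho_base q ix ip = - (2^-1 * partial ip (partial ip f) q)
     + 6^-1 * (q 0 ip * partial ip (partial ip (partial ip f)) q)) *
  (extd rho_base q iy ip = - (6^-1 * partial ip (partial ip (partial ip f)) q)).
Proof.
rewrite !mxE /rho_base !partial_vec3.
eassert (Hx : has_gradient (fun q =>
   2 / 3 * (partial ix A q * (A q)^-1) + - (3^-1 * (partial ix m q * (m q)^-1))
        + (2 / 3 * partial ip f q + - (6^-1 * (q 0 ip * partial ip (partial ip f) q)))) q _)
  by find_gradient.
eassert (Hy : has_gradient (fun q =>
   2 / 3 * (partial iy A q * (A q)^-1) + - (3^-1 * (partial iy m q * (m q)^-1))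
        + 6^-1 * partial ip (partial ip f) q) q _) by find_gradient.
eassert (Hp : has_gradient (fun q =>
   2 / 3 * (partial ip A q * (A q)^-1) + - (3^-1 * (partial ip m q * (m q)^-1))) q _)
  by find_gradient.
rewrite !(gradient_partial _ Hx) !(gradient_partial _ Hy) !(gradient_partial _ Hp) {Hx Hy Hp}.
rewrite !axis_eqs eqxx mulr1n mulr0n.
(* Two exchanges move the derivative in the direction [i] innermost, the order in which the chain
   system is written. *)
have fxpp i : partial i (partial ip (partial ip f)) q = partial ip (partial ip (partial i f)) q.
  rewrite (smooth_partialC q ip i (smooth_partial ip fs)).
  have e : partial i (partial ip f) = partial ip (partial i f).
    by apply/funext => x; exact: (smooth_partialC x ip i fs).
  by rewrite e.
have := smooth_partialC q ix ip ms; have := smooth_partialC q iy ip ms.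
have := smooth_partialC q ix iy ms; have := smooth_partialC q ix iy As.
have := smooth_partialC q ix ip As; have := smooth_partialC q iy ip As.
have := smooth_partialC q iy ip fs; have := fxpp ix; have := fxpp iy.
generalize (m0 q) (A0 q); generalize_partials.
generalize (m q) (A q) (q 0 ip) => mm AA p mm0 AA0 -> -> -> -> -> -> -> -> ->.
by do !split; field; rewrite ?mm0 ?AA0.
Qed.

Lemma model_connection_form : connection_form model_connection.
Proof.
have ob := @open_bundle R.
split.
- have bs j := smooth_base ob (smooth_beta j).
  apply: ord4P.
  + apply: (smooth_eq ob _ (bs ix)) => x _; exact/esym/vertical_extension_base.
  + apply: (smooth_eq ob _ (bs iy)) => x _; exact/esym/vertical_extension_base.
  + apply: (smooth_eq ob _ (bs ip)) => x _; exact/esym/vertical_extension_base.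
  + have cs : smooth_on (@bundle R) (fun u => (u 0 ifib)^-1).
      by apply: (smoothV ob) => [x|]; [rewrite -fib_coord|exact: smooth_coord].
    apply: (smooth_eq ob _ cs) => x _.
    by rewrite vertical_extension_fib mul1r fib_coord.
- move=> u u0; rewrite /pairing sum4E !(model_connection_entries u).1 (model_connection_entries u).2.
  rewrite /fundamental !row_mx_base row_mx_fib.
  have z j : (0 : 'rV[R]_3) 0 j = 0 by rewrite mxE.
  rewrite !z !mulr0 !add0r -/(fib u).
  exact: mulVf.
- move=> r u v r0 u0; rewrite /pairing !sum4E.
  have ab w : base (act r w) = base w by rewrite base_row_mx.
  have af w : fib (act r w) = r * fib w by rewrite fib_row_mx mxE.
  rewrite !(model_connection_entries _).1 !(model_connection_entries _).2 !ab af.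
  have wb w j : act r w 0 (ibase j) = w 0 (ibase j).
    by rewrite -base_coord ab base_coord.
  have wf w : act r w 0 ifib = r * w 0 ifib by rewrite -fib_coord af fib_coord.
  rewrite !wb wf; congr (_ + _).
  by rewrite invfM mulrACA mulVf// mul1r.
Qed.

(* The first entry of d(eta2) is redundant, because d(d(eta3)) = 0. *)
Lemma extd_model2_xy q :
  extd model2 q ix iy = beta q 0 ix * model2 q 0 iy - model2 q 0 ix * beta q 0 iy
    + f q * (extd model2 q iy ip + model2 q 0 iy * beta q 0 ip).
Proof.
rewrite ![extd _ _ _ _]mxE /model2 !partial_vec3 /beta !vec3E.
eassert (H : has_gradient (fun x => - (m x + x 0 ip * partial ip m x) * (A x)^-1) q _)
  by find_gradient.
eassert (H' : has_gradient (fun x => partial ip m x * (A x)^-1) q _)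
  by find_gradient.
rewrite !(gradient_partial _ H) !(gradient_partial _ H') {H H'} !(gradient_partial _ (gradient_cst _ q)).
rewrite !axis_eqs mulr0n.
have : eN q = partial ip mX q * (m q)^-1 + partial ip m q * mX q * (m q)^-1 * (m q)^-1 by [].
have := gradient_partial ip (gradient_mX q); rewrite eqxx mulr1n.
have : mX q = partial ix m q + q 0 ip * partial iy m q + f q * partial ip m q by [].
have := smooth_partialC q ix ip ms; have := smooth_partialC q iy ip ms.
generalize (m0 q) (A0 q); generalize_partials.
generalize (eN q) (mX q) (m q) (A q) (f q) (q 0 ip).
move=> N X mm AA ff p mm0 AA0 <- <- -> -> ->.
by field; rewrite ?mm0 ?AA0.
Qed.

Ltac generalize_at u :=
  generalize (m0 (base u)) (A0 (base u)); generalize_partials;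
  generalize (m (base u)) (A (base u)) (f (base u)) (mX (base u)) (eN (base u))
    (e1 (base u)) (base u 0 ip);
  match goal with H : is_true (fib u != 0) |- _ => generalize (fib u) H end.
Ltac nonzero_field := move=> *; field; by repeat (apply/andP; split).

Lemma model_structure_equations : exists a1 a2 b1 b2 K,
  structure_equations model1 model2 model3 model_connection a1 a2 b1 b2 K.
Proof.
pose a1 (u : 'rV[R]_(3 + 1)) := - (extd model1 (base u) ix iy
  + (beta (base u) 0 ix * model1 (base u) 0 iy - model1 (base u) 0 ix * beta (base u) 0 iy))
  * A (base u) / (fib u ^+ 2 * m (base u) ^+ 2).
pose a2 (u : 'rV[R]_(3 + 1)) := fib u ^+ 2 * (extd model2 (base u) iy ip
  + model2 (base u) 0 iy * beta (base u) 0 ip) / (m (base u) * A (base u)).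
pose K (u : 'rV[R]_(3 + 1)) := curvature (base u).
pose b2 (u : 'rV[R]_(3 + 1)) := fib u * (extd beta (base u) iy ip
  + K u * partial ip m (base u)) / (m (base u) * A (base u)).
pose b1 (u : 'rV[R]_(3 + 1)) := - (extd beta (base u) ix iy
  - b2 u / fib u * (f (base u) * m (base u) * A (base u))
  - K u * (partial ix m (base u) + base u 0 ip * partial iy m (base u)))
  * A (base u) / (fib u * m (base u) ^+ 2).
exists a1, a2, b1, b2, K => u u0.
have bd := smooth_form_differentiable (base u) smooth_beta.
apply/(structure_equations_base u0
  (smooth_form_differentiable (base u) smooth_model1)
  (smooth_form_differentiable (base u) smooth_model2)
  (smooth_form_differentiable (base u) smooth_model3)).
  exact: (model_connection_entries u).2.
have s0 : fib u != 0 := u0.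
have XE : mX (base u) = partial ix m (base u) + base u 0 ip * partial iy m (base u)
  + f (base u) * partial ip m (base u) by [].
split.
- split; rewrite !(model_connection_entries u).1.
  + rewrite /a1; generalize (extd model1 (base u) ix iy) => d.
    rewrite /model1 /model2 /model3 /beta !vec3E; generalize_at u; nonzero_field.
  + rewrite (extd_model1 _).1 partial_e1 /model1 /model2 /model3 /beta !vec3E /e1.
    generalize (a1 u); generalize_at u; nonzero_field.
  + rewrite (extd_model1 _).2 partial_e1 /model1 /model2 /model3 /beta !vec3E /e1.
    generalize (a1 u); generalize_at u; nonzero_field.
- split; rewrite !(model_connection_entries u).1.
  + rewrite extd_model2_xy /a2; generalize (extd model2 (base u) iy ip) => d.
    rewrite /model1 /model2 /model3 /beta !vec3E; generalize_at u; nonzero_field.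
  (* Adding and subtracting p times the (y, p) entry makes the combination computed in [extd_model2]
     appear. *)
  + rewrite /a2 -[LHS](addrK (base u 0 ip * extd model2 (base u) iy ip)) extd_model2.
    generalize (extd model2 (base u) iy ip) => d.
    rewrite /model1 /model2 /model3 /beta !vec3E; generalize_at u; nonzero_field.
  + rewrite /a2; generalize (extd model2 (base u) iy ip) => d.
    rewrite /model1 /model2 /model3 /beta !vec3E; generalize_at u; nonzero_field.
- split; rewrite extd_model3 /model1 /model2 !vec3E /e1 ?XE;
    generalize_at u; nonzero_field.
- split; first by move=> j; exact: extd_vertical_extension_fib.
  have E i j : extd model_connection u (ibase i) (ibase j) = extd beta (base u) i j.
    exact: extd_vertical_extension_base.
  split; rewrite E.
  + rewrite /b1; generalize (b2 u) (K u) (extd beta (base u) ix iy) => b k d.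
    rewrite /model1 /model2 /model3 !vec3E /e1 XE; generalize_at u; nonzero_field.
  + rewrite -[LHS](addrK (base u 0 ip * extd beta (base u) iy ip)) extd_beta /b2 /K.
    generalize (b1 u) (curvature (base u)) (extd beta (base u) iy ip) => b k d.
    rewrite /model1 /model2 /model3 !vec3E /e1 XE; generalize_at u; nonzero_field.
  + rewrite /b2 /K.
    generalize (b1 u) (curvature (base u)) (extd beta (base u) iy ip) => b k d.
    rewrite /model1 /model2 /model3 !vec3E /e1 XE; generalize_at u; nonzero_field.
Qed.

End Model.

(** * Contact forms and adapted coframes are in normal form *)

Section ContactGeometry.
Context {R : realType} (f : 'rV[R]_3 -> R).
Implicit Types (q v : 'rV[R]_3).
Hypothesis fs : smooth_on setT f.

Lemma pairing3E (a v : 'rV[R]_3) :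
  pairing a v = a 0 ix * v 0 ix + a 0 iy * v 0 iy + a 0 ip * v 0 ip.
Proof. exact: sum3E. Qed.

Lemma row3P (v w : 'rV[R]_3) : v 0 ix = w 0 ix -> v 0 iy = w 0 iy -> v 0 ip = w 0 ip -> v = w.
Proof. by move=> hx hy hp; apply/rowP; exact: ord3P. Qed.

Lemma contact_planeP q v : contact_plane ode_L1 (ode_L2 f) q v <-> v 0 iy = q 0 ip * v 0 ix.
Proof.
split=> [[v1 [v2 [[a ->] [b ->] ->]]]|e].
  by rewrite !mxE /=; ring.
exists ((v 0 ip - v 0 ix * f q) *: vec3 0 0 1), (v 0 ix *: vec3 1 (q 0 ip) (f q)).
split; [by eexists|by eexists|].
by apply: row3P; rewrite !mxE /= ?e; ring.
Qed.

Section ContactForm.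
Context (eta3 : 'rV[R]_3 -> 'rV[R]_3).
Hypothesis eta3c : contact_form ode_L1 (ode_L2 f) eta3.
Let m q := eta3 q 0 iy.

Lemma contact_form_smooth : smooth_on setT m.
Proof. by case: eta3c => + _; apply. Qed.

Lemma contact_form_neq0 q : m q != 0.
Proof.
case: eta3c => _ H; apply/eqP => mq0.
have /H/contact_planeP : pairing (eta3 q) (vec3 0 1 0) = 0.
  by rewrite pairing3E !vec3E -/(m q) mq0; ring.
by rewrite !vec3E mulr0 => /eqP; rewrite oner_eq0.
Qed.

Lemma contact_formE : eta3 = model3 m.
Proof.
case: eta3c => _ H; apply/funext => q.
have hp : eta3 q 0 ip = 0.
  have /H : contact_plane ode_L1 (ode_L2 f) q (vec3 0 0 1).
    by apply/contact_planeP; rewrite !vec3E mulr0.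
  by rewrite pairing3E !vec3E !mulr0 !add0r mulr1.
have hx : eta3 q 0 ix + q 0 ip * eta3 q 0 iy = 0.
  have /H : contact_plane ode_L1 (ode_L2 f) q (vec3 1 (q 0 ip) 0).
    by apply/contact_planeP; rewrite !vec3E mulr1.
  by rewrite pairing3E !vec3E mulr0 mulr1 addr0 [_ * q 0 ip]mulrC.
apply: row3P; rewrite /model3 !vec3E//.
by apply/eqP; rewrite -addr_eq0 hx.
Qed.

Section AdaptedCoframe.
Context (eta1 eta2 : 'rV[R]_3 -> 'rV[R]_3).
Hypothesis eta12 : adapted_coframe ode_L1 (ode_L2 f) eta1 eta2 eta3.
Let A q := eta1 q 0 ip.

Lemma adapted_smooth : smooth_on setT A.
Proof. by case: eta12 => + _ _ _ _; apply. Qed.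

(** Vanishing of [eta1] on L2 and of [eta2] on L1 gives the last two equations; the other three come
    from comparing the entries of eta1 /\ eta2 with those of d(m theta). *)
Lemma adapted_equations q :
  [/\ A q * eta2 q 0 iy = partial ip m q,
      A q * (eta2 q 0 ix + q 0 ip * eta2 q 0 iy) = - m q,
      eta1 q 0 iy * m q = A q * mX f m q,
      eta1 q 0 ix = - (q 0 ip * eta1 q 0 iy + f q * A q) & eta2 q 0 ip = 0].
Proof.
have ms := contact_form_smooth.
case: eta12 => _ _ _ d /(_ q) [H1 H2].
have e2p : eta2 q 0 ip = 0.
  have /H2 : ode_L1 q (vec3 0 0 1) by exists 1; rewrite scale1r.
  by rewrite pairing3E !vec3E !mulr0 !add0r mulr1.
have e1x : eta1 q 0 ix = - (q 0 ip * eta1 q 0 iy + f q * A q).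
  have /H1 : ode_L2 f q (vec3 1 (q 0 ip) (f q)) by exists 1; rewrite scale1r.
  rewrite pairing3E !vec3E mulr1 -/(A q) => h.
  by rewrite -[LHS]subr0 -h; ring.
have := extd_model3 ms q; rewrite -contact_formE d !wedgeE e2p e1x -/(A q).
move=> [[xy xp] yp].
have E1 : A q * eta2 q 0 iy = partial ip m q by rewrite -[RHS]opprK -yp; ring.
have E2 : A q * (eta2 q 0 ix + q 0 ip * eta2 q 0 iy) = - m q.
  have -> : m q = m q + q 0 ip * partial ip m q - q 0 ip * partial ip m q by rewrite addrK.
  by rewrite -xp -E1; ring.
split=> //; rewrite -[m q]opprK -E2 /mX.
have -> : partial ix m q = (partial ix m q + q 0 ip * partial iy m q)
  - q 0 ip * partial iy m q by rewrite addrK.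
rewrite -xy -E1 -/(A q); generalize_partials.
by generalize (A q) (eta1 q 0 iy) (eta2 q 0 iy) (eta2 q 0 ix) (q 0 ip) (f q) => *; ring.
Qed.

Lemma adapted_neq0 q : A q != 0.
Proof.
have [_ H _ _ _] := adapted_equations q.
by apply: contraTneq (contact_form_neq0 q) => A0; rewrite negbK -oppr_eq0 -H A0 mul0r.
Qed.

Lemma adapted_model : eta1 = model1 f m A /\ eta2 = model2 m A.
Proof.
split; apply/funext => q; have [H1 H2 H3 H4 H5] := adapted_equations q;
  have m0 := contact_form_neq0 q; have A0 := adapted_neq0 q.
  have e : eta1 q 0 iy = e1 f m A q by rewrite /e1 mulrA -H3 mulfK.
  by apply: row3P; rewrite /model1 !vec3E -?e ?H4.
have e : eta2 q 0 iy = partial ip m q * (A q)^-1 by rewrite -H1 mulrC mulKf.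
apply: row3P; rewrite /model2 !vec3E ?H5 -?e//.
apply: (mulfI A0); rewrite mulrCA mulfV// mulr1 opprD -H2 -H1; ring.
Qed.

End AdaptedCoframe.

End ContactForm.

End ContactGeometry.

(* Up to the factor 1/2 and a triangular change of basis, the components of
   the Euler-Lagrange expression are its values on the frame dual to
   (theta, psi, dx, rho). *)
Lemma frame_algebra (R : realType) (Lx Ly Lp Ls Fx Fy Fp Fs th ps dr rx ry rp s k
    D P r p f fp fy fpp fppp fxpp fypp fyp : R) :
  s != 0 ->
  Lx = 2^-1 * (th * rx + dr * - p
    + D * (- ((D + p) * (6^-1 * (fxpp + p * fypp) - 2 / 3 * fyp))
           - (P + f) * (- (2^-1 * fpp) + 6^-1 * (p * fppp)))
    + r * (- ((D + p) * 0) - (P + f) * 1))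
    - 2^-1 * (ps * 1 + 0 * - f + P * (- ((D + p) * 0) - (P + f) * 0)
              + 1 * (- ((D + p) * fy) - (P + f) * fp)) ->
  Ly = 2^-1 * (th * ry + dr * 1
    + D * (1 * (6^-1 * (fxpp + p * fypp) - 2 / 3 * fyp) - (P + f) * - (6^-1 * fppp))
    + r * (1 * 0 - (P + f) * 0))
    - 2^-1 * (ps * 0 + 0 * 0 + P * (1 * 0 - (P + f) * 0) + 1 * (1 * fy - (P + f) * 0)) ->
  Lp = 2^-1 * (th * rp + dr * 0
    + D * (1 * (- (2^-1 * fpp) + 6^-1 * (p * fppp)) + (D + p) * - (6^-1 * fppp))
    + r * (1 * 1 + (D + p) * 0))
    - 2^-1 * (ps * 0 + 0 * 1 + P * (1 * 0 + (D + p) * 0) + 1 * (1 * fp + (D + p) * 0)) ->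
  Ls = 2^-1 * (th * (- (2 / 3) / s) + dr * 0 + D * 0 + r * 0)
    - 2^-1 * (ps * 0 + 0 * 0 + P * 0 + 1 * 0) ->
  Fx = 2^-1 * (D * rx + r * - p - P * 1 - 1 * - f) ->
  Fy = 2^-1 * (D * ry + r * 1 - P * 0 - 1 * 0) ->
  Fp = 2^-1 * (D * rp + r * 0 - P * 0 - 1 * 1) ->
  Fs = 2^-1 * (D * (- (2 / 3) / s) + r * 0 - P * 0 - 1 * 0) ->
  [/\ Lx = k * Fx, Ly = k * Fy, Lp = k * Fp & Ls = k * Fs] <->
  [/\ th = k * D, r - fp - 2^-1 * fpp * D - 6^-1 * fppp * D ^+ 2 = - k,
      ps = fp * P + fy * D + 2^-1 * fpp * P * D
           - (6^-1 * (fxpp + p * fypp + f * fppp) - 2 / 3 * fyp) * D ^+ 2 - r * P + k * P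
    & dr = fy - (6^-1 * (fxpp + p * fypp + f * fppp) - 2 / 3 * fyp) * D
           - 6^-1 * fppp * P * D + k * r].
Proof.
move=> s0 Hx Hy Hp Hs Gx Gy Gp Gs.
set E1 := _ = k * D; set E2 := _ = - k; set E3 := ps = _; set E4 := dr = _.
(* These are the defects of the four equations on the right. In the order fibre, p, y, x each
   coordinate defect [L - k * F] brings in one new defect with a nonzero factor, so they can be
   solved for successively. *)
pose x1 := th - k * D.
pose x2 := r - fp - 2^-1 * fpp * D - 6^-1 * fppp * D ^+ 2 + k.
pose Q := 6^-1 * (fxpp + p * fypp + f * fppp) - 2 / 3 * fyp.
pose x3 := ps - (fp * P + fy * D + 2^-1 * fpp * P * D - Q * D ^+ 2 - r * P + k * P).
pose x4 := dr - (fy - Q * D - 6^-1 * fppp * P * D + k * r).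
have Is : Ls - k * Fs = - (3^-1 / s) * x1 by rewrite Hs Gs /x1; field.
have Ip : Lp - k * Fp = 2^-1 * (rp * x1 + x2) by rewrite Hp Gp /x1 /x2; field.
have Iy : Ly - k * Fy = 2^-1 * (ry * x1 + x4) by rewrite Hy Gy /x1 /x4 /Q; field.
have Ix : Lx - k * Fx = 2^-1 * (rx * x1 - p * x4 - x3 - f * x2).
  by rewrite Hx Gx /x1 /x4 /x3 /x2 /Q; field.
split=> [[ex ey ep es]|[]].
  have z1 : x1 = 0.
    have : - (3^-1 / s) * x1 = 0 by rewrite -Is es subrr.
    by move/eqP; rewrite mulf_eq0 oppr_eq0 mulf_eq0 !invr_eq0 pnatr_eq0 (negPf s0) => /eqP.
  have half (x : R) : 2^-1 * x = 0 -> x = 0.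
    by move/eqP; rewrite mulf_eq0 invr_eq0 pnatr_eq0 => /eqP.
  have z2 : x2 = 0.
    by apply: half; rewrite -[X in _ * X]add0r -[X in _ * (X + _)](mulr0 rp) -z1 -Ip ep subrr.
  have z4 : x4 = 0.
    by apply: half; rewrite -[X in _ * X]add0r -[X in _ * (X + _)](mulr0 ry) -z1 -Iy ey subrr.
  have z3 : x3 = 0.
    have : 2^-1 * (rx * x1 - p * x4 - x3 - f * x2) = 0 by rewrite -Ix ex subrr.
    by rewrite z1 z2 z4 !mulr0 !sub0r subr0 oppr0 sub0r => /half/eqP; rewrite oppr_eq0 => /eqP.
  split; apply/eqP; rewrite -subr_eq0; apply/eqP; [exact: z1| |exact: z3|exact: z4].
  by rewrite opprK; exact: z2.
rewrite /E1 /E2 /E3 /E4 => e1 e2 e3 e4.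
have z1 : x1 = 0 by rewrite /x1 e1 subrr.
have z2 : x2 = 0 by rewrite /x2 e2 addNr.
have z3 : x3 = 0 by rewrite /x3 /Q -e3 subrr.
have z4 : x4 = 0 by rewrite /x4 /Q -e4 subrr.
split; apply/eqP; rewrite -subr_eq0 ?Ix ?Iy ?Ip ?Is z1 ?z2 ?z3 ?z4 ?mulr0 ?subr0 ?addr0 ?mulr0 //.
Qed.

(** * Geodesic equations in the coframe *)

(** The second frame equation gives [k] and nullity gives [r = P / D]. The term -2 P^2 / D collects
    two equal contributions: - r P, and k P through the summand - r of [k]. *)
Lemma chain_equations_necessary (R : realType) (k r th ps y1 p1 y2 p2
    p f fx fy fp fpp fppp fxpp fypp fyp : R) :
  let D := y1 - p in let P := p1 - f in
  D != 0 -> P = D * r -> th = y2 - p1 -> ps = p2 - (fx + fy * y1 + fp * p1) ->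
  th = k * D -> r - fp - 2^-1 * fpp * D - 6^-1 * fppp * D ^+ 2 = - k ->
  ps = fp * P + fy * D + 2^-1 * fpp * P * D
       - (6^-1 * (fxpp + p * fypp + f * fppp) - 2 / 3 * fyp) * D ^+ 2 - r * P + k * P ->
  y2 = f + fp * D + 1 / 2 * fpp * D ^+ 2 + 1 / 6 * fppp * D ^+ 3 /\
  p2 = - (2 * P ^+ 2 / D) + fp * (3 * p1 - 2 * f) + fx + p * fy + (fpp * P + 2 * fy) * D
       + 1 / 6 * (fppp * (p1 - 2 * f) - fxpp + 4 * fyp - p * fypp) * D ^+ 2.
Proof.
move=> D P D0 PE thE psE e1 e2 e3.
have kE : k = fp + 2^-1 * fpp * D + 6^-1 * fppp * D ^+ 2 - r by rewrite -[k]opprK -e2; ring.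
have rE : r = P / D by rewrite PE mulrC mulKf.
have y1E : y1 = D + p by rewrite /D subrK.
have p1E : p1 = P + f by rewrite /P subrK.
split.
  have -> : y2 = th + p1 by rewrite thE subrK.
  by rewrite e1 kE p1E mulrBl [r * D]mulrC -PE; field.
have -> : p2 = ps + (fx + fy * y1 + fp * p1) by rewrite psE subrK.
by rewrite e3 kE rE y1E p1E; field.
Qed.

(** Here [k] is defined by the first frame equation, and [dr] is the derivative of the quotient P /
    D, so the last frame equation is a consequence of the first three. *)
Lemma chain_equations_sufficient (R : realType) (k r th ps dr y1 p1 y2 p2
    p f fx fy fp fpp fppp fxpp fypp fyp : R) :
  let D := y1 - p in let P := p1 - f in
  D != 0 -> r = P / D -> th = y2 - p1 -> ps = p2 - (fx + fy * y1 + fp * p1) ->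
  k = th / D -> dr = (ps * D - P * th) / D ^+ 2 ->
  y2 = f + fp * D + 1 / 2 * fpp * D ^+ 2 + 1 / 6 * fppp * D ^+ 3 ->
  p2 = - (2 * P ^+ 2 / D) + fp * (3 * p1 - 2 * f) + fx + p * fy + (fpp * P + 2 * fy) * D
       + 1 / 6 * (fppp * (p1 - 2 * f) - fxpp + 4 * fyp - p * fypp) * D ^+ 2 ->
  [/\ th = k * D, r - fp - 2^-1 * fpp * D - 6^-1 * fppp * D ^+ 2 = - k,
      ps = fp * P + fy * D + 2^-1 * fpp * P * D
           - (6^-1 * (fxpp + p * fypp + f * fppp) - 2 / 3 * fyp) * D ^+ 2 - r * P + k * P
    & dr = fy - (6^-1 * (fxpp + p * fypp + f * fppp) - 2 / 3 * fyp) * D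
           - 6^-1 * fppp * P * D + k * r].
Proof.
move=> D P D0 -> thE psE kE -> y2E p2E.
have y1E : y1 = D + p by rewrite /D subrK.
have p1E : p1 = P + f by rewrite /P subrK.
have {}thE : th = - P + fp * D + 2^-1 * fpp * D ^+ 2 + 6^-1 * fppp * D ^+ 3.
  by rewrite thE y2E p1E; field.
rewrite {}kE {}psE {}p2E {}thE y1E p1E; clear - D0.
by split; field.
Qed.

(** * The Euler-Lagrange expression of [contact_metric] in its coframe *)

Section FrameEquations.
Context {R : realType} (f m A : 'rV[R]_3 -> R).
Hypothesis fs : smooth_on setT f.
Hypothesis ms : smooth_on setT m.
Hypothesis As : smooth_on setT A.
Hypothesis m0 : forall q, m q != 0.
Hypothesis A0 : forall q, A q != 0.
Implicit Types (q : 'rV[R]_3) (u v w : 'rV[R]_(3 + 1)).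

Definition lift_theta : 'rV[R]_(3 + 1) -> 'rV[R]_(3 + 1) := vertical_extension 0 theta.
Definition lift_psi : 'rV[R]_(3 + 1) -> 'rV[R]_(3 + 1) := vertical_extension 0 (psi f).
Definition lift_dx : 'rV[R]_(3 + 1) -> 'rV[R]_(3 + 1) := vertical_extension 0 dx.
Definition rho : 'rV[R]_(3 + 1) -> 'rV[R]_(3 + 1) :=
  vertical_extension (- (2 / 3)) (rho_base f m A).

Lemma lift_theta_differentiable u : bundle u -> differentiable_form lift_theta u.
Proof.
move=> u0; apply: differentiable_vertical_extension => //.
exact/smooth_form_differentiable/smooth_theta.
Qed.

Lemma lift_psi_differentiable u : bundle u -> differentiable_form lift_psi u.
Proof.
move=> u0; apply: differentiable_vertical_extension => //.
exact/smooth_form_differentiable/smooth_psi.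
Qed.

Lemma lift_dx_differentiable u : bundle u -> differentiable_form lift_dx u.
Proof.
move=> u0; apply: differentiable_vertical_extension => //.
exact/smooth_form_differentiable/smooth_dx.
Qed.

Lemma rho_differentiable u : bundle u -> differentiable_form rho u.
Proof.
move=> u0; apply: differentiable_vertical_extension => //.
exact/smooth_form_differentiable/smooth_rho_base.
Qed.

Lemma differentiable_symprod n (a b : 'rV[R]_n.+1 -> 'rV[R]_n.+1) x :
  differentiable_form a x -> differentiable_form b x ->
  differentiable_metric (fun x => symprod (a x) (b x)) x.
Proof.
move=> ad bd i j.
have ga r := differentiable_gradient (ad r); have gb r := differentiable_gradient (bd r).
have [H _] := gradientM (gradient_cst 2^-1 x)
  (gradientD (gradientM (ga i) (gb j)) (gradientM (gb i) (ga j))).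
apply: differentiable_near H; near=> z.
by rewrite symprodE.
Unshelve. all: by end_near. Qed.

Lemma differentiable_contact_metric u : bundle u ->
  differentiable_metric (contact_metric f m A) u.
Proof.
move=> u0 i j. 
have H := differentiable_symprod (lift_theta_differentiable u0) (rho_differentiable u0) i j.
have H' := differentiable_symprod (lift_psi_differentiable u0) (lift_dx_differentiable u0) i j.
apply: differentiable_near (differentiableB H H'); near=> z.
by rewrite /contact_metric entryD entryN.
Unshelve. all: by end_near. Qed.

Lemma flat_contact_metric u v l : flat (contact_metric f m A) u v l =
  2^-1 * (pairing (lift_theta u) v * rho u 0 l + pairing (rho u) v * lift_theta u 0 l
          - pairing (lift_psi u) v * lift_dx u 0 l - pairing (lift_dx u) v * lift_psi u 0 l).
Proof.
rewrite /flat /pairing !mulr_suml -big_split -!sumrB mulr_sumr; apply: eq_bigr => k _ /=.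
rewrite /contact_metric entryD entryN !symprodE -/lift_theta -/lift_psi -/lift_dx -/rho.
by ring.
Qed.

Lemma quadratic_contact_metric u v : quadratic (contact_metric f m A) u v =
  pairing (lift_theta u) v * pairing (rho u) v - pairing (lift_psi u) v * pairing (lift_dx u) v.
Proof.
have -> : quadratic (contact_metric f m A) u v =
    \sum_j flat (contact_metric f m A) u v j * v 0 j.
  rewrite /quadratic exchange_big/=; apply: eq_bigr => j _.
  by rewrite /flat mulr_suml.
under eq_bigr do rewrite flat_contact_metric.
have -> a b c d : \sum_j 2^-1 * (a * rho u 0 j + b * lift_theta u 0 j
   - c * lift_dx u 0 j - d * lift_psi u 0 j) * v 0 j = 2^-1 * (a * pairing (rho u) v
   + b * pairing (lift_theta u) v - c * pairing (lift_dx u) v - d * pairing (lift_psi u) v).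
  rewrite /pairing !mulr_sumr -big_split -!sumrB mulr_sumr; apply: eq_bigr => j _ /=.
  by ring.
by field.
Qed.

Lemma lowered_contact_metric u v w l : bundle u ->
  lowered (contact_metric f m A) u v w l =
  2^-1 * (form_derivative lift_theta u v w * rho u 0 l
     + form_derivative rho u v w * lift_theta u 0 l
     + pairing (lift_theta u) v * interior_extd rho u v l
     + pairing (rho u) v * interior_extd lift_theta u v l)
  - 2^-1 * (form_derivative lift_psi u v w * lift_dx u 0 l
     + form_derivative lift_dx u v w * lift_psi u 0 l
     + pairing (lift_psi u) v * interior_extd lift_dx u v l
     + pairing (lift_dx u) v * interior_extd lift_psi u v l).
Proof.
move=> u0; have [t r] := (lift_theta_differentiable u0, rho_differentiable u0).
have [p d] := (lift_psi_differentiable u0, lift_dx_differentiable u0).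
rewrite -(lowered_symprod _ _ _ t r) -(lowered_symprod _ _ _ p d).
exact: loweredB (differentiable_symprod t r) (differentiable_symprod p d).
Qed.

Lemma extd_swap n (a : 'rV[R]_n.+1 -> 'rV[R]_n.+1) (x : 'rV[R]_n.+1) i j :
  extd a x i j = - extd a x j i.
Proof. by rewrite !mxE opprB. Qed.

Lemma extd_diag n (a : 'rV[R]_n.+1 -> 'rV[R]_n.+1) (x : 'rV[R]_n.+1) i : extd a x i i = 0.
Proof. by rewrite mxE subrr. Qed.

Lemma interior_vertical_extension k (a : 'rV[R]_3 -> 'rV[R]_3) u v : bundle u ->
  differentiable_form a (base u) ->
  (interior_extd (vertical_extension k a) u v (ibase ix) =
    - (v 0 (ibase iy) * extd a (base u) ix iy) - v 0 (ibase ip) * extd a (base u) ix ip) *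
  (interior_extd (vertical_extension k a) u v (ibase iy) =
    v 0 (ibase ix) * extd a (base u) ix iy - v 0 (ibase ip) * extd a (base u) iy ip) *
  (interior_extd (vertical_extension k a) u v (ibase ip) =
    v 0 (ibase ix) * extd a (base u) ix ip + v 0 (ibase iy) * extd a (base u) iy ip) *
  (interior_extd (vertical_extension k a) u v ifib = 0).
Proof.
move=> u0 ad; rewrite /interior_extd !sum4E.
have e i j : extd (vertical_extension k a) u (ibase i) (ibase j) = extd a (base u) i j.
  exact: extd_vertical_extension_base.
have e0 j : extd (vertical_extension k a) u ifib (ibase j) = 0.
  exact: extd_vertical_extension_fib.
have e1 j : extd (vertical_extension k a) u (ibase j) ifib = 0.
  by rewrite extd_swap e0 oppr0.
have e2 : extd (vertical_extension k a) u ifib ifib = 0 by exact: extd_diag.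
rewrite !(e, e0, e1, e2) !extd_diag (extd_swap a (base u) iy ix)
  (extd_swap a (base u) ip ix) (extd_swap a (base u) ip iy).
by do !split; ring.
Qed.

(** The assumptions dx(v) = 1 and (dx(v))' = 0 express that x is the parameter. It need not be
    affine, and [k] measures the failure; the equivalence is [frame_algebra] with the exterior
    derivatives of the coframe inserted. *)
Lemma frame_equations u v w (k : R) : bundle u -> v 0 (ibase ix) = 1 ->
  form_derivative lift_dx u v w = 0 ->
  let q := base u in
  let D := pairing (lift_theta u) v in
  let P := pairing (lift_psi u) v in
  let r := pairing (rho u) v in
  let fpp := partial ip (partial ip f) q in
  let fppp := partial ip (partial ip (partial ip f)) q in
  let Q := 6^-1 * (partial ip (partial ip (partial ix f)) q
             + q 0 ip * partial ip (partial ip (partial iy f)) q + f q * fppp)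
     - 2 / 3 * partial ip (partial iy f) q in
  (forall l, lowered (contact_metric f m A) u v w l = k * flat (contact_metric f m A) u v l) <->
  [/\ form_derivative lift_theta u v w = k * D,
      r - partial ip f q - 2^-1 * fpp * D - 6^-1 * fppp * D ^+ 2 = - k,
      form_derivative lift_psi u v w = partial ip f q * P + partial iy f q * D
        + 2^-1 * fpp * P * D - Q * D ^+ 2 - r * P + k * P &
      form_derivative rho u v w = partial iy f q - Q * D - 6^-1 * fppp * P * D + k * r].
Proof.
move=> u0 vx dx0 q D P r fpp fppp Q.
have s0 : fib u != 0 := u0.
have DE : D = v 0 (ibase iy) - q 0 ip.
  rewrite /D /pairing sum4E /lift_theta !vertical_extension_base vertical_extension_fib.
  by rewrite /theta !vec3E vx -/q; ring.
have PE : P = v 0 (ibase ip) - f q.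
  rewrite /P /pairing sum4E /lift_psi !vertical_extension_base vertical_extension_fib.
  by rewrite /psi !vec3E vx -/q; ring.
have dxE : pairing (lift_dx u) v = 1.
  rewrite /pairing sum4E /lift_dx !vertical_extension_base vertical_extension_fib.
  by rewrite /dx !vec3E vx; ring.
have td : differentiable_form theta q by exact/smooth_form_differentiable/smooth_theta.
have pd : differentiable_form (psi f) q by exact/smooth_form_differentiable/smooth_psi.
have xd : differentiable_form dx q by exact/smooth_form_differentiable/smooth_dx.
have rd : differentiable_form (rho_base f m A) q.
  exact/smooth_form_differentiable/smooth_rho_base.
have it := interior_vertical_extension 0 v u0 td; rewrite -/lift_theta -/q !extd_theta vx in it.
have ip' := interior_vertical_extension 0 v u0 pd.
rewrite -/lift_psi -/q !(extd_psi fs) vx in ip'.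
have idx := interior_vertical_extension 0 v u0 xd; rewrite -/lift_dx -/q !extd_dx vx in idx.
have ir := interior_vertical_extension (- (2 / 3)) v u0 rd.
rewrite -/q !(extd_rho_base fs ms As m0 A0) vx in ir.
have H l := lowered_contact_metric v w l u0; have F l := flat_contact_metric u v l.
rewrite dx0 dxE -/D -/P -/r in H; rewrite dxE -/D -/P -/r in F.
have tx : lift_theta u 0 (ibase ix) = - q 0 ip by rewrite vertical_extension_base vec3E.
have ty : lift_theta u 0 (ibase iy) = 1 by rewrite vertical_extension_base vec3E.
have tp : lift_theta u 0 (ibase ip) = 0 by rewrite vertical_extension_base vec3E.
have ts : lift_theta u 0 ifib = 0 by rewrite vertical_extension_fib mul0r.
have px : lift_psi u 0 (ibase ix) = - f q by rewrite vertical_extension_base vec3E.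
have py : lift_psi u 0 (ibase iy) = 0 by rewrite vertical_extension_base vec3E.
have pp : lift_psi u 0 (ibase ip) = 1 by rewrite vertical_extension_base vec3E.
have ps : lift_psi u 0 ifib = 0 by rewrite vertical_extension_fib mul0r.
have dx_x : lift_dx u 0 (ibase ix) = 1 by rewrite vertical_extension_base vec3E.
have dx_y : lift_dx u 0 (ibase iy) = 0 by rewrite vertical_extension_base vec3E.
have dx_p : lift_dx u 0 (ibase ip) = 0 by rewrite vertical_extension_base vec3E.
have dx_s : lift_dx u 0 ifib = 0 by rewrite vertical_extension_fib mul0r.
have rs : rho u 0 ifib = - (2 / 3) / fib u by rewrite vertical_extension_fib.
have Hx := H (ibase ix); have Hy := H (ibase iy); have Hp := H (ibase ip); have Hs := H ifib.
have Fx := F (ibase ix); have Fy := F (ibase iy); have Fp := F (ibase ip); have Fs := F ifib.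
move: Hx Hy Hp Hs Fx Fy Fp Fs.
have [[[irx iry] irp] irs] := ir; have [[[itx ity] itp] its] := it.
have [[[ipx ipy] ipp] ips] := ip'; have [[[idxx idxy] idxp] idxs] := idx.
rewrite irx iry irp irs itx ity itp its ipx ipy ipp ips idxx idxy idxp idxs.
rewrite tx ty tp ts px py pp ps dx_x dx_y dx_p dx_s rs.
have vy : v 0 (ibase iy) = D + q 0 ip by rewrite DE subrK.
have vp : v 0 (ibase ip) = P + f q by rewrite PE subrK.
rewrite vy vp; clear - s0.
rewrite /Q /fppp /fpp => Hx Hy Hp Hs Fx Fy Fp Fs.
have FA := frame_algebra k s0 Hx Hy Hp Hs Fx Fy Fp Fs.
split=> [E|/FA[Ex Ey Ep Es]]; last exact: ord4P.
by apply/FA; split; exact: E.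
Qed.

Lemma tr_contact_metric u : (contact_metric f m A u)^T = contact_metric f m A u.
Proof.
apply/matrixP => i j; rewrite mxE /contact_metric !(entryD, entryN) !symprodE.
by congr (_ * _ - _ * _); rewrite addrC [X in X + _]mulrC [X in _ + X]mulrC.
Qed.

(** For a vector of the kernel, the components along s, p, y, x of its dual successively force
    theta(v), dx(v), rho(v) and psi(v) to vanish. Since the four forms are a coframe, the vector is
    zero. *)
Lemma contact_metric_unit u : bundle u -> contact_metric f m A u \in unitmx.
Proof.
move=> u0; rewrite -row_free_unit -kermx_eq0; apply/eqP/row_matrixP => i.
rewrite row0; set v := row i _.
have vG : v *m contact_metric f m A u = 0 by apply/sub_kermxP; exact: row_sub.
have F l : flat (contact_metric f m A) u v l = 0.
  have := congr1 (fun M : 'rV[R]_(3 + 1) => M 0 l) vG; rewrite !mxE => <-.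
  by rewrite /flat; apply: eq_bigr => k _; rewrite mulrC.
have half (x : R) : 2^-1 * x = 0 -> x = 0.
  by move/eqP; rewrite mulf_eq0 invr_eq0 pnatr_eq0 => /eqP.
have G l : pairing (lift_theta u) v * rho u 0 l + pairing (rho u) v * lift_theta u 0 l
    - pairing (lift_psi u) v * lift_dx u 0 l - pairing (lift_dx u) v * lift_psi u 0 l = 0.
  by apply: half; rewrite -flat_contact_metric F.
have [tE pE xE rE] : [/\ pairing (lift_theta u) v = v 0 (ibase iy) - base u 0 ip * v 0 (ibase ix),
    pairing (lift_psi u) v = v 0 (ibase ip) - f (base u) * v 0 (ibase ix),
    pairing (lift_dx u) v = v 0 (ibase ix) &
    pairing (rho u) v = rho_base f m A (base u) 0 ix * v 0 (ibase ix)
      + rho_base f m A (base u) 0 iy * v 0 (ibase iy)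
      + rho_base f m A (base u) 0 ip * v 0 (ibase ip) + - (2 / 3) / fib u * v 0 ifib].
  rewrite /pairing !sum4E /lift_theta /lift_psi /lift_dx /rho.
  rewrite !vertical_extension_base !vertical_extension_fib /theta /psi /dx !vec3E.
  by split=> //; ring.
have s0 : fib u != 0 := u0.
have c0 : - (2 / 3) / fib u != 0 :> R.
  by rewrite mulf_neq0 ?invr_eq0// oppr_eq0 mulf_neq0 ?invr_eq0 ?pnatr_eq0.
have tz : pairing (lift_theta u) v = 0.
  have := G ifib; rewrite /rho /lift_theta /lift_psi /lift_dx !vertical_extension_fib.
  rewrite !mul0r !mulr0 !subr0 addr0 => /eqP; rewrite mulf_eq0 (negPf c0) orbF => /eqP; exact.
have xz : pairing (lift_dx u) v = 0.
  have := G (ibase ip); rewrite tz mul0r add0r /lift_theta /lift_psi /lift_dx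
    !vertical_extension_base /theta /psi /dx !vec3E !mulr0 !mulr1 sub0r.
  by rewrite oppr0 add0r => /eqP; rewrite oppr_eq0 => /eqP; apply.
have rz : pairing (rho u) v = 0.
  have := G (ibase iy); rewrite tz xz !mul0r subr0 /lift_theta /lift_psi /lift_dx
    !vertical_extension_base /theta /psi /dx !vec3E mulr0 mulr1 add0r subr0; exact.
have pz : pairing (lift_psi u) v = 0.
  have := G (ibase ix); rewrite tz xz rz !mul0r subr0 /lift_dx
    !vertical_extension_base /dx !vec3E mulr1 add0r sub0r.
  by move=> /eqP; rewrite oppr_eq0 => /eqP; apply.
rewrite xE in xz; rewrite tz xz mulr0 subr0 in tE; rewrite pz xz mulr0 subr0 in pE.
rewrite -tE -pE xz !mulr0 !add0r rz in rE.
have sz : v 0 ifib = 0.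
  by move/esym/eqP: rE; rewrite mulf_eq0 (negPf c0) => /eqP.
by apply/rowP; apply: ord4P; rewrite [RHS]mxE.
Qed.

End FrameEquations.

(** * Primitives and inverse functions on open intervals *)

Section OpenIntervals.
Context {R : realType} (I : set R).
Hypothesis Ii : open_interval I.
Notation mu := (@lebesgue_measure R).

Lemma open_interval_near x : I x -> \forall y \near x, I y.
Proof. by case: Ii => Io _ _ Ix; exact: open_nbhs_nbhs. Qed.

Lemma open_interval_mem a b x : I a -> I b -> a <= x <= b -> I x.
Proof. by case: Ii => _ Iit _ Ia Ib; exact: Iit. Qed.

Lemma open_interval_itv x : I x -> exists a b, [/\ I a, I b, a < x & x < b].
Proof.
move=> Ix; have /nbhs_ballP[e /= e0 xe] := open_interval_near Ix.
have e2 : 0 < e / 2 by rewrite divr_gt0.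
exists (x - e / 2), (x + e / 2); rewrite ltrBlDr !ltrDl e2; split=> //; apply: xe.
  by rewrite /ball/= opprB addrCA subrr addr0 gtr0_norm// gtr_pMr// invf_lt1// ltr1n.
by rewrite /ball/= opprD addNKr normrN gtr0_norm// gtr_pMr// invf_lt1// ltr1n.
Qed.

(** An open interval has no endpoint to integrate from, so the primitive is the oriented integral
    from an interior point [x0]. Near a given point it differs by a constant from an integral
    starting at some [a] in [I] to the left of both points, to which the fundamental theorem
    applies. *)
Lemma antiderivative (h : R -> R) : (forall x, I x -> {for x, continuous h}) ->
  exists F : R -> R, forall x, I x -> is_derive x 1 F (h x).
Proof.
move=> hc; have [x0 Ix0] : I !=set0 by case: Ii.
pose F x := if x0 <= x then (\int[mu]_(t in `[x0, x]) h t)%R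
            else (- \int[mu]_(t in `[x, x0]) h t)%R.
exists F => x1 Ix1.
have [a [b [Ia Ib [ax0 ax1] x1b x0b]]] : exists a b,
    [/\ I a, I b, a < x0 /\ a < x1, x1 < b & x0 < b].
  have [a0 [b0 [Ia0 Ib0 a0x b0x]]] := open_interval_itv Ix0.
  have [a1 [b1 [Ia1 Ib1 a1x b1x]]] := open_interval_itv Ix1.
  exists (Num.min a0 a1), (Num.max b0 b1); split.
  - by rewrite minEle; case: ifP.
  - by rewrite maxEle; case: ifP.
  - by rewrite !gt_min a0x a1x orbT.
  - by rewrite lt_max b1x orbT.
  - by rewrite lt_max b0x.
have hI c d : I c -> I d -> mu.-integrable `[c, d] (EFin \o h).
  move=> Ic Id; apply: continuous_compact_integrable; first exact: segment_compact.
  apply: continuous_in_subspaceT => x; rewrite inE/= in_itv/= => xcd.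
  by apply: hc; exact: open_interval_mem xcd.
pose G x := (\int[mu]_(t in `[a, x]) h t - \int[mu]_(t in `[a, x0]) h t)%R.
have split_int c d : a < c -> c <= d -> I c -> I d ->
    (\int[mu]_(t in `[a, d]) h t - \int[mu]_(t in `[a, c]) h t
     = \int[mu]_(t in `[c, d]) h t)%R.
  move=> ac cd Ic Id; rewrite Rintegral_itvB ?bnd_simp//; [|exact: hI|exact: ltW].
  rewrite Rintegral_itv_obnd_cbnd//.
  apply: integrableS (hI _ _ Ic Id) => //.
  exact: subset_itv_oc_cc.
have GF : \forall x \near x1, G x = F x.
  near=> x.
  have ax : a < x by near: x; exact: lt_nbhsr.
  have Ix : I x by near: x; exact: open_interval_near.
  rewrite /G /F; case: ifPn => [x0x|]; first exact: split_int.
  by rewrite -ltNge => xx0; rewrite -(split_int _ _ ax (ltW xx0) Ix Ix0) opprB.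
apply: near_eq_is_derive GF _.
have [dG G'] := @continuous_FTC1_closed R h a x1 b x1b (hI _ _ Ia Ib) ax1 (hc _ Ix1).
have -> : h x1 = h x1 - 0 by rewrite subr0.
apply: is_deriveB.
by split=> //; rewrite -G' derive1E.
Unshelve. all: by end_near. Qed.

Section Inverse.
Context (phi h : R -> R).
Hypothesis phih : forall x, I x -> is_derive x 1 phi (h x).
Hypothesis h0 : forall x, I x -> h x != 0.

Lemma derive_neq0_continuous x : I x -> {for x, continuous phi}.
Proof.
by move=> Ix; apply/differentiable_continuous/derivable1_diffP; case: (phih Ix).
Qed.

(** By Rolle's theorem, two points with equal values would enclose a zero of [h]. *)
Lemma derive_neq0_inj x y : I x -> I y -> phi x = phi y -> x = y.
Proof.
wlog xy : x y / x < y => [W Ix Iy e|Ix Iy e].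
  by case: (ltgtP x y) => // ?; [|apply/esym]; apply: W.
have Iz z : x <= z <= y -> I z by exact: open_interval_mem.
have [] := @Rolle R phi x y xy _ _ e.
- by move=> z; rewrite in_itv/= => /andP[xz zy]; case: (phih (Iz z _)); rewrite ?ltW.
- apply: continuous_in_subspaceT => z; rewrite inE/= in_itv/= => /Iz.
  exact: derive_neq0_continuous.
move=> z; rewrite in_itv/= => /andP[xz zy] [_ dz].
have Izz : I z by apply: Iz; rewrite !ltW.
by have := h0 Izz; case: (phih Izz) => _ <-; rewrite dz eqxx.
Qed.

Definition inverse_on (t : R) : R := xget 0 [set x | I x /\ phi x = t].

Lemma inverse_onK x : I x -> inverse_on (phi x) = x.
Proof.
move=> Ix; rewrite /inverse_on; case: xgetP => [y _ [Iy e]|/(_ x)[]//].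
exact: derive_neq0_inj.
Qed.

Lemma inverse_on_near x : I x ->
  {near x, cancel phi inverse_on} /\ {near x, continuous phi}.
Proof.
move=> Ix; split; near=> y.
  by apply: inverse_onK; near: y; exact: open_interval_near.
by apply: derive_neq0_continuous; near: y; exact: open_interval_near.
Unshelve. all: by end_near. Qed.

Lemma is_derive_inverse_on x : I x -> is_derive (phi x) 1 inverse_on (h x)^-1.
Proof.
move=> Ix; have [K C] := inverse_on_near Ix.
exact: is_derive_inverse K C (phih Ix) (h0 Ix).
Qed.

(** Openness comes from the local inverse: it is continuous at [phi x], so nearby values are again
    attained inside [I]. Being an interval is connectedness of a continuous image. *)
Lemma open_interval_image : open_interval (phi @` I).
Proof.
have [Io Iit [x0 Ix0]] := Ii; split.
- rewrite openE => _ [x Ix <-]; have [K C] := inverse_on_near Ix.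
  have S := near_continuous_can_sym C K.
  have ic : {for phi x, continuous inverse_on}.
    by apply/differentiable_continuous/derivable1_diffP; case: (is_derive_inverse_on Ix).
  have In : \forall t \near phi x, I (inverse_on t).
    by apply: ic; rewrite inverse_onK//; exact: open_interval_near.
  rewrite /interior; near=> t; exists (inverse_on t).
    by near: t.
  by near: t.
- apply/connected_intervalP/connected_continuous_connected.
    exact/connected_intervalP.
  apply: continuous_in_subspaceT => x; rewrite inE; exact: derive_neq0_continuous.
- by exists (phi x0), x0.
Unshelve. all: by end_near. Qed.

End Inverse.

End OpenIntervals.

(** * Chains *)

Section Curves.
Context {R : realType}.

Lemma is_derive_reparam n (c : R -> 'rV[R]_n.+1) (phi : R -> R) (x a : R) v :
  is_derive (phi x) 1 c v -> is_derive x 1 phi a -> is_derive x 1 (c \o phi) (a *: v).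
Proof.
move=> cv pa; apply: is_derive_row => i; rewrite mxE mulrC.
exact: (is_derive1_comp (is_derive_coord i cv) pa).
Qed.

Lemma is_derive_scale n (a : R -> R) (c : R -> 'rV[R]_n.+1) (x a' : R) v :
  is_derive x 1 a a' -> is_derive x 1 c v ->
  is_derive x 1 (fun t => a t *: c t) (a x *: v + a' *: c x).
Proof.
move=> aa cv; apply: is_derive_row => i; rewrite !mxE [a' * _]mulrC.
rewrite (_ : (fun s => _) = (a * (fun s => c s 0 i))); last by apply/funext => s; rewrite mxE.
exact: (is_deriveM aa (is_derive_coord i cv)).
Qed.

Lemma derivable_is_derive n (c : R -> 'rV[R]_n.+1) (t : R) :
  derivable c t 1 -> is_derive t 1 c (derive1 c t).
Proof. by move=> cd; apply: (DeriveDef cd); rewrite derive1E. Qed.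

Lemma derivable_is_derive1 (c : R -> R) (t : R) :
  derivable c t 1 -> is_derive t 1 c (derive1 c t).
Proof. by move=> cd; apply: (DeriveDef cd); rewrite derive1E. Qed.

Lemma is_derive_val (V : normedModType R) (c : R -> V) (t : R) v w :
  is_derive t 1 c v -> is_derive t 1 c w -> v = w.
Proof. by move=> [_ <-] [_ <-]. Qed.

Lemma is_derive_derive1 (V : normedModType R) (c : R -> V) (t : R) v :
  is_derive t 1 c v -> derive1 c t = v.
Proof. by move=> [_ <-]; rewrite derive1E. Qed.

(** * Lifts of a jet graph to the bundle, parametrized by x *)

Section JetLift.
Context (f : 'rV[R]_3 -> R) (I : set R) (y p : R -> R).
Context (c V W : R -> 'rV[R]_(3 + 1)).
Hypothesis fs : smooth_on setT f.
Hypothesis Ii : open_interval I.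
Hypothesis cb : forall x, I x -> bundle (c x).
Hypothesis cV : forall x, I x -> is_derive x 1 c (V x).
Hypothesis VW : forall x, I x -> is_derive x 1 V (W x).
Hypothesis cj : forall x, I x -> base (c x) = jet_graph y p x.

Lemma eq_on_is_derive (F G : R -> R) x d : (forall z, I z -> F z = G z) -> I x ->
  is_derive x 1 F d -> is_derive x 1 G d.
Proof.
move=> FG Ix; apply: near_eq_is_derive.
by apply: filterS (open_interval_near Ii Ix) => z; exact: FG.
Qed.

Lemma jet_coord x : I x -> [/\ c x 0 (ibase ix) = x, c x 0 (ibase iy) = y x
  & c x 0 (ibase ip) = p x].
Proof. by move=> Ix; rewrite -!base_coord cj// /jet_graph !vec3E. Qed.

Lemma jet_velocity x : I x -> [/\ V x 0 (ibase ix) = 1,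
  is_derive x 1 y (V x 0 (ibase iy)) & is_derive x 1 p (V x 0 (ibase ip))].
Proof.
move=> Ix; have D i := is_derive_coord i (cV Ix); split.
- apply: (is_derive_val (D (ibase ix))).
  apply: (eq_on_is_derive (F := id)) => // z Iz; by have [-> _ _] := jet_coord Iz.
- by apply: eq_on_is_derive (D (ibase iy)) => // z Iz; have [_ -> _] := jet_coord Iz.
- by apply: eq_on_is_derive (D (ibase ip)) => // z Iz; have [_ _ ->] := jet_coord Iz.
Qed.

Lemma jet_velocity1 x : I x -> V x 0 (ibase iy) = derive1 y x /\
  V x 0 (ibase ip) = derive1 p x.
Proof. by move=> /jet_velocity [_ /is_derive_derive1 -> /is_derive_derive1 ->]. Qed.

Lemma jet_acceleration x : I x -> [/\ W x 0 (ibase ix) = 0,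
  is_derive x 1 (derive1 y) (W x 0 (ibase iy)) &
  is_derive x 1 (derive1 p) (W x 0 (ibase ip))].
Proof.
move=> Ix; have D i := is_derive_coord i (VW Ix); split.
- apply: (is_derive_val (D (ibase ix))).
  apply: (eq_on_is_derive (F := fun=> 1)) => // z Iz; by have [-> _ _] := jet_velocity Iz.
- by apply: eq_on_is_derive (D (ibase iy)) => // z Iz; have [-> _] := jet_velocity1 Iz.
- by apply: eq_on_is_derive (D (ibase ip)) => // z Iz; have [_ ->] := jet_velocity1 Iz.
Qed.

Lemma jet_pairings x : I x ->
  [/\ pairing (lift_theta (c x)) (V x) = derive1 y x - p x,
      pairing (lift_psi f (c x)) (V x) = derive1 p x - f (jet_graph y p x)
    & pairing (lift_dx (c x)) (V x) = 1].
Proof.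
move=> Ix; have [Vx _ _] := jet_velocity Ix; have [Vy Vp] := jet_velocity1 Ix.
rewrite /pairing !sum4E /lift_theta /lift_psi /lift_dx.
rewrite !vertical_extension_base !vertical_extension_fib /theta /psi /dx !vec3E.
rewrite Vx Vy Vp cj// /jet_graph !vec3E.
by split; ring.
Qed.

(** [form_derivative] is the derivative of a pairing along the curve, and [jet_pairings] gives these
    pairings as functions of x; uniqueness of derivatives then replaces any expansion of the double
    sums. *)
Lemma jet_form_derivatives x : I x -> let q := jet_graph y p x in
  [/\ form_derivative lift_theta (c x) (V x) (W x) = derive1 (derive1 y) x - derive1 p x,
      form_derivative (lift_psi f) (c x) (V x) (W x) = derive1 (derive1 p) x
        - (partial ix f q + partial iy f q * derive1 y x + partial ip f q * derive1 p x)
    & form_derivative lift_dx (c x) (V x) (W x) = 0].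
Proof.
move=> Ix q; have [Wx dy dp] := jet_acceleration Ix.
have [Vx y1 p1] := jet_velocity Ix; have [Vy Vp] := jet_velocity1 Ix.
rewrite (is_derive_derive1 dy) (is_derive_derive1 dp).
have T := form_derivative_curve (lift_theta_differentiable (cb Ix)) (cV Ix) (VW Ix).
have P := form_derivative_curve (lift_psi_differentiable fs (cb Ix)) (cV Ix) (VW Ix).
have X := form_derivative_curve (lift_dx_differentiable (cb Ix)) (cV Ix) (VW Ix).
split.
- apply: (is_derive_val T); apply: (eq_on_is_derive (F := derive1 y - p)) => // [z Iz|].
    by have [-> _ _] := jet_pairings Iz.
  by rewrite -Vp; exact: is_deriveB.
- apply: (is_derive_val P).
  apply: (eq_on_is_derive (F := derive1 p - (f \o @base R \o c))) => // [z Iz|].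
    by have [_ -> _] := jet_pairings Iz; rewrite -cj.
  apply: is_deriveB.
  have := gradient_comp_curve (gradient_base (smooth_gradient fs (Logic.I : setT (base (c x))))) (cV Ix).
  rewrite sum4E !(unsplitK (inl _)) (unsplitK (inr _)) mul0r addr0 Vx mulr1 Vy Vp cj//.
- apply: (is_derive_val X); apply: (eq_on_is_derive (F := fun=> 1)) => // z Iz.
  by have [_ _ ->] := jet_pairings Iz.
Qed.

End JetLift.

End Curves.

(** * Null geodesics of a metric conformal to [contact_metric] *)

Section ConformalGeodesics.
Context {R : realType} (f m A : 'rV[R]_3 -> R).
Hypothesis fs : smooth_on setT f.
Hypothesis ms : smooth_on setT m.
Hypothesis As : smooth_on setT A.
Hypothesis m0 : forall q, m q != 0.
Hypothesis A0 : forall q, A q != 0.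
Notation G := (contact_metric f m A).

(** [mu] is the conformal factor times [m], whose sign is arbitrary, so it is only assumed nonzero
    at [u]. The term of [loweredZ] containing the norm of the velocity drops out by nullity. *)
Lemma conformal_geodesic (mu : 'rV[R]_(3 + 1) -> R) (g : 'rV[R]_(3 + 1) -> 'M[R]_(3 + 1))
    (u v w : 'rV[R]_(3 + 1)) : bundle u ->
  (forall x, bundle x -> g x = mu x *: G x) -> differentiable mu u -> mu u != 0 ->
  ((forall k, w 0 k + \sum_i \sum_j christoffel g u k i j * v 0 i * v 0 j = 0) /\
   \sum_i \sum_j g u i j * v 0 i * v 0 j = 0) <->
  ((forall l, mu u * lowered G u v w l + (\sum_i partial i mu u * v 0 i) * flat G u v l = 0) /\
   quadratic G u v = 0).
Proof.
move=> u0 gE mud muu.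
have gT : (g u)^T = g u by rewrite gE// linearZ/= tr_contact_metric.
have gU : g u \in unitmx.
  by rewrite gE// unitmxZ ?unitfE//; exact: contact_metric_unit.
have Gd := differentiable_contact_metric fs ms As m0 A0 u0.
have qE : \sum_i \sum_j g u i j * v 0 i * v 0 j = mu u * quadratic G u v.
  rewrite gE// /quadratic mulr_sumr; apply: eq_bigr => i _; rewrite mulr_sumr.
  by apply: eq_bigr => j _; rewrite mxE !mulrA.
have lE l : lowered g u v w l = mu u * lowered G u v w l
    + (\sum_i partial i mu u * v 0 i) * flat G u v l
    - 2^-1 * partial l mu u * quadratic G u v.
  rewrite -(loweredZ _ _ _ mud Gd); exact: lowered_open open_bundle gE u0.
have Q0 : (mu u * quadratic G u v = 0) <-> (quadratic G u v = 0).
  by split=> [/eqP|->]; rewrite ?mulr0// mulf_eq0 (negPf muu) => /eqP.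
split.
- move=> [/(geodesic_lowered v w gT gU) H]; rewrite qE => /Q0 q0; split=> // l.
  by have := H l; rewrite lE q0 mulr0 subr0.
- move=> [H q0]; split; last by rewrite qE q0 mulr0.
  by apply/(geodesic_lowered v w gT gU) => l; rewrite lE q0 mulr0 subr0.
Qed.

End ConformalGeodesics.

(** * Chains solve the system *)

Section ChainsSolveSystem.
Context {R : realType} (f : 'rV[R]_3 -> R) (eta3 : 'rV[R]_3 -> 'rV[R]_3).
Context (I : set R) (y p : R -> R).
Hypothesis fs : smooth_on setT f.
Hypothesis eta3c : contact_form ode_L1 (ode_L2 f) eta3.
Hypothesis Ii : open_interval I.

Lemma chain_solves : is_chain ode_L1 (ode_L2 f) eta3 I (jet_graph y p) ->
  solves_chain_system f I y p.
Proof.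
move=> [transverse [I' [phi [q [X [I'i [phid phiI] [_ fng] _ cq]]]]]].
have [eta1 [eta2 [g [g' [c [ad [gf gc] [cb ctd cgeo cnull] qc _]]]]]] := fng.
(* The values eta3(d_y) and eta1(d_p), which by [contact_formE] and [adapted_model] determine the
   whole coframe. *)
pose m q := eta3 q 0 iy; pose A q := eta1 q 0 ip.
have ms : smooth_on setT m by exact: contact_form_smooth eta3c.
have As : smooth_on setT A by exact: adapted_smooth ad.
have m0 : forall q, m q != 0 by exact: contact_form_neq0 eta3c.
have A0 : forall q, A q != 0 by exact: (adapted_neq0 eta3c ad).
have e3 : eta3 = model3 m by exact: contact_formE eta3c.
have [e1 e2] : eta1 = model1 f m A /\ eta2 = model2 m A by exact: (adapted_model eta3c ad).
have gE u : bundle u -> g u = m (base u) *: contact_metric f m A u.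
  move=> u0; apply: (fefferman_metric_model fs ms As m0 A0) u0.
  by move: gf; rewrite {1}e1 {1}e2 {1}e3.
have [lam [lams lam0 g'E]] := gc.
pose mu u := lam u * m (base u).
have muE u : bundle u -> g' u = mu u *: contact_metric f m A u.
  by move=> u0; rewrite g'E// gE// scalerA.
have mud u : bundle u -> differentiable mu u.
  move=> u0; have H : smooth_on (@bundle R) (fun u => m (base u)).
    exact: smooth_base open_bundle ms.
  exact: differentiableM (smooth_differentiable lams u0) (smooth_differentiable H u0).
have mu0 u : bundle u -> mu u != 0 by move=> u0; apply: mulf_neq0; [exact: lt0r_neq0 (lam0 _ u0)|exact: m0].
have phiP x : I x -> I' (phi x) by rewrite -phiI => Ix; exists x.
(* The geodesic reparametrized by x, with its velocity [V] and acceleration [W]; its projection is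
   the jet graph. *)
pose C := c \o phi.
pose V x := derive1 phi x *: derive1 c (phi x).
pose W x := derive1 phi x *: (derive1 phi x *: derive1 (derive1 c) (phi x))
            + derive1 (derive1 phi) x *: derive1 c (phi x).
have Cb x : I x -> bundle (C x) by move=> /phiP; exact: cb.
have phi1 x : I x -> is_derive x 1 phi (derive1 phi x).
  by move=> /phid[d _ _]; exact: derivable_is_derive1.
have phi2 x : I x -> is_derive x 1 (derive1 phi) (derive1 (derive1 phi) x).
  by move=> /phid[_ d _]; exact: derivable_is_derive1.
have c1 t : I' t -> is_derive t 1 c (derive1 c t).
  by move=> /ctd[d _]; exact: derivable_is_derive.
have c2 t : I' t -> is_derive t 1 (derive1 c) (derive1 (derive1 c) t).
  by move=> /ctd[_ d]; exact: derivable_is_derive.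
have CV x : I x -> is_derive x 1 C (V x).
  by move=> Ix; apply: is_derive_reparam (phi1 _ Ix); exact: c1 (phiP _ Ix).
have VW x : I x -> is_derive x 1 V (W x).
  move=> Ix; apply: is_derive_scale (phi2 _ Ix) _.
  by apply: is_derive_reparam (phi1 _ Ix); exact: c2 (phiP _ Ix).
have Cj x : I x -> base (C x) = jet_graph y p x.
  by move=> Ix; rewrite cq// qc//; exact: phiP.
move=> x Ix j; move=> /=.
have [Vx dy dp] := jet_velocity Ii CV Cj Ix.
have [Wx dy1 dp1] := jet_acceleration Ii CV VW Cj Ix.
have [tE pE xE] := jet_pairings f Ii CV Cj Ix.
have [TE PE XE] := jet_form_derivatives fs Ii Cb CV VW Cj Ix.
have D0 : derive1 y x - p x != 0.
  apply/negP => /eqP e; apply: (transverse x Ix); apply/contact_planeP.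
  have jd : is_derive x 1 (jet_graph y p) (vec3 1 (derive1 y x) (derive1 p x)).
    apply: is_derive_row; apply: ord3P; rewrite vec3E.
    - by apply: (eq_on_is_derive Ii (F := id) _ Ix (is_derive_id x 1)) => z _; rewrite vec3E.
    - rewrite (is_derive_derive1 dy).
      by apply: (eq_on_is_derive Ii (F := y) _ Ix dy) => z _; rewrite vec3E.
    - rewrite (is_derive_derive1 dp).
      by apply: (eq_on_is_derive Ii (F := p) _ Ix dp) => z _; rewrite vec3E.
  rewrite (is_derive_derive1 jd) !vec3E mulr1.
  by apply/eqP; rewrite -subr_eq0 e.
have It := phiP _ Ix; have bt := cb _ It.
have [geo null] := (conformal_geodesic fs ms As m0 A0 (derive1 c (phi x))
  (derive1 (derive1 c) (phi x)) bt muE (mud _ bt) (mu0 _ bt)).1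
  (conj (cgeo _ It) (cnull _ It)).
set v := derive1 c (phi x) in geo null; set w := derive1 (derive1 c) (phi x) in geo null.
pose a := derive1 phi x; pose b := derive1 (derive1 phi) x.
have a0 : a != 0 by have [_ _] := phid x Ix.
have VE : V x = a *: v by [].
have WE : W x = a ^+ 2 *: w + b *: v by rewrite expr2 -scalerA.
pose dmu := \sum_i partial i mu (c (phi x)) * v 0 i.
(* The proportionality factor in the parameter x: the first term comes from the derivative of the
   conformal factor along the curve, the second is phi'' / phi'. *)
pose k := - a * dmu / mu (c (phi x)) + b / a.
have lin (M L d F : R) : M != 0 -> M * L + d * F = 0 -> L = - (d / M) * F.
  move=> M0 /eqP; rewrite addr_eq0 => /eqP e.
  by apply: (mulfI M0); rewrite e; field.
have low l : lowered (contact_metric f m A) (C x) (V x) (W x) l =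
    k * flat (contact_metric f m A) (C x) (V x) l.
  rewrite VE WE lowered_reparam flatZ -/(C x).
  have -> : lowered (contact_metric f m A) (C x) v w l =
      - (dmu / mu (C x)) * flat (contact_metric f m A) (C x) v l.
    exact: (lin _ _ _ _ (mu0 _ bt) (geo l)).
  rewrite /k -/(C x); field.
  by rewrite a0 (mu0 _ bt : mu (C x) != 0).
have [E1 E2 E3 _] := (frame_equations fs ms As m0 A0 k (Cb _ Ix) Vx XE).1 low.
(* Nullity reads theta(V) rho(V) = psi(V) dx(V), and dx(V) = 1. *)
have Pr : derive1 p x - f (jet_graph y p x) =
    (derive1 y x - p x) * pairing (rho f m A (C x)) (V x).
  have : quadratic (contact_metric f m A) (C x) (V x) = 0 by rewrite VE quadraticZ null mulr0.
  rewrite quadratic_contact_metric tE pE xE mulr1 => /eqP; rewrite subr_eq0 => /eqP <-.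
  by [].
move: E1 E2 E3; rewrite tE pE (Cj _ Ix) => E1 E2 E3.
have jp : jet_graph y p x 0 ip = p x by rewrite vec3E.
rewrite jp in E3.
have [F1 F2] := chain_equations_necessary D0 Pr TE PE E1 E2 E3.
have y'E := is_derive_derive1 dy; have p'E := is_derive_derive1 dp.
split; [|exact: D0|exact: F1|exact: F2].
by split; [case: dy|case: dy1|case: dp|case: dp1].
Qed.

End ChainsSolveSystem.

(** * Solutions of the system are chains *)

Section SolutionsAreChains.
Context {R : realType} (f : 'rV[R]_3 -> R) (eta3 : 'rV[R]_3 -> 'rV[R]_3).
Context (I : set R) (y p : R -> R).
Hypothesis fs : smooth_on setT f.
Hypothesis eta3c : contact_form ode_L1 (ode_L2 f) eta3.
Hypothesis Ii : open_interval I.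

Lemma is_derive_row_mx (a : R -> 'rV[R]_3) (b : R -> R) (x : R) a' b' :
  is_derive x 1 a a' -> is_derive x 1 b b' ->
  is_derive x 1 (fun t => row_mx (a t) (const_mx (b t)) : 'rV[R]_(3 + 1))
    (row_mx a' (const_mx b')).
Proof.
move=> da db; apply: (@is_derive_row _ 3).
have E j : is_derive x 1 (fun s => (row_mx (a s) (const_mx (b s)) : 'rV[R]_(3 + 1)) 0 (ibase j))
    ((row_mx a' (const_mx b') : 'rV[R]_(3 + 1)) 0 (ibase j)).
  rewrite row_mx_base (_ : (fun s => _) = (fun s => a s 0 j)); first exact: is_derive_coord.
  by apply/funext => s; rewrite row_mx_base.
apply: ord4P; [exact: E|exact: E|exact: E|].
rewrite row_mx_fib mxE (_ : (fun s => _) = b)//.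
by apply/funext => s; rewrite row_mx_fib mxE.
Qed.

Lemma is_derive_vec3 (a b c : R -> R) (x a' b' c' : R) :
  is_derive x 1 a a' -> is_derive x 1 b b' -> is_derive x 1 c c' ->
  is_derive x 1 (fun t => vec3 (a t) (b t) (c t)) (vec3 a' b' c').
Proof.
move=> da db dc; apply: (@is_derive_row _ 2); apply: ord3P; rewrite vec3E.
- by rewrite (_ : (fun s => _) = a)//; apply/funext => s; rewrite vec3E.
- by rewrite (_ : (fun s => _) = b)//; apply/funext => s; rewrite vec3E.
- by rewrite (_ : (fun s => _) = c)//; apply/funext => s; rewrite vec3E.
Qed.

Lemma is_derive_quotient (a b : R -> R) (x a' b' : R) : b x != 0 ->
  is_derive x 1 a a' -> is_derive x 1 b b' ->
  is_derive x 1 (fun t => a t / b t) ((a' * b x - a x * b') / b x ^+ 2).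
Proof.
move=> b0 da db; apply: (is_derive_eq (is_deriveM da (is_deriveV b0 db))).
rewrite -[_ *: (_ *: _)]/(a x * (- b x ^- 2 * b')) -[_ *: a']/((b x)^-1 * a').
by field.
Qed.

Let m q := eta3 q 0 iy.
(** The freedom in the choice of adapted coframe is normalized to 1, so that [eta1] is psi + (X m /
    m) theta. *)
Let A (q : 'rV[R]_3) : R := 1.

(** The vector representing h(u): in the contact plane, eta2(X) = - m dx(X) and eta1(X) = psi(X), so
    s eta2(X) = 1 forces dx(X) = -1 / (s m), and eta1(X) / s = 1 forces psi(X) = s. *)
Definition unit_ray (u : 'rV[R]_(3 + 1)) : 'rV[R]_3 :=
  let b := - (fib u * m (base u))^-1 in
  vec3 b (b * base u 0 ip) (b * f (base u) + fib u).

Lemma unit_ray_h_graph u : bundle u ->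
  h_graph (model1 f m A) (model2 m A) (model3 m) u (unit_ray u).
Proof.
move=> u0; have m0 := contact_form_neq0 eta3c (base u); have s0 : fib u != 0 := u0.
have mE : eta3 (base u) 0 iy = m (base u) by [].
rewrite mE in m0.
have zE (c : R) (w : 'rV[R]_3) j : (c *: w) 0 j = c * w 0 j by rewrite mxE.
split; rewrite pairing3E /unit_ray !vec3E.
- rewrite /coframe1 !zE /model1 !vec3E /A.
  by generalize (e1 f m (fun=> 1) (base u)) => e; field; rewrite s0 m0.
- by rewrite /coframe2 !zE /model2 !vec3E /A; generalize_partials; field; rewrite s0 m0.
- by rewrite /coframe3 /model3 ?vec3E; field; rewrite s0 m0.
Qed.

(** Its components along L2 and L1 are -1 / (s m) and s, both nonzero. *)
Lemma unit_ray_contact_star u : bundle u ->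
  contact_star ode_L1 (ode_L2 f) (base u) (unit_ray u).
Proof.
move=> u0; have m0 := contact_form_neq0 eta3c (base u); have s0 : fib u != 0 := u0.
have mE : eta3 (base u) 0 iy = m (base u) by [].
rewrite mE in m0.
have b0 : - (fib u * m (base u))^-1 != 0 by rewrite oppr_eq0 invr_eq0 mulf_neq0.
split; first by apply/contact_planeP; rewrite /unit_ray !vec3E mulrC.
move=> [[c e]|[c e]].
- have := congr1 (fun w : 'rV[R]_3 => w 0 ix) e; rewrite !mxE /= mulr0.
  by move/eqP; rewrite (negPf b0).
- have e1 := congr1 (fun w : 'rV[R]_3 => w 0 ix) e.
  have e2 := congr1 (fun w : 'rV[R]_3 => w 0 ip) e.
  move: e1 e2; rewrite !mxE /= mulr1 => <- e2.
  have : fib u = 0 by apply: (addrI (- (fib u * m (base u))^-1 * f (base u))); rewrite addr0.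
  by move/eqP; rewrite (negPf s0).
Qed.

Lemma model_adapted : adapted_coframe ode_L1 (ode_L2 f) (model1 f m A) (model2 m A) eta3.
Proof.
have ms : smooth_on setT m := contact_form_smooth eta3c.
have m0 : forall q, m q != 0 := contact_form_neq0 eta3c.
have As : smooth_on setT A := smooth_cst 1.
have A0 q : A q != 0 by exact: oner_neq0.
split.
- exact: smooth_model1.
- exact: smooth_model2.
- move=> q; rewrite -kermx_eq0; apply/eqP/row_matrixP => i; rewrite row0.
  set v := row i _; have vE : v *m col_mx (model1 f m A q) (col_mx (model2 m A q) (eta3 q)) = 0.
    by apply/sub_kermxP; exact: row_sub.
  rewrite -[v]hsubmxK -[rsubmx v]hsubmxK !mul_row_col in vE *.
  move: (lsubmx v) (lsubmx (rsubmx v)) (rsubmx (rsubmx v)) vE => a b c.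
  rewrite [a]mx11_scalar [b]mx11_scalar [c]mx11_scalar !mul_scalar_mx.
  move: (a 0 0) (b 0 0) (c 0 0) => {}a {}b {}c E.
  have Ej j : a * model1 f m A q 0 j + (b * model2 m A q 0 j + c * eta3 q 0 j) = 0.
    by have := congr1 (fun w : 'rV[R]_3 => w 0 j) E; rewrite !mxE.
  have eE : eta3 q = model3 m q by rewrite -(contact_formE eta3c).
  rewrite eE in Ej.
  have a0 : a = 0.
    by have := Ej ip; rewrite /model1 /model2 /model3 !vec3E /A mulr1 !mulr0 !addr0.
  have b0 : b = 0.
    (* Evaluation on d_x + p d_y, where [eta3] vanishes and [eta2] equals [- m q]. *)
    have : b * (- m q) = 0.
      have e1 := Ej ix; have e2 := Ej iy; move: e1 e2.
      rewrite a0 !mul0r !add0r /model2 /model3 !vec3E /A invr1 !mulr1 => e1 e2.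
      transitivity (0 + q 0 ip * 0 : R); last by rewrite mulr0 addr0.
      by rewrite -{1}e1 -e2; generalize_partials; ring.
    by move/eqP; rewrite mulf_eq0 oppr_eq0 (negPf (m0 q)) orbF => /eqP.
  have c0 : c = 0.
    have := Ej iy; rewrite a0 b0 !mul0r !add0r /model3 vec3E => /eqP.
    by rewrite mulf_eq0 (negPf (m0 q)) orbF => /eqP.
  by rewrite a0 b0 c0 !raddf0 !row_mx0.
- move=> q; apply/matrixP; rewrite (contact_formE eta3c) -/m.
  have A1 := extd_model3 ms q.
  have W : pairs_of_axes (fun i j => extd (model3 m) q i j =
      wedge (model1 f m A q) (model2 m A q) i j).
    split; rewrite A1 wedgeE /model1 /model2 !vec3E /e1 /mX /A invr1 !mulr1 !mul1r;
    have := m0 q; generalize_partials; generalize (m q) (f q) (q 0 ip) => *; by field.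
  have tE i j : extd (model3 m) q i j = - extd (model3 m) q j i by exact: extd_swap.
  have tW i j : wedge (model1 f m A q) (model2 m A q) i j =
      - wedge (model1 f m A q) (model2 m A q) j i by rewrite !wedgeE; ring.
  have dW i : wedge (model1 f m A q) (model2 m A q) i i = 0 by rewrite wedgeE mulrC subrr.
  case: W => xy xp yp; apply: ord3P; apply: ord3P;
    by [rewrite extd_diag dW|exact: xy|exact: xp|exact: yp|rewrite tE tW xy|rewrite tE tW xp|rewrite tE tW yp].
- move=> q; split=> v [c ->]; rewrite pairing3E !mxE /=.
  + by rewrite /A; generalize (e1 f m (fun=> 1) q) => e; ring.
  + by ring.
Qed.

Lemma model_fefferman_metric : exists g, fefferman_metric (model1 f m A) (model2 m A) eta3 g.
Proof.
have ms : smooth_on setT m := contact_form_smooth eta3c.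
have m0 : forall q, m q != 0 := contact_form_neq0 eta3c.
have As : smooth_on setT A := smooth_cst 1.
have A0 q : A q != 0 by exact: oner_neq0.
have [a1 [a2 [b1 [b2 [K S]]]]] := model_structure_equations fs ms As m0 A0.
exists (fun u => symprod (omega1 (model1 f m A) u) (omega2 (model2 m A) u)
  + symprod (omega3 eta3 u) (- (2 / 3) *: model_connection f m A u
      + (6^-1 * K u) *: omega3 eta3 u)).
exists (model_connection f m A), a1, a2, b1, b2, K; split=> //.
- exact: model_connection_form.
- by rewrite (contact_formE eta3c).
Qed.

Lemma solution_chain : solves_chain_system f I y p ->
  is_chain ode_L1 (ode_L2 f) eta3 I (jet_graph y p).
Proof.
move=> S.
have ms : smooth_on setT m := contact_form_smooth eta3c.
have m0 : forall q, m q != 0 := contact_form_neq0 eta3c.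
have As : smooth_on setT A := smooth_cst 1.
have A0 q : A q != 0 by exact: oner_neq0.
pose j := jet_graph y p.
pose D x := derive1 y x - p x; pose P x := derive1 p x - f (j x).
have D0 x : I x -> D x != 0 by move=> /S[].
have dy x : I x -> is_derive x 1 y (derive1 y x).
  by move=> /S[[d _ _ _] _ _ _]; exact: derivable_is_derive1.
have dy1 x : I x -> is_derive x 1 (derive1 y) (derive1 (derive1 y) x).
  by move=> /S[[_ d _ _] _ _ _]; exact: derivable_is_derive1.
have dp x : I x -> is_derive x 1 p (derive1 p x).
  by move=> /S[[_ _ d _] _ _ _]; exact: derivable_is_derive1.
have dp1 x : I x -> is_derive x 1 (derive1 p) (derive1 (derive1 p) x).
  by move=> /S[[_ _ _ d] _ _ _]; exact: derivable_is_derive1.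
pose vj x : 'rV[R]_3 := vec3 1 (derive1 y x) (derive1 p x).
pose wj x : 'rV[R]_3 := vec3 0 (derive1 (derive1 y) x) (derive1 (derive1 p) x).
have dj x : I x -> is_derive x 1 j (vj x).
  by move=> Ix; have := is_derive_vec3 (is_derive_id x 1) (dy _ Ix) (dp _ Ix); exact.
have dvj x : I x -> is_derive x 1 vj (wj x).
  by move=> Ix; have := is_derive_vec3 (is_derive_cst (1 : R) x 1) (dy1 _ Ix) (dp1 _ Ix); exact.
pose rb x := pairing (rho_base f m A (j x)) (vj x).
have drb x : I x -> derivable rb x 1.
  move=> Ix; have rd : differentiable_form (rho_base f m A) (j x).
    exact/smooth_form_differentiable/smooth_rho_base.
  by case: (form_derivative_curve rd (dj _ Ix) (dvj _ Ix)).
have dP x : I x -> derivable P x 1.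
  move=> Ix; have [d _] := gradient_comp_curve (smooth_gradient fs (Logic.I : setT (j x))) (dj _ Ix).
  by apply: derivableB d; case: (dp1 _ Ix).
have dD x : I x -> derivable D x 1.
  by move=> Ix; apply: derivableB; [case: (dy1 _ Ix)|case: (dp _ Ix)].
(* The fibre coordinate s solves the linear equation that makes the lifted
   curve null. *)
pose h x := - (3 / 2) * (P x / D x - rb x).
have dh x : I x -> is_derive x 1 h (derive1 h x).
  move=> Ix; apply: derivable_is_derive1; apply: derivableM; first exact: derivable_cst.
  apply: derivableB; last exact: drb.
  by apply: derivableM; [exact: dP|apply: derivableV; [exact: D0|exact: dD]].
have [H dH] : exists H : R -> R, forall x, I x -> is_derive x 1 H (h x).
  apply: antiderivative => // x Ix.
  by apply/differentiable_continuous/derivable1_diffP; case: (dh _ Ix).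
(* Then s' / s = [h], and the coefficient -2/3 of ds/s in [rho] turns this into [P x / D x - rb x],
   which completes rho(V) to [P x / D x]. The exponential also keeps s away from zero. *)
pose s x := expR (H x).
have s0 x : s x != 0 by rewrite gt_eqF// expR_gt0.
have ds x : I x -> is_derive x 1 s (s x * h x).
  by move=> Ix; exact: (is_derive1_comp (is_derive_expR (H x)) (dH _ Ix)).
have dsh x : I x -> is_derive x 1 (fun x => s x * h x)
    (s x * derive1 h x + h x * (s x * h x)).
  by move=> Ix; exact: (is_deriveM (ds _ Ix) (dh _ Ix)).
pose C x : 'rV[R]_(3 + 1) := row_mx (j x) (const_mx (s x)).
pose V x : 'rV[R]_(3 + 1) := row_mx (vj x) (const_mx (s x * h x)).
pose W x : 'rV[R]_(3 + 1) := row_mx (wj x) (const_mx (s x * derive1 h x + h x * (s x * h x))).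
have CV x : I x -> is_derive x 1 C (V x).
  by move=> Ix; exact: is_derive_row_mx (dj _ Ix) (ds _ Ix).
have VW x : I x -> is_derive x 1 V (W x).
  by move=> Ix; exact: is_derive_row_mx (dvj _ Ix) (dsh _ Ix).
have Cfib x : fib (C x) = s x by rewrite fib_row_mx mxE.
have Cb x : bundle (C x) by rewrite /bundle/= Cfib.
have Cj x : base (C x) = j x by exact: base_row_mx.
have cb x (_ : I x) := Cb x.
have cj x (_ : I x) := Cj x.
have pr x : I x -> pairing (rho f m A (C x)) (V x) = P x / D x.
  move=> Ix; have -> : pairing (rho f m A (C x)) (V x) = rb x - 2 / 3 * h x.
    rewrite /pairing sum4E /rho !vertical_extension_base vertical_extension_fib.
    have vb k : V x 0 (ibase k) = vj x 0 k by rewrite row_mx_base.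
    have vf : V x 0 ifib = s x * h x by rewrite row_mx_fib mxE.
    rewrite Cj Cfib !vb vf /rb pairing3E; congr (_ + _).
    by generalize (s0 x); generalize (h x) (s x) => a b b0; field.
  by rewrite /h; generalize (rb x) (P x / D x) => *; field.
have th x : I x -> is_derive x 1 D (derive1 (derive1 y) x - derive1 p x).
  by move=> Ix; exact: is_deriveB (dy1 _ Ix) (dp _ Ix).
(* The logarithmic derivative of [D], as forced by the first frame equation. *)
pose k x := (derive1 (derive1 y) x - derive1 p x) / D x.
have low x l : I x -> lowered (contact_metric f m A) (C x) (V x) (W x) l =
    k x * flat (contact_metric f m A) (C x) (V x) l.
  move=> Ix; have [Vx _ _] := jet_velocity Ii CV cj Ix.
  have [tE pE xE] := jet_pairings f Ii CV cj Ix.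
  have [TE PE XE] := jet_form_derivatives fs Ii cb CV VW cj Ix.
  have rE := pr x Ix.
  have T := form_derivative_curve (lift_theta_differentiable (Cb x)) (CV _ Ix) (VW _ Ix).
  have Q := form_derivative_curve (lift_psi_differentiable fs (Cb x)) (CV _ Ix) (VW _ Ix).
  have rd := form_derivative_curve (rho_differentiable fs ms As m0 A0 (Cb x)) (CV _ Ix) (VW _ Ix).
  (* The lift was built with rho(V) = P / D on all of [I], so the quotient rule computes the
     derivative of rho(V). *)
  have dr : form_derivative (rho f m A) (C x) (V x) (W x) =
      (form_derivative (lift_psi f) (C x) (V x) (W x) * D x
       - P x * form_derivative lift_theta (C x) (V x) (W x)) / D x ^+ 2.
    apply: (is_derive_val rd).
    apply: (eq_on_is_derive Ii (F := fun z => P z / D z) _ Ix) => [z Iz|].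
      by rewrite pr.
    apply: is_derive_quotient; [exact: D0| |].
    - apply: (eq_on_is_derive Ii _ Ix Q) => z Iz.
      by have [_ -> _] := jet_pairings f Ii CV cj Iz.
    - apply: (eq_on_is_derive Ii _ Ix T) => z Iz.
      by have [-> _ _] := jet_pairings f Ii CV cj Iz.
  have [_ _ F1 F2] := S x Ix.
  move: l; apply/(frame_equations fs ms As m0 A0 (k x) (Cb x) Vx XE).
  rewrite tE pE Cj (_ : j x 0 ip = p x); last by rewrite vec3E.
  have kE : k x = form_derivative lift_theta (C x) (V x) (W x) / (derive1 y x - p x).
    by rewrite TE.
  exact: chain_equations_sufficient (D0 _ Ix) rE TE PE kE dr F1 F2.
have null x : I x -> quadratic (contact_metric f m A) (C x) (V x) = 0.
  move=> Ix; have [tE pE xE] := jet_pairings f Ii CV cj Ix.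
  rewrite quadratic_contact_metric tE pE xE pr// mulr1 -/(D x) -/(j x) -/(P x).
  by rewrite mulrC divfK ?subrr// D0.
pose mu (u : 'rV[R]_(3 + 1)) := m (base u).
have mus : smooth_on (@bundle R) mu by exact: smooth_base open_bundle ms.
have mud u : bundle u -> differentiable mu u by exact: smooth_differentiable mus.
pose dm x := \sum_i partial i mu (C x) * V x 0 i.
(* In the parameter x, the failure of the lift to be affine for [mu] times the contact metric is the
   sum of the logarithmic derivatives of [mu] and of [D]. A parameter phi with phi' = [mu] [D]
   absorbs both. *)
pose k0 x := mu (C x) * D x.
have k00 x : I x -> k0 x != 0 by move=> Ix; rewrite mulf_neq0 ?D0//; exact: m0.
have dk0 x : I x -> is_derive x 1 k0
    (mu (C x) * (derive1 (derive1 y) x - derive1 p x) + D x * dm x).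
  move=> Ix; have M := gradient_comp_curve (smooth_gradient mus (Cb x)) (CV _ Ix).
  exact: (is_deriveM M (th _ Ix)).
have [phi dphi] : exists phi : R -> R, forall x, I x -> is_derive x 1 phi (k0 x).
  apply: antiderivative => // x Ix.
  by apply/differentiable_continuous/derivable1_diffP; case: (dk0 _ Ix).
pose inv := inverse_on I phi.
have invK x : I x -> inv (phi x) = x by exact: (inverse_onK Ii dphi k00).
have Ji : open_interval (phi @` I) := open_interval_image Ii dphi k00.
have invI t : (phi @` I) t -> I (inv t) by move=> [x Ix <-]; rewrite invK.
have dinv t : (phi @` I) t -> is_derive t 1 inv (k0 (inv t))^-1.
  by move=> [x Ix <-]; rewrite invK//; exact: (is_derive_inverse_on Ii dphi k00 Ix).
pose a t := (k0 (inv t))^-1.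
pose k0' x := mu (C x) * (derive1 (derive1 y) x - derive1 p x) + D x * dm x.
have da t : (phi @` I) t -> is_derive t 1 a (- (k0 (inv t)) ^- 2 * (k0' (inv t) * a t)).
  move=> Jt; have It := invI _ Jt.
  exact: (@is_deriveV R (k0 \o inv) t _ 1 (k00 _ It)
    (is_derive1_comp (dk0 _ It) (dinv _ Jt))).
pose c := C \o inv.
have dc t : (phi @` I) t -> is_derive t 1 c (a t *: V (inv t)).
  by move=> Jt; exact: is_derive_reparam (CV _ (invI _ Jt)) (dinv _ Jt).
pose b t := - (k0 (inv t)) ^- 2 * (k0' (inv t) * a t).
have daV t : (phi @` I) t -> is_derive t 1 (fun t => a t *: V (inv t))
    (a t *: (a t *: W (inv t)) + b t *: V (inv t)).
  move=> Jt; apply: is_derive_scale (da _ Jt) _.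
  exact: is_derive_reparam (VW _ (invI _ Jt)) (dinv _ Jt).
have c1E t : (phi @` I) t -> derive1 c t = a t *: V (inv t).
  by move=> /dc; exact: is_derive_derive1.
have dc1 t : (phi @` I) t -> is_derive t 1 (derive1 c)
    (a t *: (a t *: W (inv t)) + b t *: V (inv t)).
  move=> Jt; apply: near_eq_is_derive (daV _ Jt).
  by apply: filterS (open_interval_near Ji Jt) => z /c1E.
have [g gf] := model_fefferman_metric.
have gE u : bundle u -> g u = mu u *: contact_metric f m A u.
  move=> u0; apply: (fefferman_metric_model fs ms As m0 A0) u0.
  by move: gf; rewrite {1}(contact_formE eta3c).
have geo t : (phi @` I) t ->
    (forall k, derive1 (derive1 c) t 0 k + \sum_i \sum_j christoffel g (c t) k i j
       * derive1 c t 0 i * derive1 c t 0 j = 0) /\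
    \sum_i \sum_j g (c t) i j * derive1 c t 0 i * derive1 c t 0 j = 0.
  move=> Jt; have It := invI _ Jt.
  have bt : bundle (c t) by exact: Cb.
  apply/(conformal_geodesic fs ms As m0 A0 (derive1 c t) (derive1 (derive1 c) t) bt gE
    (mud _ bt) (m0 _)).
  rewrite (is_derive_derive1 (dc1 _ Jt)) (c1E _ Jt) -/(c t).
  split; last by rewrite quadraticZ null// mulr0.
  move=> l; rewrite [a t *: (a t *: _)]scalerA -expr2 lowered_reparam flatZ low//.
  have -> : \sum_i partial i mu (c t) * (a t *: V (inv t)) 0 i = a t * dm (inv t).
    by rewrite mulr_sumr; apply: eq_bigr => i _; rewrite mxE mulrCA.
  have ct : c t = C (inv t) by [].
  (* With [a] = 1 / [k0] and [b] its derivative in the new parameter, the three multiples of the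
     dual velocity, from [k], from the reparametrization and from d(mu), add up to zero. *)
  rewrite /b /a /k0' /k0 /k !ct.
  move: (m0 (base (C (inv t)))) (D0 _ It); rewrite -/(mu (C (inv t))).
  generalize (flat (contact_metric f m A) (C (inv t)) (V (inv t)) l) (dm (inv t))
    (D (inv t)) (mu (C (inv t))) (derive1 (derive1 y) (inv t) - derive1 p (inv t)).
  move=> F d DD M T M0 DD0; field.
  by rewrite M0 DD0.
have phi1 x : I x -> derive1 phi x = k0 x by move=> /dphi; exact: is_derive_derive1.
have cI x : I x -> c (phi x) = C x by move=> Ix; rewrite /c/= invK.
split.
  move=> x Ix; rewrite (is_derive_derive1 (dj _ Ix)) => /contact_planeP.
  by rewrite !vec3E mulr1 => e; have := D0 _ Ix; rewrite /D e subrr eqxx.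
(* The geodesic is taken for the Fefferman metric itself, with conformal factor 1, and lies in the
   image of h. *)
exists (phi @` I), phi, (fun t => base (c t)), (fun t => unit_ray (c t)).
split=> //.
- split=> // x Ix; split; first by case: (dphi _ Ix).
    have : is_derive x 1 (derive1 phi) (k0' x).
      by apply: (eq_on_is_derive Ii _ Ix (dk0 _ Ix)) => z /phi1.
    by case.
  by rewrite phi1//; exact: k00.
- split; first by move=> t Jt; apply: unit_ray_contact_star; exact: Cb.
  exists (model1 f m A), (model2 m A), g, g, c; split=> //.
  + exact: model_adapted.
  + split=> //; exists (fun=> 1); split=> [|u _|u _]; [exact: smooth_cst|exact: ltr01|].
    by rewrite scale1r.
  + split=> [t Jt|t Jt|t Jt|t Jt].
    * exact: Cb.
    * by split; [case: (dc _ Jt)|case: (dc1 _ Jt)].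
    * by have [] := geo _ Jt.
    * by have [] := geo _ Jt.
  + left=> t Jt; exists (unit_ray (c t)); last by exists 1; rewrite ?scale1r.
    by rewrite (contact_formE eta3c); apply: unit_ray_h_graph; exact: Cb.
(* The first coordinate of the projection is x, which takes two different values on an open
   interval, so the curve is not contained in a fibre. *)
- move=> [q0 qE]; have [_ _ [x Ix]] := Ii.
  have [z [z' [Iz _ zx _]]] := open_interval_itv Ii Ix.
  have e w : I w -> base (c (phi w)) = q0 by move=> Iw; apply: qE; exists w.
  have := congr1 (fun w : 'rV[R]_3 => w 0 ix) (etrans (e _ Ix) (esym (e _ Iz))).
  rewrite !cI// !Cj !vec3E => xz.
  by move: zx; rewrite xz ltxx.
- by move=> x Ix; rewrite cI.
Qed.

End SolutionsAreChains.

Theorem proposition3p6 (R : realType) (f : 'rV[R]_3 -> R)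
    (eta3 : 'rV[R]_3 -> 'rV[R]_3) (I : set R) (y p : R -> R) :
  smooth_on setT f ->
  contact_form ode_L1 (ode_L2 f) eta3 ->
  open_interval I ->
  is_chain ode_L1 (ode_L2 f) eta3 I (jet_graph y p) <->
  solves_chain_system f I y p.
Proof.
by move=> fs eta3c Ii; split; [exact: chain_solves|exact: solution_chain].
Qed.
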